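(* Let $\mathcal{H}_0$ be a separable Hilbert space and $X=(X_t)_{t\in\mathbb{Z}}$ be a centered $\mathcal{H}_0$-valued weakly stationary time series defined on $(\Omega,\mathcal{F},\mathbb{P})$ with spectral operator density $g_X$ with respect to a $\sigma$-finite non-negative measure $\mu$ on $(\mathbb{T},\mathcal{B}(\mathbb{T}))$. Let $D$ be a bounded normal operator on $\mathcal{H}_0$ with singular value function $\mathrm{d}$ on $\mathcal{G}_0:=L^2(\mathsf{V},\mathcal{V},\xi)$ and decomposition operator $U$. Let $h\in L^2(\mathbb{T},\mathcal{B}(\mathbb{T}),\mathcal{S}_2(\mathcal{G}_0),\mu)$ be such that $\lambda\mapsto h(\lambda)[h(\lambda)]^{\mathsf{H}}$ is the spectral operator density of $UX=(UX_t)_{t\in\mathbb{Z}}$ with respect to $\mu$, that is, $h(\lambda)[h(\lambda)]^{\mathsf{H}}=U\,g_X(\lambda)\,U^{\mathsf{H}}$ for $\mu$-a.e. $\lambda\in\mathbb{T}$. Let $\kappa_h$ denote the $\mathbb{T}$-joint kernel of $h$. Then the following assertions are equivalent. (i) $X\in\mathcal{S}_{\mathrm{FI}_D}(\Omega,\mathcal{F},\mathbb{P})$. (ii) There exists $\eta\in(0,\pi)$ such that $$\int_{\mathsf{V}^2\times((-\eta,\eta)\setminus\{0\})}|\lambda|^{-2\Re(\mathrm{d}(v))}\,|\kappa_h(v,v';\lambda)|^2\;\xi(\mathrm{d}v)\,\xi(\mathrm{d}v')\,\mu(\mathrm{d}\lambda)<\infty .$$ (iii) $$\int_{\mathsf{V}^2\times((-\pi,\pi)\setminus\{0\})}|\lambda|^{-2\Re_+(\mathrm{d}(v))}\,|\kappa_h(v,v';\lambda)|^2\;\xi(\mathrm{d}v)\,\xi(\mathrm{d}v')\,\mu(\mathrm{d}\lambda)<\infty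 ,$$ where $\Re_+(z)=\max(0,(z+\bar z)/2)$ for $z\in\mathbb{C}$.
   Context: Hilbert spaces are complex. $\mathcal{L}_b(\cdot)$, $\mathcal{S}_1(\cdot)$, $\mathcal{S}_2(\cdot)$ denote bounded, trace-class and Hilbert–Schmidt operators, with norms $\|\cdot\|_\infty,\|\cdot\|_1,\|\cdot\|_2$; $\mathcal{S}_1^+$ denotes positive semidefinite trace-class operators; $\mathrm{P}^{\mathsf{H}}$ is the adjoint. $\mathbb{T}=\mathbb{R}/2\pi\mathbb{Z}$, represented by $[-\pi,\pi)$. Weak stationarity and spectral density: $X$ is weakly stationary if $X_t\in L^2(\Omega,\mathcal{F},\mathcal{H}_0,\mathbb{P})$, $\mathbb{E}[X_t]=\mathbb{E}[X_0]$ and $\mathrm{Cov}(X_{t+h},X_t)=\mathrm{Cov}(X_h,X_0)$ for all $t,h\in\mathbb{Z}$, where $\langle\mathrm{Cov}(X,Y)y,x\rangle=\mathrm{Cov}(\langle X,x\rangle,\langle Y,y\rangle)$. Its spectral operator measure $\nu_X:\mathcal{B}(\mathbb{T})\to\mathcal{S}_1^+(\mathcal{H}_0)$ is the $\|\cdot\|_1$-$\sigma$-additive measure with $\mathrm{Cov}(X_h,X_0)=\int e^{ih\lambda}\,\nu_X(\mathrm{d}\lambda)$ for all $h\in\mathbb{Z}$. $g_X\in L^1(\mathbb{T},\mathcal{B}(\mathbb{T}),\mathcal{S}_1^+(\mathcal{H}_0),\mu)$ is the spectral operator density of $X$ with respect to $\mu$ if $\nu_X(A)=\int_Ag_X\,\mathrm{d}\mu$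 for all $A$; it is implicit that $\mu$ dominates the measure $A\mapsto\|\nu_X(A)\|_1$. Fractional integration: for $D\in\mathcal{L}_b(\mathcal{H}_0)$ and $z\in\mathbb{C}\setminus[1,\infty)$, $(1-z)^D=\exp(D\ln(1-z))$ with $\ln$ the principal logarithm. $\mathrm{FI}_D(\lambda)=(1-e^{-i\lambda})^{-D}$ for $\lambda\ne0$ and $\mathrm{FI}_D(0)=0$. For a function $\Phi:\mathbb{T}\to\mathcal{L}_b(\mathcal{H}_0)$ with $\lambda\mapsto\Phi(\lambda)x$ measurable for every $x$, $\mathcal{S}_\Phi(\Omega,\mathcal{F},\mathbb{P})$ is the class of centered weakly stationary processes to which the linear filter with transfer operator function $\Phi$ can be applied, i.e. those $X$ such that $\int\|\Phi g_X\Phi^{\mathsf{H}}\|_1\,\mathrm{d}\mu<\infty$ (a condition which does not depend on the choice of dominating $\mu$). Singular value decomposition: $D$ has singular value function $\mathrm{d}$ on $L^2(\mathsf{V},\mathcal{V},\xi)$ with decomposition operator $U$ if $(\mathsf{V},\mathcal{V},\xi)$ is a $\sigma$-finite measure space, $\mathrm{d}\in L^\infty(\mathsf{V},\mathcal{V},\xi)$, $U:\mathcal{H}_0\to L^2(\mathsf{V},\mathcal{V},\xi)$ is unitary and $UDU^{\mathsf{H}}$ is the multiplication operator $f\mapsto\mathrm{d}\times f$. Joint kernel: for a measurable $K:\mathbb{T}\to\mathcal{S}_2(\mathcal{G}_0)$, its $\mathbb{T}$-joint kernel is a jointly measurable function $\kappa_K:\mathsf{V}^2\times\mathbb{T}\to\mathbb{C}$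 such that, for every $\lambda$, $K(\lambda)$ is the integral operator $[K(\lambda)f](v)=\int\kappa_K(v,v';\lambda)f(v')\,\xi(\mathrm{d}v')$, $f\in\mathcal{G}_0$ (it exists, and for each $\lambda$ is unique up to a $\xi^{\otimes2}$-null set). *)

(* Defs.v *)
From HB Require Import structures.
From mathcomp Require Import all_boot all_order all_algebra.
From mathcomp Require Import complex ring_quotient generic_quotient sesquilinear.
From mathcomp Require Import all_classical all_reals all_analysis.
From mathcomp Require Import measurable_realfun lebesgue_integral.
From mathcomp Require Import ring lra.

Set Implicit Arguments.
Unset Strict Implicit.
Unset Printing Implicit Defensive.

Import Order.TTheory GRing.Theory Num.Theory.
Import numFieldNormedType.Exports.

Local Open Scope classical_set_scope.
Local Open Scope ring_scope.

Local Notation Re := (@complex.Re _).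
Local Notation Im := (@complex.Im _).

(* [ip] is linear in its first argument, conjugate-linear in the second. *)
HB.mixin Record NormedModule_isPreHilbert (R : realType) H
    & NormedModule R[i] H := {
  ip : {dot H for Num.conj} ;
  ip_norm : forall x : H, `|x| ^+ 2 = ip x x
}.

#[short(type="preHilbertType")]
HB.structure Definition PreHilbert (R : realType) :=
  {H of NormedModule R[i] H & NormedModule_isPreHilbert R H}.

#[short(type="hilbertType")]
HB.structure Definition Hilbert (R : realType) :=
  {H of PreHilbert R H & Complete H}.

Definition rnorm (R : realType) (E : normedZmodType R[i]) (x : E) : R :=
  Re `|x|.


Section complex_integral.
Context d (T : measurableType d) (R : realType).
Variable mu : {measure set T -> \bar R}.

Definition cmeasurable_fun (D : set T) (f : T -> R[i]) :=
  measurable_fun D (Re \o f) /\ measurable_fun D (Im \o f).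

Definition cintegrable (D : set T) (f : T -> R[i]) :=
  mu.-integrable D (EFin \o (Re \o f)) /\
  mu.-integrable D (EFin \o (Im \o f)).

Definition cintegral (D : set T) (f : T -> R[i]) : R[i] :=
  ((\int[mu]_(x in D) Re (f x)) +i* (\int[mu]_(x in D) Im (f x)))%C.

End complex_integral.

Section cintegral_theory.
Context d (T : measurableType d) (R : realType).
Variable mu : {measure set T -> \bar R}.
Implicit Types f g : T -> R[i].
Local Open Scope complex_scope.

Let ReD (a b : R[i]) : Re (a + b) = Re a + Re b.
Proof. by case: a => ? ?; case: b. Qed.
Let ImD (a b : R[i]) : Im (a + b) = Im a + Im b.
Proof. by case: a => ? ?; case: b. Qed.
Let ReM (a b : R[i]) : Re (a * b) = Re a * Re b - Im a * Im b.
Proof. by case: a => ? ?; case: b. Qed.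
Let ImM (a b : R[i]) : Im (a * b) = Re a * Im b + Im a * Re b.
Proof. by case: a => ? ?; case: b => ? ? /=; rewrite [X in _ + X]mulrC. Qed.
Let ReJ (a : R[i]) : Re a^* = Re a.
Proof. by case: a. Qed.
Let ImJ (a : R[i]) : Im a^* = - Im a.
Proof. by case: a. Qed.

Lemma rnormE (z : R[i]) : rnorm z ^+ 2 = Re z ^+ 2 + Im z ^+ 2.
Proof.
by case: z => a b; rewrite /rnorm normc_def /= sqr_sqrtr ?addr_ge0 ?sqr_ge0.
Qed.

Lemma cmeasurable_funD f g : cmeasurable_fun setT f ->
  cmeasurable_fun setT g -> cmeasurable_fun setT (f + g).
Proof.
move=> [f1 f2] [g1 g2]; split.
  rewrite (_ : _ \o _ = (Re \o f) \+ (Re \o g)); first exact: measurable_funD.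
  by apply/funext => x /=; rewrite ReD.
rewrite (_ : _ \o _ = (Im \o f) \+ (Im \o g)); first exact: measurable_funD.
by apply/funext => x /=; rewrite ImD.
Qed.

Lemma cmeasurable_funM f g : cmeasurable_fun setT f ->
  cmeasurable_fun setT g -> cmeasurable_fun setT (fun x => f x * g x).
Proof.
move=> [f1 f2] [g1 g2]; split.
  rewrite (_ : _ \o _ =
    (fun x => (Re \o f) x * (Re \o g) x - (Im \o f) x * (Im \o g) x)).
    by apply: measurable_funB; apply: measurable_funM.
  by apply/funext => x /=; rewrite ReM.
rewrite (_ : _ \o _ =
  (fun x => (Re \o f) x * (Im \o g) x + (Im \o f) x * (Re \o g) x)).
  by apply: measurable_funD; apply: measurable_funM.
by apply/funext => x /=; rewrite ImM.
Qed.

Lemma cmeasurable_cst (c : R[i]) : cmeasurable_fun setT (fun _ : T => c).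
Proof. by split; exact: measurable_cst. Qed.

Lemma cmeasurable_conj f : cmeasurable_fun setT f ->
  cmeasurable_fun setT (fun x => (f x)^*).
Proof.
move=> [f1 f2]; split.
  by rewrite (_ : _ \o _ = Re \o f)//; apply/funext => x /=; rewrite ReJ.
rewrite (_ : _ \o _ = \- (Im \o f)); first exact: measurableT_comp.
by apply/funext => x /=; rewrite ImJ.
Qed.

Lemma measurable_rnorm2 f : cmeasurable_fun setT f ->
  measurable_fun setT (fun x => rnorm (f x) ^+ 2).
Proof.
move=> [f1 f2]; rewrite (_ : (fun x => _) =
  (fun x => (Re \o f) x ^+ 2 + (Im \o f) x ^+ 2)).
  by apply: measurable_funD; apply: measurable_funX.
by apply/funext => x /=; rewrite rnormE.
Qed.

Lemma cintegrableD f g : cintegrable mu setT f ->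
  cintegrable mu setT g -> cintegrable mu setT (f + g).
Proof.
move=> [f1 f2] [g1 g2]; split.
  rewrite (_ : _ \o _ = (EFin \o (Re \o f)) \+ (EFin \o (Re \o g)))%E.
    exact: integrableD.
  by apply/funext => x /=; rewrite ReD EFinD.
rewrite (_ : _ \o _ = (EFin \o (Im \o f)) \+ (EFin \o (Im \o g)))%E.
  exact: integrableD.
by apply/funext => x /=; rewrite ImD EFinD.
Qed.

Lemma cintegralD f g : cintegrable mu setT f -> cintegrable mu setT g ->
  cintegral mu setT (f + g) = cintegral mu setT f + cintegral mu setT g.
Proof.
move=> [f1 f2] [g1 g2]; apply/eqP; rewrite eq_complex /=; apply/andP; split.
  rewrite -RintegralD//; apply/eqP/eq_Rintegral => x _; exact: ReD.
rewrite -RintegralD//; apply/eqP/eq_Rintegral => x _; exact: ImD.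
Qed.

Lemma cintegrableZ c f : cintegrable mu setT f ->
  cintegrable mu setT (fun x => c * f x).
Proof.
move=> [f1 f2].
have Z (a : R) (h : T -> R) : mu.-integrable setT (EFin \o h) ->
    mu.-integrable setT (EFin \o (fun x => a * h x)).
  move=> ih; rewrite (_ : _ \o _ = (fun x => a%:E * (EFin \o h) x)%E)//.
  exact: integrableZl.
split.
  have := integrableB measurableT (Z (Re c) _ f1) (Z (Im c) _ f2).
  congr (mu.-integrable _ _); apply/funext => x /=.
  by rewrite -EFinB; congr EFin; rewrite ReM.
have := integrableD measurableT (Z (Re c) _ f2) (Z (Im c) _ f1).
congr (mu.-integrable _ _); apply/funext => x /=.
by rewrite -EFinD; congr EFin; rewrite ImM.
Qed.

Lemma cintegralZ c f : cintegrable mu setT f ->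
  cintegral mu setT (fun x => c * f x) = c * cintegral mu setT f.
Proof.
move=> [f1 f2].
have Z (a : R) (h : T -> R) : mu.-integrable setT (EFin \o h) ->
    mu.-integrable setT (EFin \o (fun x => a * h x)).
  move=> ih; rewrite (_ : _ \o _ = (fun x => a%:E * (EFin \o h) x)%E)//.
  exact: integrableZl.
apply/eqP; rewrite eq_complex ReM ImM/=; apply/andP; split.
  rewrite -!RintegralZl// -RintegralB//; [|exact: Z|exact: Z].
  by apply/eqP/eq_Rintegral => x _; exact: ReM.
rewrite -!RintegralZl// -RintegralD//; [|exact: Z|exact: Z].
by apply/eqP/eq_Rintegral => x _; exact: ImM.
Qed.

Lemma cintegral_conj f : cintegrable mu setT f ->
  cintegral mu setT (fun x => (f x)^*) = (cintegral mu setT f)^*.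
Proof.
move=> [f1 f2]; apply/eqP; rewrite eq_complex ReJ ImJ/=; apply/andP; split.
  by apply/eqP/eq_Rintegral => x _; rewrite ReJ.
rewrite -[X in _ == X]mulN1r -RintegralZl//.
by apply/eqP/eq_Rintegral => x _; rewrite ImJ mulN1r.
Qed.

Lemma eq_cintegral_ae f g : cmeasurable_fun setT f -> cmeasurable_fun setT g ->
  {ae mu, forall x, f x = g x} -> cintegral mu setT f = cintegral mu setT g.
Proof.
move=> [f1 f2] [g1 g2] fg; rewrite /cintegral /Rintegral; congr (fine _ +i* fine _).
  apply: ae_eq_integral => //; try exact/measurable_EFinP.
  by apply: filterS fg => x -> _.
apply: ae_eq_integral => //; try exact/measurable_EFinP.
by apply: filterS fg => x -> _.
Qed.

Lemma cintegrable_mulJ f g : cmeasurable_fun setT f -> cmeasurable_fun setT g ->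
  (\int[mu]_x (rnorm (f x) ^+ 2)%:E < +oo)%E ->
  (\int[mu]_x (rnorm (g x) ^+ 2)%:E < +oo)%E ->
  cintegrable mu setT (fun x => f x * (g x)^*).
Proof.
move=> mf mg nf ng.
have I : mu.-integrable setT
    (fun x => (rnorm (f x) ^+ 2)%:E + (rnorm (g x) ^+ 2)%:E)%E.
  apply: integrableD => //; apply/integrableP; split.
  - exact/measurable_EFinP/measurable_rnorm2.
  - by under eq_integral do rewrite /= ger0_norm ?sqr_ge0//.
  - exact/measurable_EFinP/measurable_rnorm2.
  - by under eq_integral do rewrite /= ger0_norm ?sqr_ge0//.
have [mR mI] := cmeasurable_funM mf (cmeasurable_conj mg).
have H (a b c e : R) : `|a * b - c * e| <= a ^+ 2 + c ^+ 2 + (b ^+ 2 + e ^+ 2).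
  have H1 : 0 <= (a + b) ^+ 2 by exact: sqr_ge0.
  have H2 : 0 <= (a - b) ^+ 2 by exact: sqr_ge0.
  have H3 : 0 <= (c + e) ^+ 2 by exact: sqr_ge0.
  have H4 : 0 <= (c - e) ^+ 2 by exact: sqr_ge0.
  have A := sqr_ge0 a; have B := sqr_ge0 b.
  have C := sqr_ge0 c; have E := sqr_ge0 e.
  by rewrite ler_norml; apply/andP; split; nra.
split; apply: le_integrable I => //; try exact/measurable_EFinP.
- move=> x _ /=; rewrite lee_fin (ger0_norm (addr_ge0 (sqr_ge0 _) (sqr_ge0 _))).
  rewrite ReM ReJ ImJ mulrN opprK !rnormE -[X in X * Im (g x)]opprK mulNr; apply: le_trans (H _ _ _ _) _.
  by rewrite sqrrN.
- move=> x _ /=; rewrite lee_fin (ger0_norm (addr_ge0 (sqr_ge0 _) (sqr_ge0 _))).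
  rewrite ImM ReJ ImJ mulrN addrC !rnormE; apply: le_trans (H _ _ _ _) _.
  by lra.
Qed.

End cintegral_theory.

Section sqint.
Context d (V : measurableType d) (R : realType).
Variable xi : {measure set V -> \bar R}.
Local Open Scope complex_scope.

Definition sqint_pred : {pred V -> R[i]} := fun f =>
  `[< cmeasurable_fun setT f /\
      (\int[xi]_v (rnorm (f v) ^+ 2)%:E < +oo)%E >].

Lemma sqint_submod_closed : submod_closed sqint_pred.
Proof.
split.
  apply/asboolP; split; first exact: (@cmeasurable_cst _ V R 0).
  rewrite integral0_eq// => x _; by rewrite rnormE /= expr0n addr0.
move=> c f g /asboolP[mf nf] /asboolP[mg ng]; apply/asboolP.
have mcf : cmeasurable_fun setT (c *: f).
  exact: (cmeasurable_funM (cmeasurable_cst V c) mf).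
split; first exact: cmeasurable_funD.
pose k := 2 * rnorm c ^+ 2.
have k0 : 0 <= k by rewrite mulr_ge0// sqr_ge0.
apply: (@le_lt_trans _ _ (\int[xi]_v (k%:E * (rnorm (f v) ^+ 2)%:E +
    2%:E * (rnorm (g v) ^+ 2)%:E))%E).
  apply: ge0_le_integral => //.
  - by move=> x _; rewrite lee_fin sqr_ge0.
  - by apply: measurableT_comp => //; apply: measurable_rnorm2; exact: cmeasurable_funD.
  - by apply: emeasurable_funD; apply: measurable_funeM;
      apply: measurableT_comp => //; exact: measurable_rnorm2.
  - move=> x _; rewrite -!EFinM -EFinD lee_fin /k !rnormE.
    rewrite [(_ + g) x]/GRing.add /= [(c *: f) x]/GRing.scale /=.
    case: (f x) => a b; case: (g x) => a' b'; case: c {mcf k k0} => s t /=.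
    have H1 := sqr_ge0 (s * a - t * b - a').
    have H2 := sqr_ge0 (s * b + t * a - b').
    by rewrite -subr_ge0; lra.
rewrite ge0_integralD//=.
- rewrite !ge0_integralZl//=.
  + by rewrite lte_add_pinfty// lte_mul_pinfty// lee_fin.
  + by apply: measurableT_comp => //; exact: measurable_rnorm2.
  + by move=> x _; rewrite lee_fin sqr_ge0.
  + by apply: measurableT_comp => //; exact: measurable_rnorm2.
  + by move=> x _; rewrite lee_fin sqr_ge0.
- by move=> x _; rewrite mule_ge0// lee_fin ?sqr_ge0.
- by apply: measurable_funeM; apply: measurableT_comp => //; exact: measurable_rnorm2.
- by move=> x _; rewrite lee_fin mulr_ge0// sqr_ge0.
- by apply: measurable_funeM; apply: measurableT_comp => //; exact: measurable_rnorm2.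
Qed.

HB.instance Definition _ :=
  GRing.isSubmodClosed.Build R[i] (V -> R[i]) sqint_pred sqint_submod_closed.

Record sqint := Sqint { sqint_val :> V -> R[i]; _ : sqint_val \in sqint_pred }.
HB.instance Definition _ := [isSub of sqint for sqint_val].
HB.instance Definition _ := [Choice of sqint by <:].
HB.instance Definition _ := [SubChoice_isSubLmodule of sqint by <:].

Definition aenull_pred : {pred sqint} :=
  fun f => `[< {ae xi, forall v, f v = 0} >].

Lemma aenull_zmod_closed : zmod_closed aenull_pred.
Proof.
split; first by apply/asboolP; apply: aeW.
move=> f g /asboolP f0 /asboolP g0; apply/asboolP.
by apply: filterS2 f0 g0 => v fv gv; rewrite /= /GRing.add /= /GRing.opp /= fv gv subr0.
Qed.

HB.instance Definition _ :=
  GRing.isZmodClosed.Build sqint aenull_pred aenull_zmod_closed.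

End sqint.

Section dot_triangle.
Variables (C : numClosedFieldType) (U : lmodType C).
Variable form : {dot U for Num.conj}.
Local Notation "''[' u , v ]" := (form u v) : ring_scope.

Lemma dot_CauchySchwarz u v : `|'[u, v]| ^+ 2 <= '[u, u] * '[v, v].
Proof.
have [->|v0] := eqVneq v 0; first by rewrite !linear0r normr0 expr0n /= ?mulr0 ?mul0r.
have nv : 0 < '[v, v] by rewrite neq0_dnorm_gt0.
have := dnorm_ge0 form ('[v, v] *: u - '[u, v] *: v).
have cross : '['[v, v] *: u, '[u, v] *: v] = '[v, v] * `|'[u, v]| ^+ 2.
  by rewrite linearZl_LR linearZr_LR /= normCK [_^* * _]mulrC.
rewrite dnormB !dnormZ cross.
set a := '[u, u]; set b := '[v, v]; set t := `|'[u, v]| ^+ 2.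
have br : b^* = b by apply/CrealP/ger0_real/ltW.
have tr : t^* = t by apply/CrealP/ger0_real; rewrite exprn_ge0.
have btr : (b * t)^* = b * t by rewrite rmorphM /= br tr.
rewrite [X in _ - (_ + X)]btr (ger0_norm (ltW nv)) => h.
rewrite -subr_ge0 -(pmulr_rge0 _ nv) -/b; apply: le_trans h _.
by rewrite le_eqVlt; apply/orP; left; apply/eqP; ring.
Qed.

Lemma dot_triangle u v :
  sqrtC '[u + v, u + v] <= sqrtC '[u, u] + sqrtC '[v, v].
Proof.
rewrite -ler_sqr ?nnegrE ?addr_ge0 ?sqrtC_ge0 ?dnorm_ge0//.
rewrite sqrrD !sqrtCK addrAC dnormD lerD2l.
apply: (@le_trans _ _ (`|'[u, v]| *+ 2)); last first.
  rewrite lerMn2r /=.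
  rewrite -ler_sqr ?nnegrE ?mulr_ge0 ?sqrtC_ge0 ?dnorm_ge0//.
  by rewrite exprMn !sqrtCK dot_CauchySchwarz.
have := leif_Re_Creal '[u, v]; rewrite ReE => -[+ _].
by rewrite ler_pdivrMr ?ltr0n// mulr_natr.
Qed.

End dot_triangle.

Section L2.
Context d (V : measurableType d) (R : realType).
Variable xi : {measure set V -> \bar R}.
Local Open Scope quotient_scope.
Local Open Scope complex_scope.

(* Almost-everywhere classes of square-integrable complex functions. This space
   is complete, but no definition below needs that fact. *)
Definition L2 : Type := Quotient.quot (@aenull_pred _ V R xi).

HB.instance Definition _ := GRing.Zmodule.on L2.
HB.instance Definition _ := EqQuotient.on L2.

Definition L2_fun (x : L2) : V -> R[i] := sqint_val (repr x).
Coercion L2_fun : L2 >-> Funclass.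

Definition L2_class (f : sqint xi) : L2 := \pi_L2 f.

Implicit Types x y z : L2.

Lemma L2_classE f : {ae xi, forall v, L2_class f v = f v}.
Proof.
have : \pi_L2 (repr (L2_class f)) = \pi_L2 f by rewrite reprK.
move/eqP; rewrite -Quotient.idealrBE => /asboolP; apply: filterS => v.
by rewrite /= [X in X = _]/GRing.add /= /GRing.opp /= => /eqP; rewrite subr_eq0 => /eqP.
Qed.

Lemma L2_eqP x y : x = y <-> {ae xi, forall v, x v = y v}.
Proof.
split=> [->|xy]; first exact: aeW.
rewrite -(reprK x) -(reprK y); apply/eqP; rewrite -Quotient.idealrBE.
apply/asboolP; apply: filterS xy => v xy.
by rewrite /= /GRing.add /= /GRing.opp /= -!/(L2_fun _ _) xy subrr.
Qed.

Lemma L2_cmeasurable x : cmeasurable_fun setT x.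
Proof. by rewrite /L2_fun; case: (repr x) => f /= /asboolP[]. Qed.

Lemma L2_sqint x : (\int[xi]_v (rnorm (x v) ^+ 2)%:E < +oo)%E.
Proof. by rewrite /L2_fun; case: (repr x) => f /= /asboolP[]. Qed.

Lemma L2D x y : {ae xi, forall v, (x + y : L2) v = x v + y v}.
Proof.
suff -> : x + y = L2_class (repr x + repr y) by exact: L2_classE.
by rewrite /L2_class raddfD /= !reprK.
Qed.

Lemma L2_zero : {ae xi, forall v, (0 : L2) v = 0}.
Proof.
suff -> : 0 = L2_class 0 by exact: L2_classE.
by rewrite /L2_class raddf0.
Qed.

Definition L2_scale (c : R[i]) (x : L2) : L2 := L2_class (c *: repr x).

Lemma L2_scaleE c x : {ae xi, forall v, L2_scale c x v = c * x v}.
Proof. exact: L2_classE. Qed.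

Let aeI (P Q : V -> Prop) : {ae xi, forall v, P v} ->
  {ae xi, forall v, Q v} -> {ae xi, forall v, P v /\ Q v}.
Proof. by move=> p q; apply: filterS2 p q => v. Qed.

Let scaleA a b x : L2_scale a (L2_scale b x) = L2_scale (a * b) x.
Proof.
apply/L2_eqP; apply: filterS3 (L2_scaleE a (L2_scale b x)) (L2_scaleE b x)
  (L2_scaleE (a * b) x) => v -> -> ->; exact: mulrA.
Qed.

Let scale1 : left_id 1 L2_scale.
Proof.
move=> x; apply/L2_eqP; apply: filterS (L2_scaleE 1 x) => v ->; exact: mul1r.
Qed.

Let scaleDr : right_distributive L2_scale +%R.
Proof.
move=> c x y; apply/L2_eqP.
have h := aeI (aeI (L2_scaleE c x) (L2_scaleE c y))
  (aeI (L2D (L2_scale c x) (L2_scale c y))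
  (aeI (L2D x y) (L2_scaleE c (x + y)))).
by apply: filterS h => v [[h1 h2] [h3 [h4 h5]]]; rewrite h5 h4 h3 h1 h2 mulrDr.
Qed.

Let scaleDl x : {morph (fun a => L2_scale a x) : a b / a + b}.
Proof.
move=> a b; apply/L2_eqP.
have h := aeI (aeI (L2_scaleE a x) (L2_scaleE b x))
  (aeI (L2_scaleE (a + b) x) (L2D (L2_scale a x) (L2_scale b x))).
by apply: filterS h => v [[h1 h2] [h3 h4]]; rewrite h3 h4 h1 h2 mulrDl.
Qed.

HB.instance Definition _ :=
  GRing.Zmodule_isLmodule.Build R[i] L2 scaleA scale1 scaleDr scaleDl.

Lemma L2Z c x : {ae xi, forall v, (c *: x : L2) v = c * x v}.
Proof. exact: L2_scaleE. Qed.

Definition L2_ip (x y : L2) : R[i] := cintegral xi setT (fun v => x v * (y v)^*).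

Lemma L2_ip_integrable x y : cintegrable xi setT (fun v => x v * (y v)^*).
Proof.
apply: cintegrable_mulJ; by [exact: L2_cmeasurable|exact: L2_sqint].
Qed.

Lemma L2_ip_linear c x y z :
  L2_ip (c *: x + z) y = c * L2_ip x y + L2_ip z y.
Proof.
rewrite /L2_ip -cintegralZ; last exact: L2_ip_integrable.
have mM x' y' : cmeasurable_fun setT (fun v => x' v * (y' v)^*).
  by apply: cmeasurable_funM; [|apply: cmeasurable_conj]; exact: L2_cmeasurable.
rewrite -cintegralD; last exact: L2_ip_integrable.
  apply: eq_cintegral_ae; first exact: mM.
    apply: cmeasurable_funD => //.
    exact: (cmeasurable_funM (cmeasurable_cst V c) (mM x y)).
  apply: filterS2 (L2D (c *: x) z) (L2Z c x) => v -> ->.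
  by rewrite mulrDl -mulrA.
exact: cintegrableZ (L2_ip_integrable x y).
Qed.

Lemma L2_ipC x y : L2_ip x y = (L2_ip y x)^*.
Proof.
rewrite /L2_ip -cintegral_conj; last exact: L2_ip_integrable.
congr cintegral; apply/funext => v.
by rewrite (rmorphM (@conjc R)) /= conjcK mulrC.
Qed.

Lemma L2_ip_linearr x c y z :
  L2_ip x (c *: y + z) = c^* * L2_ip x y + L2_ip x z.
Proof.
rewrite [LHS]L2_ipC (L2_ipC x y) (L2_ipC x z) L2_ip_linear.
by rewrite (rmorphD (@conjc R)) (rmorphM (@conjc R)).
Qed.

Lemma L2_ip_gt0 x : x != 0 -> 0 < L2_ip x x.
Proof.
move=> x0.
have E : (fun v => x v * (x v)^*) = (fun v => (rnorm (x v) ^+ 2)%:C).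
  apply/funext => v; rewrite rnormE; case: (x v) => a b /=; simpc.
  by rewrite -!expr2 [b * a]mulrC addNr.
have mx : measurable_fun setT (fun v => (rnorm (x v) ^+ 2)%:E).
  by apply: measurableT_comp => //; exact/measurable_rnorm2/L2_cmeasurable.
have fx : (\int[xi]_v (rnorm (x v) ^+ 2)%:E)%E \is a fin_num.
  rewrite ge0_fin_numE; first exact: L2_sqint.
  by apply: integral_ge0 => v _; rewrite lee_fin sqr_ge0.
rewrite /L2_ip E /cintegral ltcE /= Rintegral_cst// mul0r eqxx /=.
rewrite /Rintegral fine_gt0// -ge0_fin_numE// ?fx ?andbT; last first.
  by apply: integral_ge0 => v _; rewrite lee_fin sqr_ge0.
rewrite lt_neqAle integral_ge0 ?andbT; last first.
  by move=> v _; rewrite lee_fin sqr_ge0.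
apply: contra_neq x0 => /esym i0; apply/L2_eqP.
have /(ae_eq_integral_abs xi measurableT mx) : (\int[xi]_v `|(rnorm (x v) ^+ 2)%:E| = 0)%E.
  by under eq_integral do rewrite /= ger0_norm ?sqr_ge0//.
move=> ae0; apply: filterS2 (L2_zero) ae0 => v -> /(_ I) [] /eqP.
by rewrite sqrf_eq0 => /eqP; rewrite /rnorm normc_def /= => /(congr1 (real_complex R)); rewrite -normc_def => /eqP; rewrite normr_eq0 => /eqP ->.
Qed.

HB.instance Definition _ := bilinear_isBilinear.Build R[i] L2 L2 R[i]
  *%R (Num.conj \; *%R) L2_ip
  (fun y c x z => L2_ip_linear c x y z, L2_ip_linearr).

Lemma L2_hermitian x y : L2_ip x y = (-1) ^+ false * Num.conj (L2_ip y x).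
Proof. by rewrite expr0 mul1r L2_ipC. Qed.

HB.instance Definition _ := isHermitianSesquilinear.Build R[i] L2 false Num.conj
  L2_ip L2_hermitian.

HB.instance Definition _ := isDotProduct.Build R[i] L2 L2_ip L2_ip_gt0.

Lemma L2_ip_ge0 x : 0 <= L2_ip x x.
Proof. exact: (dnorm_ge0 (L2_ip : {dot L2 for Num.conj})). Qed.

Lemma L2_normD x y : sqrtC (L2_ip (x + y) (x + y)) <=
  sqrtC (L2_ip x x) + sqrtC (L2_ip y y).
Proof. exact: dot_triangle. Qed.

Lemma L2_normZ c x : sqrtC (L2_ip (c *: x) (c *: x)) = `|c| * sqrtC (L2_ip x x).
Proof.
have -> : L2_ip (c *: x) (c *: x) = `|c| ^+ 2 * L2_ip x x.
  exact: (dnormZ (L2_ip : {dot L2 for Num.conj})).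
by rewrite sqrtCM ?nnegrE ?exprn_ge0 ?L2_ip_ge0// sqrCK.
Qed.

Lemma L2_norm_eq0 x : sqrtC (L2_ip x x) = 0 -> x = 0.
Proof.
move=> /eqP; rewrite sqrtC_eq0 => /eqP x0; apply/eqP/negPn/negP => /L2_ip_gt0.
by rewrite x0 ltxx.
Qed.

HB.instance Definition _ := Lmodule_isNormed.Build R[i] L2
  L2_normD L2_normZ L2_norm_eq0.

Lemma L2_ip_norm x : `|x| ^+ 2 = L2_ip x x.
Proof. exact: sqrtCK. Qed.

HB.instance Definition _ := NormedModule_isPreHilbert.Build R L2 L2_ip_norm.

End L2.

Section bochner.
Context d (T : measurableType d) (R : realType).
Variable mu : {measure set T -> \bar R}.
(* [N] is an extended-valued norm on [E]; the normed space at hand is the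
   subspace of [E] where it is finite, e.g. the trace-class operators among all
   the maps H -> H. *)
Variables (E : lmodType R[i]) (N : E -> \bar R).

(* A simple function is given by a finite list of (measurable set, value). *)
Definition is_sfun (s : seq (set T * E)) :=
  forall p, p \in s -> measurable p.1 /\ (N p.2 < +oo)%E.

Definition sfun_eval (s : seq (set T * E)) (t : T) : E :=
  \sum_(p <- s) if `[< p.1 t >] then p.2 else 0.

Definition sfun_integral (A : set T) (s : seq (set T * E)) : E :=
  \sum_(p <- s) (fine (mu (A `&` p.1)))%:C%C *: p.2.

Definition strongly_measurable (f : T -> E) :=
  exists2 s : nat -> seq (set T * E), (forall n, is_sfun (s n)) &
    forall t, N (sfun_eval (s n) t - f t) @[n --> \oo] --> 0%E.

Definition bochner_Lp (p : nat) (f : T -> E) :=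
  strongly_measurable f /\ (\int[mu]_t (N (f t) ^+ p) < +oo)%E.

Definition is_bochner_integral (A : set T) (f : T -> E) (I : E) :=
  strongly_measurable f /\
  exists s : nat -> seq (set T * E),
  [/\ forall n, is_sfun (s n),
      forall n p, p \in s n -> (mu (A `&` p.1) < +oo)%E,
      (\int[mu]_(t in A) N (sfun_eval (s n) t - f t))%E @[n --> \oo] --> 0%E &
      N (sfun_integral A (s n) - I) @[n --> \oo] --> 0%E].

Definition bochner_integral (A : set T) (f : T -> E) : E :=
  xget 0 [set I | is_bochner_integral A f I].

End bochner.

Section operators.
Variable R : realType.
Implicit Types H G : preHilbertType R.

Definition bounded_op H G (A : H -> G) :=
  linear A /\ exists M : R, forall x, rnorm (A x) <= M * rnorm x.

Definition adj H G (A : H -> G) : G -> H :=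
  xget 0 [set B | forall x y, ip (A x) y = ip x (B y)].

Definition normal_op H (A : H -> H) := A \o adj A = adj A \o A.

Definition unitary_op H G (A : H -> G) :=
  [/\ linear A, forall x y, ip (A x) (A y) = ip x y &
      forall y, exists x, A x = y].

Definition positive_op H (A : H -> H) :=
  bounded_op A /\ forall x, 0 <= ip (A x) x.

(* Totality is maximality, which is equivalent to a dense span in complete
   spaces. *)
Definition orthonormal_basis H (B : set H) :=
  (forall e f, B e -> B f -> ip e f = (e == f)%:R) /\
  forall x, (forall e, B e -> ip x e = 0) -> x = 0.

(* The traces and norms below do not depend on the chosen basis. *)
Definition onb H : set H := xget set0 [set B | orthonormal_basis B].
Arguments onb H : clear implicits.

Definition abs_op H (A : H -> H) : H -> H :=
  xget 0 [set S | positive_op S /\ S \o S = adj A \o A].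

(* The Schatten norms are +oo outside the bounded operators. *)
Definition trnorm H (A : H -> H) : \bar R :=
  if `[< bounded_op A >]
  then \esum_(e in onb H) (Re (ip (abs_op A e) e))%:E else +oo%E.

Definition hsnorm H (A : H -> H) : \bar R :=
  if `[< bounded_op A >]
  then sqrte (\esum_(e in onb H) (rnorm (A e) ^+ 2)%:E) else +oo%E.

Definition S1plus H : set (H -> H) :=
  [set A | positive_op A /\ (trnorm A < +oo)%E].

Definition S2 H : set (H -> H) := [set A | (hsnorm A < +oo)%E].

End operators.

Section torus.
Variable R : realType.

Record angle := Angle { angle_val : R; _ : angle_val \in `[- pi, pi[ }.
HB.instance Definition _ := [isSub of angle for angle_val].
HB.instance Definition _ := [Choice of angle by <:].

Lemma angle0_subproof : (0 : R) \in `[- pi, pi[.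
Proof. by rewrite in_itv /= oppr_le0 pi_ge0 pi_gt0. Qed.
HB.instance Definition _ := isPointed.Build angle (Angle angle0_subproof).

Definition torus : Type :=
  g_sigma_algebra_preimageType (angle_val : angle -> measurableTypeR R).
HB.instance Definition _ := Measurable.on torus.

Definition torus_val (l : torus) : R := angle_val l.

Definition punctured (eta : R) : set torus :=
  [set l | 0 < `|torus_val l| < eta].

End torus.

Section second_order_processes.
Context d (Omega : measurableType d) (R : realType) (P : probability Omega R).

Definition expectation_C (Z : Omega -> R[i]) : R[i] := cintegral P setT Z.

Definition covariance_C (Z W : Omega -> R[i]) : R[i] :=
  expectation_C (fun w =>
    (Z w - expectation_C Z) * (W w - expectation_C W)^*%C).

Variable H : hilbertType R.
Let N (x : H) : \bar R := (rnorm x)%:E.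

Definition expectation_H (Y : Omega -> H) : H := bochner_integral P N setT Y.

Definition Cov (Y Z : Omega -> H) : H -> H :=
  xget 0 [set C | bounded_op C /\ forall x y,
    ip (C y) x = covariance_C (fun w => ip (Y w) x) (fun w => ip (Z w) y)].

Definition centered (X : int -> Omega -> H) := forall t, expectation_H (X t) = 0.

Definition weakly_stationary (X : int -> Omega -> H) :=
  [/\ forall t, bochner_Lp P N 2 (X t),
      forall t, expectation_H (X t) = expectation_H (X 0) &
      forall t h, Cov (X (t + h)) (X t) = Cov (X h) (X 0)].

End second_order_processes.

Definition expi (R : realType) (t : R) : R[i] := (cos t +i* sin t)%C.

Section spectral_density.
Context (R : realType) (H : hilbertType R).

Definition is_operator_measure (nu : set (torus R) -> H -> H) :=
  (forall A, measurable A -> S1plus (nu A)) /\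
  forall F : nat -> set (torus R), (forall n, measurable (F n)) ->
    trivIset setT F ->
    trnorm (\sum_(k < n) nu (F k) - nu (\bigcup_k F k)) @[n --> \oo] --> 0%E.

(* Integral of a bounded scalar function: limit of the integrals of simple
   functions converging uniformly to it. *)
Definition is_operator_integral (nu : set (torus R) -> H -> H)
    (f : torus R -> R[i]) (I : H -> H) :=
  exists s : nat -> seq (set (torus R) * R[i]),
  [/\ forall n p, p \in s n -> measurable p.1,
      forall e : R, 0 < e -> \forall n \near \oo, forall l,
        rnorm (sfun_eval (s n) l - f l) < e &
      trnorm (\sum_(p <- s n) p.2 *: nu p.1 - I) @[n --> \oo] --> 0%E].

Context d (Omega : measurableType d) (P : probability Omega R).
Implicit Types X : int -> Omega -> H.

Definition is_spectral_measure X (nu : set (torus R) -> H -> H) :=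
  is_operator_measure nu /\
  forall h : int, is_operator_integral nu
    (fun l => expi (h%:~R * torus_val l)) (Cov P (X h) (X 0)).

(* The spectral measure of X is unique on measurable sets. *)
Definition spectral_measure X : set (torus R) -> H -> H :=
  xget 0 [set nu | is_spectral_measure X nu].

Definition is_spectral_density X
    (mu : {measure set (torus R) -> \bar R}) (g : torus R -> H -> H) :=
  [/\ forall l, S1plus (g l),
      bochner_Lp mu (@trnorm R H) 1 g,
      is_spectral_measure X (spectral_measure X) &
      forall A, measurable A ->
        is_bochner_integral mu (@trnorm R H) A g (spectral_measure X A)].

(* S_Phi(Omega, F, P); the condition does not depend on the choice of the
   dominating measure mu. *)
Definition S_filter (Phi : torus R -> H -> H) : set (int -> Omega -> H) :=
  [set X | [/\ centered P X, weakly_stationary P X &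
    exists (mu : {sigma_finite_measure set (torus R) -> \bar R})
      (g : torus R -> H -> H), is_spectral_density X mu g /\
      (\int[mu]_l trnorm (Phi l \o g l \o adj (Phi l)) < +oo)%E]].

End spectral_density.

Section fractional_integration.
Context (R : realType) (H : hilbertType R).

(* The argument in ]-pi, pi]. *)
Definition carg (z : R[i]) : R :=
  if 0 <= Im z then acos (Re z / rnorm z) else - acos (Re z / rnorm z).

Definition cln (z : R[i]) : R[i] := (ln (rnorm z) +i* carg z)%C.

(* The exponential series converges in operator norm, hence pointwise. *)
Definition op_exp (A : H -> H) : H -> H :=
  fun x => limn (series (fun k => (k`!%:R : R[i])^-1 *: iter k A x)).

(* (1 - z)^A *)
Definition op_pow1B (z : R[i]) (A : H -> H) : H -> H :=
  op_exp (cln (1 - z) *: A).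

Definition FI (D : H -> H) (l : torus R) : H -> H :=
  if torus_val l == 0 then 0 else op_pow1B (expi (- torus_val l)) (- D).

End fractional_integration.

Section singular_value_decomposition.
Context d (V : measurableType d) (R : realType).
Variable xi : {measure set V -> \bar R}.

Definition ess_bounded (f : V -> R[i]) :=
  cmeasurable_fun setT f /\
  exists M : R, {ae xi, forall v, rnorm (f v) <= M}.

Definition singular_value_decomposition (H : hilbertType R) (D : H -> H)
    (dv : V -> R[i]) (U : H -> L2 xi) :=
  [/\ ess_bounded dv, unitary_op U &
      forall f : L2 xi, {ae xi, forall v, U (D (adj U f)) v = dv v * f v}].

Definition is_joint_kernel (K : torus R -> L2 xi -> L2 xi)
    (kappa : V * V * torus R -> R[i]) :=
  cmeasurable_fun setT kappa /\
  forall l (f : L2 xi), {ae xi, forall v,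
    cintegrable xi setT (fun v' => kappa (v, v', l) * f v') /\
    K l f v = cintegral xi setT (fun v' => kappa (v, v', l) * f v')}.

End singular_value_decomposition.

Definition separable (T : topologicalType) :=
  exists2 A : set T, countable A & dense A.

Definition Re_plus (R : realType) (z : R[i]) : R := Num.max 0 (Re z).

(* Main.v *)
(* Transport everything to L^2(xi) by U. For l <> 0 the operator U FI_D(l) U^H is
   the multiplication by the exponential of z = - d ln(1 - e^{-il}), so, the
   Hilbert-Schmidt norm being computed row by row on the kernel, the trace norm of
   FI_D(l) g_X(l) FI_D(l)^H is the integral over v of exp(2 Re z(v)) times
   |kappa_h(v, v'; l)|^2 integrated in v'. As |l|/2 <= |1 - e^{-il}| <= |l| and d is
   bounded, exp(2 Re z) is comparable with |l|^{-2 Re d(v)}, uniformly in v and l.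
   Away from l = 0 all the weights are bounded and the square of the
   Hilbert-Schmidt norm of h is integrable, so only a neighbourhood of 0 matters;
   there |l|^{-2 Re_+ d} is the maximum of |l|^{-2 Re d} and 1.

   The dominating measure in (i) is arbitrary. If g and g' are densities of the
   same operator measure with respect to mu and mu', with trace densities theta and
   theta', then theta' g = theta g' almost everywhere, as one sees on the quadratic
   forms at countably many points.

   The trace norm being defined through |A|, a positive operator must be shown to
   be its own absolute value, that is, positive square roots must be unique; they
   are constructed by a fixed-point iteration. *)
Require Import Defs.
From HB Require Import structures.
From mathcomp Require Import all_boot all_order all_algebra.
From mathcomp Require Import complex.
From mathcomp Require Import all_classical all_reals all_analysis.
From mathcomp Require Import measurable_realfun.
From mathcomp Require Import ring lra.

Set Implicit Arguments.
Unset Strict Implicit.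
Unset Printing Implicit Defensive.

Import Order.TTheory GRing.Theory Num.Theory.
Import numFieldNormedType.Exports HBSimple HBNNSimple.

Local Open Scope classical_set_scope.
Local Open Scope ring_scope.

Local Notation Re := (@complex.Re _).
Local Notation Im := (@complex.Im _).
Local Notation conj := (@conjc _).

(** The kernel is only known to represent [h l] against each fixed f, off a null set that depends on
    f, and the sigma-algebra of V need not be countably generated. Before Parseval can be applied to
    a kernel row, that row must be shown to lie in L^2. Riesz-Fischer provides an abstract L^2 row
    with the same integrals over each set of finite measure, but it is a mere choice in v, with no
    joint measurability. So the kernel row is tested against simple functions on V^2 approximating
    the kernel itself, which costs countably many null sets.

    Measurability of the trace norm of FI_D g FI_D^H is never established. Comparisons of integrals
    rest on the integral of a nonnegative function being a supremum over the simple functions below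
    it, and the change of dominating measure is an inequality that carries over a measurable
    minorant.

    Completeness of L^2(xi) is inherited from H_0 through U. Conditions (i), (ii), (iii) are each
    compared with finiteness of the integral with exponent Re d over all l <> 0, including the angle
    -pi, which the set in (iii) leaves out. *)

Section rnorm_theory.
Context (R : realType).
Implicit Types E : normedModType R[i].

Lemma rnormC (E : normedZmodType R[i]) (x : E) : `|x| = (rnorm x)%:C%C.
Proof. by rewrite /rnorm RRe_real// normr_real. Qed.

Lemma rnorm_ge0 (E : normedZmodType R[i]) (x : E) : 0 <= rnorm x.
Proof. by rewrite -lecR -rnormC normr_ge0. Qed.

Lemma rnorm0 (E : normedZmodType R[i]) : rnorm (0 : E) = 0.
Proof. by apply: complexI; rewrite -rnormC normr0. Qed.

Lemma rnorm_eq0 (E : normedZmodType R[i]) (x : E) : rnorm x = 0 -> x = 0.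
Proof. by move=> x0; apply/eqP; rewrite -normr_eq0 rnormC x0. Qed.

Lemma rnormD (E : normedZmodType R[i]) (x y : E) :
  rnorm (x + y) <= rnorm x + rnorm y.
Proof. by rewrite -lecR rmorphD /= -!rnormC ler_normD. Qed.

Lemma rnormN (E : normedZmodType R[i]) (x : E) : rnorm (- x) = rnorm x.
Proof. by apply: complexI; rewrite -!rnormC normrN. Qed.

Lemma rnormBC (E : normedZmodType R[i]) (x y : E) : rnorm (x - y) = rnorm (y - x).
Proof. by rewrite -rnormN opprB. Qed.

Lemma rnorm_dist (E : normedZmodType R[i]) (x y : E) :
  `|rnorm x - rnorm y| <= rnorm (x - y).
Proof.
rewrite ler_norml; apply/andP; split.
  by rewrite lerNl opprB lerBlDr rnormBC -{1}[y](subrK x); exact: rnormD.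
by rewrite lerBlDr -{1}[x](subrK y); exact: rnormD.
Qed.

Lemma rnormZ E (c : R[i]) (x : E) : rnorm (c *: x) = rnorm c * rnorm x.
Proof. by apply: complexI; rewrite rmorphM /= -!rnormC normrZ. Qed.

Lemma rnormM (a b : R[i]) : rnorm (a * b) = rnorm a * rnorm b.
Proof. by apply: complexI; rewrite rmorphM /= -!rnormC normrM. Qed.

Lemma rnormX (a : R[i]) n : rnorm (a ^+ n) = rnorm a ^+ n.
Proof. by apply: complexI; rewrite rmorphXn /= -!rnormC normrX. Qed.

Lemma rnormJ (a : R[i]) : rnorm (conj a) = rnorm a.
Proof. by apply: (@pexpIrn _ 2) => //; rewrite ?nnegrE ?rnorm_ge0// !rnormE; case: a => a b /=; rewrite sqrrN. Qed.

Lemma rnorm_real (a : R) : rnorm (a%:C%C : R[i]) = `|a|.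
Proof. by apply: complexI; rewrite -rnormC normc_def /= expr0n addr0 sqrtr_sqr. Qed.

Lemma mulJ (a : R[i]) : a * conj a = (rnorm a ^+ 2)%:C%C.
Proof. by rewrite rnormE; case: a => a b; simpc; rewrite -!expr2 [b * a]mulrC addNr. Qed.

Lemma Re_le_rnorm (z : R[i]) : `|Re z| <= rnorm z.
Proof.
rewrite -ler_sqr ?nnegrE ?rnorm_ge0// rnormE real_normK ?num_real// lerDl.
exact: sqr_ge0.
Qed.

Lemma Im_le_rnorm (z : R[i]) : `|Im z| <= rnorm z.
Proof.
rewrite -ler_sqr ?nnegrE ?rnorm_ge0// rnormE real_normK ?num_real// lerDr.
exact: sqr_ge0.
Qed.

Lemma ReD (a b : R[i]) : Re (a + b) = Re a + Re b.
Proof. by case: a => ? ?; case: b. Qed.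
Lemma ReN (a : R[i]) : Re (- a) = - Re a.
Proof. by case: a. Qed.
Lemma ReM (a b : R[i]) : Re (a * b) = Re a * Re b - Im a * Im b.
Proof. by case: a => ? ?; case: b. Qed.
Lemma ReJ (a : R[i]) : Re (conj a) = Re a.
Proof. by case: a. Qed.
Lemma ReZ (r : R) (a : R[i]) : Re (r%:C%C * a) = r * Re a.
Proof. by rewrite ReM /= mul0r subr0. Qed.
Lemma Re_sum (u : nat -> R[i]) n : Re (\sum_(k < n) u k) = \sum_(k < n) Re (u k).
Proof. by elim: n => [|n IH]; rewrite ?big_ord0// !big_ord_recr /= ReD IH. Qed.

(** Taking c = 1 and c = i gives the sums and the differences of the coefficients, which separates
    the conjugate-linear part from the linear one. *)
Lemma conj_linear_inj (a b a' b' : R[i]) :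
  (forall c, c * a + conj c * a' = c * b + conj c * b') -> a' = b'.
Proof.
move=> h; have h1 := h 1; have := h 'i%C; rewrite !mul1r rmorph1 !mul1r in h1 *.
have -> : conj 'i%C = - 'i%C :> R[i] by apply/eqP; rewrite eq_complex /= oppr0 !eqxx.
rewrite !mulNr -!mulrBr => /mulfI h2.
have {}h2 : a - a' = b - b' by apply: h2; rewrite eq_complex /= oner_eq0 andbF.
have : (a + a') - (a - a') = (b + b') - (b - b') by rewrite h1 h2.
have E (u v : R[i]) : u + v - (u - v) = v *+ 2 by ring.
by rewrite !E => /eqP; rewrite eqrMn2r /= => /eqP.
Qed.

End rnorm_theory.

(** * Inner products and polarization *)

Section inner_product.
Context (R : realType) (H : preHilbertType R).
Implicit Types x y z : H.

Lemma ipC x y : ip x y = conj (ip y x).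
Proof. by rewrite (hermC (@ip R H)) expr0 mul1r. Qed.
Lemma ipDl x y z : ip (x + y) z = ip x z + ip y z.
Proof. exact: linearDl. Qed.
Lemma ipZl c x z : ip (c *: x) z = c * ip x z.
Proof. exact: linearZl_LR. Qed.
Lemma ipDr x y z : ip z (x + y) = ip z x + ip z y.
Proof. exact: linearDr. Qed.
Lemma ipZr c x z : ip z (c *: x) = conj c * ip z x.
Proof. exact: linearZr_LR. Qed.
Lemma ipNl x z : ip (- x) z = - ip x z.
Proof. by rewrite -scaleN1r ipZl mulN1r. Qed.
Lemma ipNr x z : ip z (- x) = - ip z x.
Proof. by rewrite ipC ipNl rmorphN /= -ipC. Qed.
Lemma ipBl x y z : ip (x - y) z = ip x z - ip y z.
Proof. by rewrite ipDl ipNl. Qed.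
Lemma ipBr x y z : ip z (x - y) = ip z x - ip z y.
Proof. by rewrite ipDr ipNr. Qed.
Lemma ip0l z : ip 0 z = 0.
Proof. by rewrite -(scale0r 0) ipZl mul0r. Qed.
Lemma ip0r z : ip z 0 = 0.
Proof. by rewrite ipC ip0l rmorph0. Qed.
Lemma ip_suml x n (u : nat -> H) : ip (\sum_(k < n) u k) x = \sum_(k < n) ip (u k) x.
Proof. exact: linear_sumlz. Qed.
Lemma ip_sumr x n (u : nat -> H) : ip x (\sum_(k < n) u k) = \sum_(k < n) ip x (u k).
Proof. exact: linear_sumr. Qed.

Lemma ip_sqr x : ip x x = (rnorm x ^+ 2)%:C%C.
Proof. by rewrite -ip_norm rnormC rmorphXn. Qed.

Lemma Re_ip_sqr x : Re (ip x x) = rnorm x ^+ 2.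
Proof. by rewrite ip_sqr. Qed.

Lemma cauchy_schwarz x y : rnorm (ip x y) <= rnorm x * rnorm y.
Proof.
rewrite -ler_sqr ?nnegrE ?mulr_ge0 ?rnorm_ge0// exprMn -lecR.
by rewrite rmorphXn rmorphM /= -rnormC -!ip_sqr; exact: dot_CauchySchwarz.
Qed.

Lemma Re_ip_le x y : `|Re (ip x y)| <= rnorm x * rnorm y.
Proof. exact: le_trans (Re_le_rnorm _) (cauchy_schwarz _ _). Qed.

Lemma rnorm_sqrD x y :
  rnorm (x + y) ^+ 2 = rnorm x ^+ 2 + 2 * Re (ip x y) + rnorm y ^+ 2.
Proof.
rewrite -!Re_ip_sqr ipDl !ipDr !ReD [ip y x]ipC ReJ; ring.
Qed.

Lemma rnorm_sqrB x y :
  rnorm (x - y) ^+ 2 = rnorm x ^+ 2 - 2 * Re (ip x y) + rnorm y ^+ 2.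
Proof. by rewrite rnorm_sqrD ipNr ReN rnormN mulrN. Qed.

Lemma ip_inj x y : (forall z, ip x z = ip y z) -> x = y.
Proof.
move=> xy; apply/eqP; rewrite -subr_eq0; apply/eqP/rnorm_eq0/eqP.
by rewrite -sqrf_eq0 -Re_ip_sqr ipBl xy subrr.
Qed.

(** Over the complex field the values of a quadratic form at x + c y, for all scalars c, determine
    its cross terms. *)
Lemma polarization (A B : H -> H) : linear A -> linear B ->
  (forall x, ip (A x) x = ip (B x) x) -> A = B.
Proof.
move=> lA lB AB; apply/funext => x; apply: ip_inj => y.
have LD (C : H -> H) : linear C -> forall u v, C (u + v) = C u + C v.
  by move=> lC u v; rewrite -{1}[u]scale1r lC scale1r.
have LZ (C : H -> H) : linear C -> forall c u, C (c *: u) = c *: C u.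
  move=> lC c u; have C0 : C 0 = 0.
    by have /eqP := lC 1 0 0; rewrite scaler0 addr0 scale1r -subr_eq subrr => /eqP.
  by rewrite -[c *: u]addr0 lC C0 addr0.
have h c : c * ip (A y) x + conj c * ip (A x) y = c * ip (B y) x + conj c * ip (B x) y.
  have := AB (x + c *: y).
  rewrite !(LD _ lA) !(LD _ lB) !(LZ _ lA) !(LZ _ lB) !(ipDl, ipDr, ipZl, ipZr) -!AB => /eqP.
  rewrite -subr_eq0 => /eqP e; apply/eqP; rewrite -subr_eq0 -e; apply/eqP; ring.
exact: (conj_linear_inj h).
Qed.

End inner_product.

(** * Convergence of sequences in the real-valued norm *)

Section sequences.
Context (R : realType).
Implicit Types E : normedModType R[i].

(** [L2 xi] carries no completeness structure. Convergence is therefore phrased for sequences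
    through the real-valued norm, and completeness is a predicate, [scomplete], that can be handed
    from one space to another. *)
Definition scvg (E : normedZmodType R[i]) (u : nat -> E) (l : E) :=
  rnorm (u n - l) @[n --> \oo] --> (0 : R).

Definition scauchy (E : normedZmodType R[i]) (u : nat -> E) :=
  forall e : R, 0 < e -> exists N, forall n m, (N <= n)%N -> (N <= m)%N ->
    rnorm (u n - u m) < e.

Definition scomplete (E : normedZmodType R[i]) :=
  forall u : nat -> E, scauchy u -> exists l, scvg u l.

Lemma scvgP (E : normedZmodType R[i]) (u : nat -> E) l :
  scvg u l <-> forall e : R, 0 < e -> exists N, forall n, (N <= n)%N ->
    rnorm (u n - l) < e.
Proof.
split=> [/cvgrPdist_lt h e e0|h].
  have [N _ hN] := h _ e0; exists N => n Nn.
  by have := hN n Nn; rewrite /= sub0r normrN ger0_norm ?rnorm_ge0.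
apply/cvgrPdist_lt => e e0; have [N hN] := h _ e0; exists N => // n Nn /=.
by rewrite sub0r normrN ger0_norm ?rnorm_ge0//; exact: hN.
Qed.

Lemma scvg_le (E : normedZmodType R[i]) (u : nat -> E) l (a : nat -> R) :
  (forall n, rnorm (u n - l) <= a n) -> a n @[n --> \oo] --> 0 -> scvg u l.
Proof.
move=> ua a0; apply: (squeeze_cvgr _ (@cvg_cst _ 0 _ _ _) a0).
by apply: nearW => n; rewrite rnorm_ge0 ua.
Qed.

Lemma scvg_unique (E : normedZmodType R[i]) (u : nat -> E) l l' :
  scvg u l -> scvg u l' -> l = l'.
Proof.
move=> ul ul'; apply/eqP; rewrite -subr_eq0; apply/eqP/rnorm_eq0/eqP.
rewrite eq_le rnorm_ge0 andbT; apply/ler_addgt0Pl => e e0; rewrite addr0.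
have e20 : 0 < e / 2 by rewrite divr_gt0.
have [N hN] := (scvgP _ _).1 ul _ e20.
have [M hM] := (scvgP _ _).1 ul' _ e20.
rewrite -(subrKA (u (maxn N M))) [leRHS](splitr e).
apply: le_trans (rnormD _ _) _; apply: lerD; apply: ltW.
  by rewrite rnormBC; apply: hN; rewrite leq_maxl.
by apply: hM; rewrite leq_maxr.
Qed.

Lemma scvgD (E : normedZmodType R[i]) (u v : nat -> E) l l' :
  scvg u l -> scvg v l' -> scvg (fun n => u n + v n) (l + l').
Proof.
move=> ul vl.
apply: (@scvg_le _ _ _ (fun n => rnorm (u n - l) + rnorm (v n - l'))).
  by move=> n; rewrite opprD addrACA rnormD.
by rewrite -(addr0 0); exact: cvgD.
Qed.

Lemma scvgZ E (u : nat -> E) l (c : R[i]) :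
  scvg u l -> scvg (fun n => c *: u n) (c *: l).
Proof.
move=> ul; apply: (@scvg_le _ _ _ (fun n => rnorm c * rnorm (u n - l))).
  by move=> n; rewrite -scalerBr rnormZ.
by rewrite -(mulr0 (rnorm c)); exact: cvgMr.
Qed.

Lemma scvg_rnorm (E : normedZmodType R[i]) (u : nat -> E) l :
  scvg u l -> rnorm (u n) @[n --> \oo] --> rnorm l.
Proof.
move=> ul; apply/cvgrPdist_lt => e e0.
have [N hN] := (scvgP _ _).1 ul _ e0; exists N => // n Nn /=.
by rewrite distrC; apply: le_lt_trans (rnorm_dist _ _) _; exact: hN.
Qed.

Lemma scvg_Re (u : nat -> R[i]) l : scvg u l -> Re (u n) @[n --> \oo] --> Re l.
Proof.
move=> ul; apply/cvgrPdist_lt => e e0.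
have [N hN] := (scvgP _ _).1 ul _ e0; exists N => // n Nn /=.
rewrite distrC -ReN -ReD; apply: le_lt_trans (Re_le_rnorm _) _; exact: hN.
Qed.

Lemma scvg_cst (E : normedZmodType R[i]) (l : E) : scvg (fun=> l) l.
Proof. by rewrite /scvg subrr rnorm0; exact: cvg_cst. Qed.

Lemma real_cvg_cauchy (a : nat -> R) (l : R) : a n @[n --> \oo] --> l ->
  forall e : R, 0 < e -> exists N, forall n m, (N <= n)%N -> (N <= m)%N ->
    `|a n - a m| < e.
Proof.
move=> /cvgrPdist_lt al e e0; have [N _ hN] := al _ (divr_gt0 e0 (ltr0Sn _ 1)).
exists N => n m Nn Nm; rewrite -(subrKA l) [ltRHS](splitr e).
apply: le_lt_trans (ler_normD _ _) _; apply: ltrD; last exact: hN.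
by rewrite distrC; exact: hN.
Qed.

Lemma scauchy_le (E : normedZmodType R[i]) (u : nat -> E) (a : nat -> R) (l : R) :
  (forall n m, (m <= n)%N -> rnorm (u n - u m) <= a n - a m) ->
  a n @[n --> \oo] --> l -> scauchy u.
Proof.
move=> ua /real_cvg_cauchy al e /al[N hN]; exists N => n m Nn Nm.
wlog mn : n m Nn Nm / (m <= n)%N => [h|].
  by have [/h|/ltnW /h] := leqP m n; [|rewrite rnormBC]; exact.
exact: le_lt_trans (ua _ _ mn) (le_lt_trans (ler_norm _) (hN _ _ Nn Nm)).
Qed.

Lemma scauchy_sqr_le (E : normedZmodType R[i]) (u : nat -> E) (a : nat -> R) (l : R) :
  (forall n m, (m <= n)%N -> rnorm (u n - u m) ^+ 2 <= a n - a m) ->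
  a n @[n --> \oo] --> l -> scauchy u.
Proof.
move=> ua /real_cvg_cauchy al e e0; have [N hN] := al _ (exprn_gt0 2 e0).
exists N => n m Nn Nm.
wlog mn : n m Nn Nm / (m <= n)%N => [h|].
  by have [/h|/ltnW /h] := leqP m n; [|rewrite rnormBC]; exact.
rewrite -ltr_sqr ?nnegrE ?rnorm_ge0 ?ltW//.
exact: le_lt_trans (ua _ _ mn) (le_lt_trans (ler_norm _) (hN _ _ Nn Nm)).
Qed.

Lemma scvg_cvg E (u : nat -> E) l : scvg u l -> u n @[n --> \oo] --> l.
Proof.
move=> /scvgP ul; apply/cvgrPdist_lt => e e0.
have eR : e = (Re e)%:C%C by rewrite RRe_real// ger0_real ?ltW.
have : 0 < Re e by rewrite -ltcR -eR.
move=> /ul[N hN]; exists N => // n Nn /=.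
by rewrite eR rnormC ltcR rnormBC; exact: hN.
Qed.

Lemma scvg_limn E (u : nat -> E) l : scvg u l -> limn u = l.
Proof. by move=> /scvg_cvg /cvg_lim; apply. Qed.

Lemma hilbert_scomplete (H : hilbertType R) : scomplete H.
Proof.
move=> u cu; suff /cvg_ex[l ul] : cvg (u @ \oo).
  exists l; apply/scvgP => e e0.
  have : 0 < e%:C%C by rewrite ltcR.
  move=> /((cvgrPdist_lt _ _).1 ul)[N _ hN]; exists N => n Nn.
  by rewrite rnormBC -ltcR -rnormC; exact: hN.
apply: cauchy_cvg; apply: cauchy_exP => e e0.
have eR : e = (Re e)%:C%C by rewrite RRe_real// ger0_real ?ltW.
have : 0 < Re e by rewrite -ltcR -eR.
move=> /cu[N hN]; exists (u N); exists N => // n Nn /=.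
by rewrite -ball_normE /= eR rnormC ltcR; exact: hN.
Qed.

End sequences.

Section inner_product_limits.
Context (R : realType) (H : preHilbertType R).

Lemma scvg_ipl (u : nat -> H) l y : scvg u l -> scvg (fun n => ip (u n) y) (ip l y).
Proof.
move=> ul; apply: (@scvg_le _ _ _ _ (fun n => rnorm (u n - l) * rnorm y)).
  by move=> n; rewrite -ipBl cauchy_schwarz.
by rewrite -(mul0r (rnorm y)); exact: cvgMl.
Qed.

Lemma scvg_ip2 (u v : nat -> H) l k : scvg u l -> scvg v k ->
  scvg (fun n => ip (u n) (v n)) (ip l k).
Proof.
move=> ul vk; apply: (@scvg_le _ _ _ _
  (fun n => rnorm (u n - l) * rnorm (v n) + rnorm l * rnorm (v n - k))).
  move=> n; rewrite -(subrKA (ip l (v n))) -ipBl -ipBr.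
  by apply: le_trans (rnormD _ _) _; apply: lerD; exact: cauchy_schwarz.
have -> : 0 = 0 * rnorm k + rnorm l * 0 :> R by rewrite mul0r mulr0 addr0.
by apply: cvgD; [apply: cvgM => //; exact: scvg_rnorm|exact: cvgMr].
Qed.

End inner_product_limits.

(** * Orthonormal sequences, Riesz-Fischer, Parseval and Riesz representation *)

Section orthonormal_sequences.
Context (R : realType) (H : preHilbertType R).
Implicit Types x y z : H.

(** Zero vectors are allowed so that a finite or countable basis can always be indexed by all of
    [nat], idle indices being sent to 0. *)
Definition orthonormal_seq (e : nat -> H) :=
  (forall m n, m != n -> ip (e m) (e n) = 0) /\
  (forall n, e n = 0 \/ rnorm (e n) = 1).

Definition total_seq (e : nat -> H) := forall x, (forall n, ip x (e n) = 0) -> x = 0.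

Variable (e : nat -> H).
Hypothesis one : orthonormal_seq e.

Definition fourier (c : nat -> R[i]) n : H := \sum_(k < n) c k *: e k.

(** The value is left as an inner product because [e k] may vanish: it is [c k] for a unit vector
    and 0 otherwise. *)
Lemma fourier_ip c n k : ip (fourier c n) (e k) =
  (if (k < n)%N then ip (c k *: e k) (e k) else 0).
Proof.
rewrite /fourier (ip_suml _ _ (fun k => c k *: e k)); elim: n => [|n IH]; first by rewrite big_ord0.
rewrite big_ord_recr /= IH (ltnS k n) (leq_eqVlt k n).
have [->|kn] := eqVneq k n; first by rewrite ltnn add0r.
by rewrite (ipZl _ (e n) (e k)) one.1 1?eq_sym// mulr0 addr0.
Qed.

Lemma fourier_sqr c n :
  rnorm (fourier c n) ^+ 2 = \sum_(k < n) rnorm (c k *: e k) ^+ 2.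
Proof.
elim: n => [|n IH]; first by rewrite /fourier !big_ord0 rnorm0 expr0n.
rewrite [in RHS]big_ord_recr -IH /fourier big_ord_recr /= -/(fourier c n).
rewrite rnorm_sqrD ipZr fourier_ip ltnn mulr0 /= mulr0 addr0//.
Qed.

Lemma onseq_rnorm_le c n : rnorm (c *: e n) <= rnorm c.
Proof.
rewrite rnormZ; case: (one.2 n) => ->; last by rewrite mulr1.
by rewrite rnorm0 mulr0 rnorm_ge0.
Qed.

Lemma fourier_sqr_le c n :
  rnorm (fourier c n) ^+ 2 <= \sum_(k < n) rnorm (c k) ^+ 2.
Proof.
rewrite fourier_sqr; apply: ler_sum => k _.
by rewrite lerXn2r ?nnegrE ?rnorm_ge0// onseq_rnorm_le.
Qed.

(** The difference is again a partial sum, with its first m coefficients replaced by 0, so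
    Pythagoras applies to it. *)
Lemma fourierB_sqr_le c n m : (m <= n)%N ->
  rnorm (fourier c n - fourier c m) ^+ 2 <=
  \sum_(k < n) rnorm (c k) ^+ 2 - \sum_(k < m) rnorm (c k) ^+ 2.
Proof.
move=> mn; pose c' k := if (k < m)%N then 0 else c k.
have -> : fourier c n - fourier c m = fourier c' n.
  rewrite /fourier -!(big_mkord xpredT (fun k => c k *: e k)).
  rewrite -(big_mkord xpredT (fun k => c' k *: e k)).
  rewrite (big_cat_nat (leq0n m) mn)//= [in RHS](big_cat_nat (leq0n m) mn)//=.
  rewrite addrAC subrr add0r [in RHS]big1_seq ?add0r; last first.
    by move=> k /andP[_]; rewrite mem_index_iota /c' => /andP[_ ->]; rewrite scale0r.
  by apply: eq_big_nat => k /andP[mk _]; rewrite /c' ltnNge mk.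
apply: le_trans (fourier_sqr_le _ _) _.
rewrite -!(big_mkord xpredT (fun k => rnorm (c k) ^+ 2)).
rewrite -(big_mkord xpredT (fun k => rnorm (c' k) ^+ 2)).
rewrite [in leRHS](big_cat_nat (leq0n m) mn)//= [in leLHS](big_cat_nat (leq0n m) mn)//=.
rewrite [leRHS]addrAC subrr add0r big1_seq ?add0r; last first.
  by move=> k /andP[_]; rewrite mem_index_iota /c' => /andP[_ ->]; rewrite rnorm0 expr0n.
rewrite le_eqVlt; apply/orP; left; apply/eqP.
by apply: eq_big_nat => k /andP[mk _]; rewrite /c' ltnNge mk.
Qed.

Lemma ip_onseq x n : ip (ip x (e n) *: e n) (e n) = ip x (e n).
Proof.
case: (one.2 n) => [->|e1]; first by rewrite !ip0r.
by rewrite ipZl ip_sqr e1 expr1n mulr1.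
Qed.

Lemma rnorm_ip_onseq x n : rnorm (ip x (e n) *: e n) = rnorm (ip x (e n)).
Proof.
case: (one.2 n) => [->|e1]; first by rewrite ip0r scaler0 !rnorm0.
by rewrite rnormZ e1 mulr1.
Qed.

Lemma bessel_eq x n : rnorm (x - fourier (fun k => ip x (e k)) n) ^+ 2 =
  rnorm x ^+ 2 - \sum_(k < n) rnorm (ip x (e k)) ^+ 2.
Proof.
have E : Re (ip x (fourier (fun k => ip x (e k)) n)) =
    \sum_(k < n) rnorm (ip x (e k)) ^+ 2.
  rewrite /fourier (ip_sumr _ _ (fun k => ip x (e k) *: e k)) (Re_sum (fun k => ip x (ip x (e k) *: e k))); apply: eq_bigr => k _.
  by rewrite ipZr mulrC mulJ.
rewrite rnorm_sqrB E fourier_sqr; under [X in _ + X]eq_bigr do rewrite rnorm_ip_onseq.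
ring.
Qed.

Lemma bessel x n : \sum_(k < n) rnorm (ip x (e k)) ^+ 2 <= rnorm x ^+ 2.
Proof. by rewrite -subr_ge0 -bessel_eq sqr_ge0. Qed.

Lemma bounded_series_cvg (a : nat -> R) C : (forall k, 0 <= a k) ->
  (forall n, \sum_(k < n) a k <= C) ->
  cvg (\sum_(k < n) a k @[n --> \oo]) .
Proof.
move=> a0 aC; apply: nondecreasing_is_cvgn; last by exists C => _ [n _ <-].
by apply/nondecreasing_seqP => n; rewrite big_ord_recr lerDl.
Qed.

Hypothesis HC : scomplete H.

(** By Pythagoras the squared increments of the partial sums are at most the increments of a bounded
    nondecreasing real sequence. *)
Lemma riesz_fischer (c : nat -> R[i]) C :
  (forall n, \sum_(k < n) rnorm (c k) ^+ 2 <= C) ->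
  exists2 y, scvg (fourier c) y & rnorm y ^+ 2 <= C.
Proof.
move=> cC.
have /cvg_ex[l al] := bounded_series_cvg (fun k => sqr_ge0 (rnorm (c k))) cC.
have [y ly] := HC (scauchy_sqr_le (fun n m => @fourierB_sqr_le c n m) al).
exists y => //.
have h : rnorm (fourier c n) ^+ 2 @[n --> \oo] --> rnorm y ^+ 2.
  by rewrite expr2; under eq_fun do rewrite expr2; apply: cvgM; exact: scvg_rnorm.
rewrite -(cvg_lim _ h)//; apply: limr_le; first exact: cvgP h.
by apply: nearW => n; exact: le_trans (fourier_sqr_le c n) (cC n).
Qed.

Lemma scvg_fourier_ip c y k : scvg (fourier c) y -> ip y (e k) = ip (c k *: e k) (e k).
Proof.
move=> /(@scvg_ipl _ _ _ _ (e k)) h; apply: scvg_unique h _.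
apply/scvgP => r r0; exists k.+1 => n kn.
by rewrite fourier_ip kn subrr rnorm0.
Qed.

Hypothesis te : total_seq e.

(** The Riesz-Fischer sum of the Fourier series has the same coefficients as x, and totality then
    forces it to be x. *)
Lemma fourier_cvg x : scvg (fourier (fun k => ip x (e k))) x.
Proof.
have [y hy _] := riesz_fischer (c := fun k => ip x (e k)) (bessel x).
suff xy : x = y by rewrite [X in scvg _ X]xy.
apply/esym/eqP; rewrite -subr_eq0; apply/eqP/te => n.
by rewrite ipBl (scvg_fourier_ip _ hy) ip_onseq subrr.
Qed.

Lemma parseval_cvg x :
  \sum_(k < n) rnorm (ip x (e k)) ^+ 2 @[n --> \oo] --> rnorm x ^+ 2.
Proof.
have h := scvg_rnorm (fourier_cvg x).
have E n : \sum_(k < n) rnorm (ip x (e k)) ^+ 2 =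
    rnorm (fourier (fun k => ip x (e k)) n) ^+ 2.
  by rewrite fourier_sqr; apply: eq_bigr => k _; rewrite rnorm_ip_onseq.
by under eq_fun do rewrite E expr2; rewrite expr2; exact: cvgM.
Qed.

Lemma parseval x :
  (\sum_(0 <= k <oo) (rnorm (ip x (e k)) ^+ 2)%:E = (rnorm x ^+ 2)%:E)%E.
Proof.
apply: cvg_lim => //.
rewrite (_ : (fun n => _) = EFin \o (fun n => \sum_(k < n) rnorm (ip x (e k)) ^+ 2)).
  by apply: cvg_EFin; [exact: nearW|exact: parseval_cvg].
by apply/funext => n /=; rewrite sumEFin big_mkord.
Qed.

Lemma ip_fourier_cvg x y : scvg (fun n => \sum_(k < n) ip x (e k) * ip (e k) y) (ip x y).
Proof.
have := scvg_ipl y (fourier_cvg x); congr scvg; apply/funext => n.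
by rewrite /fourier (ip_suml _ _ (fun k => ip x (e k) *: e k)); apply: eq_bigr => k _; rewrite ipZl.
Qed.

(** The representing vector has the coefficients conj (f (e k)), which the bound on f makes
    square-summable. *)
Lemma riesz_representation (f : H -> R[i]) (M : R) :
  (forall c x y, f (c *: x + y) = c * f x + f y) ->
  (forall x, rnorm (f x) <= M * rnorm x) -> exists y, forall x, f x = ip x y.
Proof.
move=> lf bf.
have f0 : f 0 = 0.
  by apply/rnorm_eq0/eqP; rewrite eq_le rnorm_ge0 andbT (le_trans (bf 0))// rnorm0 mulr0.
have fS (c : nat -> R[i]) n : f (fourier c n) = \sum_(k < n) c k * f (e k).
  elim: n => [|n IH]; first by rewrite /fourier !big_ord0.
  by rewrite /fourier !big_ord_recr /= addrC lf -/(fourier c n) IH addrC.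
have fB x y : f (x - y) = f x - f y.
  by rewrite addrC -scaleN1r lf mulN1r addrC.
pose c k := conj (f (e k)).
(* The value of f at the partial sum is s itself, while the squared norm of that sum is at most s.
   Hence s^2 <= M^2 s. *)
have cM n : \sum_(k < n) rnorm (c k) ^+ 2 <= M ^+ 2.
  set s := \sum_(k < n) _.
  have s0 : 0 <= s by apply: sumr_ge0 => k _; exact: sqr_ge0.
  have fs : f (fourier c n) = s%:C%C.
    rewrite fS /s raddf_sum /=; apply: eq_bigr => k _.
    by rewrite /c mulrC mulJ rnormJ.
  have := bf (fourier c n); rewrite fs rnorm_real ger0_norm// => h.
  have h2 : s ^+ 2 <= M ^+ 2 * s.
    apply: (@le_trans _ _ (M ^+ 2 * rnorm (fourier c n) ^+ 2)).
      rewrite -exprMn lerXn2r// nnegrE; exact: le_trans s0 h.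
    by rewrite ler_wpM2l ?sqr_ge0// fourier_sqr_le.
  have [->|sn0] := eqVneq s 0; first exact: sqr_ge0.
  by rewrite -(@ler_pM2r _ s) ?lt_neqAle ?s0 1?eq_sym ?sn0// -expr2.
have [y hy _] := riesz_fischer (c := c) cM.
exists y => x.
have h1 : scvg (fun n => f (fourier (fun k => ip x (e k)) n)) (f x).
  apply: (@scvg_le _ _ _ _ (fun n =>
    M * rnorm (fourier (fun k => ip x (e k)) n - x))).
    by move=> n; rewrite -fB.
  by rewrite -(mulr0 M); apply: cvgMr; exact: fourier_cvg.
apply: scvg_unique h1 _.
have := ip_fourier_cvg x y; congr scvg; apply/funext => n; rewrite fS.
apply: eq_bigr => k _; congr (_ * _); rewrite ipC (scvg_fourier_ip _ hy) /c.
case: (one.2 k) => [->|e1]; first by rewrite f0 rmorph0 scaler0 ip0l rmorph0.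
by rewrite ipZl ip_sqr e1 expr1n mulr1 conjcK.
Qed.

End orthonormal_sequences.

(** * Orthonormal bases and their enumeration *)

Section orthonormal_bases.
Context (R : realType).
Implicit Types H : preHilbertType R.

(** Zorn yields a maximal orthonormal set; a nonzero vector orthogonal to it could be normalized and
    added. This rules out the default value of [onb]. *)
Lemma onbP H : orthonormal_basis (@onb R H).
Proof.
pose P (B : set H) := forall e f, B e -> B f -> ip e f = (e == f)%:R.
have [F FP Ft|B [PB maxB]] := @Zorn_bigcup _ P.
  move=> e f [X FX Xe] [Y FY Yf]; have [XY|YX] := Ft _ _ FX FY.
    exact: (FP _ FY _ _ (XY _ Xe) Yf).
  exact: (FP _ FX _ _ Xe (YX _ Yf)).
rewrite /onb; case: xgetP => [C -> //|/(_ B)]; case; split => // x x0.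
apply: contrapT => /eqP xn0.
have nx : rnorm x != 0 by apply: contra_neq xn0; exact: rnorm_eq0.
pose y : H := ((rnorm x)^-1)%:C%C *: x.
have ye e : B e -> ip y e = 0 by move=> Be; rewrite ipZl x0// mulr0.
have yy : ip y y = 1.
  rewrite ip_sqr rnormZ rnorm_real ger0_norm ?invr_ge0 ?rnorm_ge0//.
  by rewrite mulVf// expr1n.
have nBy : ~ B y by move=> /ye; rewrite yy => /eqP; rewrite oner_eq0.
apply: (maxB (y |` B)); first split; first by move=> e Be; right.
  by move=> /(_ y (or_introl erefl)).
move=> e f [->|Be] [->|Bf].
- by rewrite yy eqxx.
- by rewrite ye//; case: eqP => // yf; rewrite yf in nBy.
- by rewrite ipC ye// rmorph0; case: eqP => // ey; rewrite -ey in nBy.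
- exact: PB.
Qed.

Definition sdense H (u : nat -> H) :=
  forall x (eps : R), 0 < eps -> exists n, rnorm (x - u n) < eps.

Lemma countable_enum (T : pointedType) (A : set T) (x0 : T) : countable A ->
  exists u : nat -> T, (forall n, u n = x0 \/ A (u n)) /\
    exists c : T -> nat, forall x, A x -> u (c x) = x.
Proof.
move=> /countable_injP[f fi].
exists (fun n => xget x0 [set x | A x /\ f x = n]); split.
  by move=> n; case: xgetP => [y -> [Ay _]|_]; [right|left].
exists f => x Ax; case: xgetP => [y -> [Ay yx]|/(_ x)]; last by case.
by apply: fi; rewrite ?inE.
Qed.

Lemma separable_sdense (H : hilbertType R) : separable H ->
  exists u : nat -> H, sdense u.
Proof.
move=> [A cA dA]; have [u [_ [c cu]]] := countable_enum 0 cA.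
exists u => x eps eps0.
have e0 : 0 < eps%:C%C by rewrite ltcR.
have := dA (ball x eps%:C%C)°.
case; first by exists x; exact: nbhsx_ballx.
  exact: open_interior.
move=> y [/interior_subset + Ay]; rewrite -ball_normE /= rnormC ltcR => xy.
by exists (c y); rewrite cu.
Qed.

(** Distinct basis vectors are at distance sqrt 2, so no point of a dense sequence is within 1/2 of
    two of them: the index of a nearby point enumerates the basis. The last clause turns sums over
    the basis into series. *)
Lemma onb_enum H (u : nat -> H) : sdense u ->
  exists e : nat -> H, [/\ orthonormal_seq e, total_seq e &
    forall F : H -> \bar R, (forall x, 0 <= F x)%E -> F 0 = 0%E ->
      (\esum_(x in @onb R H) F x = \sum_(0 <= n <oo) F (e n))%E].
Proof.
move=> du; have [onB tB] := onbP H.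
have B1 b : @onb R H b -> rnorm b = 1.
  move=> Bb; have : rnorm b ^+ 2 = 1 by rewrite -Re_ip_sqr onB// eqxx.
  by move/eqP; rewrite sqrp_eq1 ?rnorm_ge0// => /eqP.
pose c b := xget 0%N [set n | rnorm (b - u n) < 1 / 2].
have cE b : rnorm (b - u (c b)) < 1 / 2.
  rewrite /c; case: xgetP => [n -> //|] h.
  by have [n hn] := du b _ (divr_gt0 ltr01 (ltr0Sn R 1)); have := h n hn.
have ci b b' : @onb R H b -> @onb R H b' -> c b = c b' -> b = b'.
  move=> Bb Bb' cbb'; apply: contrapT => /eqP nbb'.
  have : rnorm (b - b') ^+ 2 = 2.
    by rewrite rnorm_sqrB !B1// onB// (negbTE nbb') /= mulr0 subr0 expr1n.
  have : rnorm (b - b') < 1.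
    rewrite -(subrKA (u (c b))) (splitr 1); apply: le_lt_trans (rnormD _ _) _.
    by apply: ltrD; [exact: cE|rewrite rnormBC cbb'; exact: cE].
  have := rnorm_ge0 (b - b'); nra.
pose e n := xget 0 [set b | @onb R H b /\ c b = n].
have eB n : e n = 0 \/ @onb R H (e n) /\ c (e n) = n.
  by rewrite /e; case: xgetP => [y -> ?|_]; [right|left].
have ec b : @onb R H b -> e (c b) = b.
  move=> Bb; rewrite /e; case: xgetP => [y -> [By ycb]|/(_ b)]; last by case.
  exact: ci.
have one : orthonormal_seq e.
  split=> [m n mn|n]; last by case: (eB n) => [->|[/B1 ? _]]; [left|right].
  case: (eB n) => [->|[Bn cn]]; first by rewrite ip0r.
  case: (eB m) => [->|[Bm cm]]; first by rewrite ip0l.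
  rewrite onB//; case: eqP => // emn; move: mn; rewrite -cm -cn emn eqxx//.
exists e; split => //.
  by move=> x xe; apply: tB => b Bb; rewrite -(ec b Bb).
move=> F F0 F00.
have h : set_bij [set n | e n != 0] (@onb R H) e.
  split.
  - by move=> n /=; case: (eB n) => [->|[]//]; rewrite eqxx.
  - move=> m n; rewrite !inE /= => em en emn.
    case: (eB m) em => [->|[_ {2}<-] _]; first by rewrite eqxx.
    by case: (eB n) en => [->|[_ {2}<-] _]; [rewrite eqxx|rewrite emn].
  - move=> b Bb; exists (c b); rewrite /= ec//; apply/eqP => b0.
    by have := B1 b Bb; rewrite b0 rnorm0 => /esym/eqP; rewrite oner_eq0.
rewrite (reindex_esum _ _ _ F h) -(@nneseries_esum _ (F \o e) (fun n => e n != 0))//.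
  rewrite eseries_mkcond; apply: eq_eseriesr => n _ /=.
  by case: eqP => // ->; rewrite F00.
by move=> n _; exact: F0.
Qed.

End orthonormal_bases.

(** * Unitary maps: transport of density and completeness *)

Section isometries.
Context (R : realType) (H G : preHilbertType R) (U : H -> G).
Hypothesis uU : unitary_op U.

Lemma unitary_linear : linear U. Proof. by case: uU. Qed.

Lemma unitaryB x y : U (x - y) = U x - U y.
Proof. by rewrite addrC -scaleN1r unitary_linear scaleN1r addrC. Qed.

Lemma unitary_rnorm x : rnorm (U x) = rnorm x.
Proof.
apply: (@pexpIrn _ 2) => //; rewrite ?nnegrE ?rnorm_ge0//.
by case: uU => _ h _; rewrite -!Re_ip_sqr h.
Qed.

Lemma unitary_sdense (u : nat -> H) : sdense u -> sdense (U \o u).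
Proof.
move=> du y eps eps0; have [_ _ sU] := uU; have [x <-] := sU y.
have [n hn] := du x _ eps0.
by exists n; rewrite /= -unitaryB unitary_rnorm.
Qed.

(** Preimages of a Cauchy sequence form a Cauchy sequence. This is the source of the completeness of
    [L2 xi]. *)
Lemma unitary_scomplete : scomplete H -> scomplete G.
Proof.
move=> cH v cv; have [_ _ sU] := uU; have [w hw] := choice sU.
have [|l hl] := cH (w \o v).
  move=> e e0; have [N hN] := cv e e0; exists N => n m Nn Nm.
  by rewrite /= -unitary_rnorm unitaryB !hw; exact: hN.
exists (U l); rewrite /scvg.
rewrite (_ : (fun n => _) = (fun n => rnorm ((w \o v) n - l)))//.
by apply/funext => n /=; rewrite -[RHS]unitary_rnorm unitaryB hw.
Qed.

(** [adj] is a choice with default 0; the inverse of U is the witness that an adjoint exists. *)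
Lemma unitary_adjP x y : ip (U x) y = ip x (adj U y).
Proof.
rewrite /adj; case: xgetP => [B -> //|/(_ (fun y => xget 0 [set x | U x = y]))].
case=> {}x {}y; have [_ h sU] := uU; case: xgetP => [z _ zy|]; first by rewrite -zy h.
by have [z zy] := sU y => /(_ z).
Qed.

Lemma unitaryK x : adj U (U x) = x.
Proof.
apply: ip_inj => z; rewrite ipC -unitary_adjP -ipC.
by have [_ h _] := uU.
Qed.

Lemma unitaryVK y : U (adj U y) = y.
Proof. by have [_ _ /(_ y)[x <-]] := uU; rewrite unitaryK. Qed.

End isometries.

(** * Linear maps and adjoints of bounded operators *)

Section linear_maps.
Context (R : realType) (E F : lmodType R[i]) (A : E -> F).
Hypothesis lA : linear A.

Lemma linear_mapD x y : A (x + y) = A x + A y.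
Proof. by rewrite -{1}[x]scale1r lA scale1r. Qed.
Lemma linear_map0 : A 0 = 0.
Proof. by apply: (@addrI _ (A 0)); rewrite -linear_mapD !addr0. Qed.
Lemma linear_mapZ c x : A (c *: x) = c *: A x.
Proof. by rewrite -[c *: x]addr0 lA linear_map0 addr0. Qed.
Lemma linear_mapN x : A (- x) = - A x.
Proof. by rewrite -scaleN1r linear_mapZ scaleN1r. Qed.
Lemma linear_mapB x y : A (x - y) = A x - A y.
Proof. by rewrite linear_mapD linear_mapN. Qed.
Lemma linear_map_sum n (u : nat -> E) : A (\sum_(k < n) u k) = \sum_(k < n) A (u k).
Proof.
elim: n => [|n IH]; first by rewrite !big_ord0 linear_map0.
by rewrite !big_ord_recr /= linear_mapD IH.
Qed.

End linear_maps.

Section adjoints.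
Context (R : realType).
Implicit Types H G : preHilbertType R.

Lemma adj_unique H G (A : H -> G) (B : G -> H) :
  (forall x y, ip (A x) y = ip x (B y)) -> adj A = B.
Proof.
move=> AB; rewrite /adj; case: xgetP => [C -> hC|/(_ B)//].
apply/funext => y; apply: ip_inj => x.
by rewrite ipC -hC AB -ipC.
Qed.

Lemma bounded_op_ge0 H G (A : H -> G) : bounded_op A ->
  exists2 M : R, 0 < M & forall x, rnorm (A x) <= M * rnorm x.
Proof.
move=> [_ [M hM]]; exists (Num.max 1 M); first by rewrite lt_max ltr01.
move=> x; apply: le_trans (hM x) _.
by rewrite ler_wpM2r ?rnorm_ge0// le_max lexx orbT.
Qed.

Lemma scvg_bounded_op H G (A : H -> G) u l : bounded_op A -> scvg u l ->
  scvg (A \o u) (A l).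
Proof.
move=> [lA [M hM]] ul; apply: (@scvg_le _ _ _ _ (fun n => M * rnorm (u n - l))).
  by move=> n /=; rewrite -linear_mapB.
by rewrite -(mulr0 M); exact: cvgMr.
Qed.

Lemma bounded_op_comp H G (K : preHilbertType R) (A : H -> G) (B : G -> K) :
  bounded_op A -> bounded_op B -> bounded_op (B \o A).
Proof.
move=> bA bB; split=> [c x y /=|].
  by case: bA => -> _; case: bB => -> _.
have [M M0 hM] := bounded_op_ge0 bA; have [N N0 hN] := bounded_op_ge0 bB.
exists (N * M) => x; apply: le_trans (hN _) _.
by rewrite -mulrA ler_wpM2l// ltW.
Qed.

Lemma bounded_opB H G (A B : H -> G) :
  bounded_op A -> bounded_op B -> bounded_op (fun x => A x - B x).
Proof.
move=> [lA [M hM]] [lB [N hN]]; split=> [c x y /=|].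
  by rewrite lA lB scalerBr opprD addrACA.
exists (M + N) => x; rewrite mulrDl.
by apply: le_trans (rnormD _ _) _; rewrite rnormN lerD.
Qed.

Lemma bounded_opZ H G (c : R[i]) (A : H -> G) :
  bounded_op A -> bounded_op (fun x => c *: A x).
Proof.
move=> [lA [M hM]]; split=> [a x y /=|].
  by rewrite lA scalerDr !scalerA mulrC.
by exists (rnorm c * M) => x; rewrite rnormZ -mulrA ler_wpM2l ?rnorm_ge0.
Qed.

Lemma bounded_op_id H : bounded_op (@id H).
Proof. by split=> //; exists 1 => x; rewrite mul1r. Qed.

Variable H : preHilbertType R.
Hypotheses (HC : scomplete H) (Hd : exists u : nat -> H, sdense u).

(** Riesz representation of x |-> <A x, y>, bounded by M |y| |x|, supplies the value of the adjoint
    at y. *)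
Lemma adjP G (A : H -> G) : bounded_op A ->
  forall x y, ip (A x) y = ip x (adj A y).
Proof.
move=> bA; have [u du] := Hd; have [e [one te _]] := onb_enum du.
have [M M0 hM] := bounded_op_ge0 bA.
suff /choice[B hB] : forall y, exists z, forall x, ip (A x) y = ip x z.
  by rewrite (adj_unique (B := B)).
move=> y; apply: (riesz_representation one HC te (M := M * rnorm y)).
  by move=> c x z; case: bA => -> _; rewrite ipDl ipZl.
move=> x; apply: le_trans (cauchy_schwarz _ _) _.
by rewrite mulrAC ler_wpM2r ?rnorm_ge0.
Qed.

(** |A^H y|^2 = <A A^H y, y> <= M |A^H y| |y|, and one factor |A^H y| cancels. *)
Lemma adj_rnorm_le G (A : H -> G) (M : R) : linear A -> 0 <= M ->
  (forall x, rnorm (A x) <= M * rnorm x) ->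
  forall y, rnorm (adj A y) <= M * rnorm y.
Proof.
move=> lA M0 hM y.
have [->|ny] := eqVneq (rnorm (adj A y)) 0; first by rewrite mulr_ge0 ?rnorm_ge0.
have n0 : 0 < rnorm (adj A y) by rewrite lt_neqAle eq_sym ny rnorm_ge0.
rewrite -(ler_pM2l n0) -expr2 -Re_ip_sqr -adjP; last by split => //; exists M.
apply: le_trans (ler_norm _) _; apply: le_trans (Re_ip_le _ _) _.
by rewrite mulrA ler_wpM2r ?rnorm_ge0// mulrC hM.
Qed.

Lemma adj_bounded G (A : H -> G) : bounded_op A -> bounded_op (adj A).
Proof.
move=> bA; have aA := adjP bA; split.
  move=> c x y; apply: ip_inj => z; rewrite ipC -aA -ipC.
  rewrite !ipDl !ipZl; congr (_ * _ + _); by rewrite ipC aA -ipC.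
have [M M0 hM] := bounded_op_ge0 bA; exists M.
by apply: adj_rnorm_le; [case: bA|exact: ltW|].
Qed.

End adjoints.

(** * Positive operators and their Cauchy-Schwarz inequality *)

Section positive_operators.
Context (R : realType) (H : preHilbertType R).
Implicit Types A B : H -> H.

Lemma pos_real (z : R[i]) : 0 <= z -> z = (Re z)%:C%C.
Proof. by move=> z0; rewrite RRe_real// ger0_real. Qed.

Lemma positive_op_Re A x : positive_op A -> 0 <= Re (ip (A x) x).
Proof. by move=> [_ /(_ x) h]; rewrite -lecR -pos_real. Qed.

Lemma positive_opP A : bounded_op A ->
  (forall x, exists2 r : R, 0 <= r & ip (A x) x = r%:C%C) -> positive_op A.
Proof. by move=> bA h; split=> // x; have [r r0 ->] := h x; rewrite lecR. Qed.

(** Realness of the quadratic form means <A z, z> = <z, A z>; the cross terms of this identity at z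
    = x + c y give symmetry. *)
Lemma positive_op_sym A : positive_op A -> forall x y, ip (A x) y = ip x (A y).
Proof.
move=> [[lA _] pA] x y.
have sA z : ip (A z) z = ip z (A z).
  by rewrite [RHS]ipC (pos_real (pA z)); apply/eqP; rewrite eq_complex /= oppr0 !eqxx.
have h c : c * ip (A y) x + conj c * ip (A x) y =
    c * ip y (A x) + conj c * ip x (A y).
  have := sA (x + c *: y).
  rewrite !(linear_mapD lA) !(linear_mapZ lA) !(ipDl, ipDr, ipZl, ipZr) -!sA => /eqP.
  rewrite -subr_eq0 => /eqP e; apply/eqP; rewrite -subr_eq0 -e; apply/eqP; ring.
exact: (conj_linear_inj h).
Qed.

Lemma positive_op_adj A : positive_op A -> adj A = A.
Proof. by move=> pA; apply: adj_unique; exact: positive_op_sym. Qed.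

(** In its use w is a squared modulus |<A x, y>|^2, which appears in both the linear and the
    quadratic coefficient; t = 1/b is the minimizer. *)
Lemma quadratic_discr (a b w : R) : 0 <= a -> 0 <= b -> 0 <= w ->
  (forall t, 0 <= a - 2 * t * w + t ^+ 2 * w * b) -> w <= a * b.
Proof.
move=> a0 b0 w0 h; have [b00|bn0] := eqVneq b 0.
  rewrite b00 mulr0; have [->//|wn0] := eqVneq w 0.
  (* When b = 0 this t gives the value - a - 2, which is negative. *)
  have := h ((a + 1) / w); rewrite b00 mulr0 addr0 -mulrA divfK//; lra.
have := h b^-1.
have -> : a - 2 * b^-1 * w + b^-1 ^+ 2 * w * b = a - b^-1 * w by field.
by rewrite subr_ge0 mulrC ler_pdivrMr// lt_neqAle eq_sym bn0.
Qed.

(** The form is evaluated at x - t w y with w = <A x, y>: the factor w absorbs the phase and leaves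
    a real polynomial in the real variable t. *)
Lemma positive_cauchy_schwarz A x y : positive_op A ->
  rnorm (ip (A x) y) ^+ 2 <= Re (ip (A x) x) * Re (ip (A y) y).
Proof.
move=> pA; have [[lA _] _] := pA; set w := ip (A x) y.
apply: quadratic_discr; rewrite ?positive_op_Re// ?sqr_ge0// => t.
have := positive_op_Re (x - (t%:C%C * w) *: y) pA.
rewrite (linear_mapB lA) (linear_mapZ lA) !(ipBl, ipBr) !(ipZl, ipZr) -/w.
have -> : ip (A y) x = conj w by rewrite (positive_op_sym pA) ipC.
have -> : conj (t%:C%C * w) = t%:C%C * conj w.
  by rewrite rmorphM /=; congr (_ * _); apply/eqP; rewrite eq_complex /= oppr0 !eqxx.
have -> : t%:C%C * w * (t%:C%C * conj w * ip (A y) y) =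
    (t * t)%:C%C * ((w * conj w) * ip (A y) y) by rewrite rmorphM /=; ring.
rewrite !ReD !ReN ReD ReN -![t%:C%C * _ * _]mulrA ![_ * conj w]mulrC -?[conj w * w]mulrC mulJ.
rewrite !ReZ /=; congr (_ <= _); ring.
Qed.

End positive_operators.

(** * Positive square roots by iteration *)

Section square_roots.
Context (R : realType) (H : preHilbertType R).
Implicit Types A B C S T : H -> H.

(** Cauchy-Schwarz for the form of A, taken at x and A x, bounds |A x|^4 by 0. *)
Lemma positive_op_ip0 A x : positive_op A -> Re (ip (A x) x) = 0 -> A x = 0.
Proof.
move=> pA x0; have := positive_cauchy_schwarz x (A x) pA.
rewrite x0 mul0r ip_sqr rnorm_real ger0_norm ?sqr_ge0// => h.
apply: rnorm_eq0; apply/eqP; have := rnorm_ge0 (A x); rewrite eq_le => -> /[!andbT].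
rewrite leNgt; apply/negP => n0; move: h; rewrite leNgt => /negP; apply.
by rewrite !exprn_gt0.
Qed.

Section construction.
Variable A : H -> H.
Let B x := x - A x.
Hypotheses (bA : bounded_op A) (sA : forall x y, ip (A x) y = ip x (A y)).
Hypothesis B1 : forall x, rnorm (B x) <= rnorm x.
Hypothesis HC : scomplete H.

Let half : R[i] := (2^-1)%:C%C.

(* The fixed-point iteration for Q = (B + Q^2) / 2, i.e. (1 - Q)^2 = 1 - B = A;
   [r] is the same iteration for the scalar 1, and dominates it. *)
Fixpoint root_iter n x : H :=
  if n is n'.+1 then half *: (B x + root_iter n' (root_iter n' x)) else 0.

Fixpoint root_bound n : R :=
  if n is n'.+1 then 2^-1 * (1 + root_bound n' ^+ 2) else 0.

Local Notation Q := root_iter.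
Local Notation r := root_bound.

Let BB : bounded_op B.
Proof. exact: (bounded_opB (bounded_op_id H) bA). Qed.

Let lB : linear B. Proof. by case: BB. Qed.

Let rnorm_half : rnorm half = 2^-1.
Proof. by rewrite rnorm_real ger0_norm. Qed.

Lemma root_bound_ge0 n : 0 <= r n.
Proof.
by case: n => //= n; rewrite mulr_ge0 ?invr_ge0// addr_ge0// sqr_ge0.
Qed.

Lemma root_bound_le1 n : r n <= 1.
Proof. elim: n => //= n IH; have := root_bound_ge0 n; nra. Qed.

Lemma root_bound_mono n : r n <= r n.+1.
Proof. by rewrite /=; have := sqr_ge0 (r n - 1); nra. Qed.

Lemma root_iter_linear n : linear (Q n).
Proof.
elim: n => [|n IH] c x y /=; first by rewrite scaler0 addr0.
rewrite lB !IH addrACA -(scalerDr c) [in RHS]scalerA [c * half]mulrC -[in RHS]scalerA.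
by rewrite -(scalerDr half).
Qed.

Lemma root_iter_rnorm n x : rnorm (Q n x) <= r n * rnorm x.
Proof.
elim: n x => [|n IH] x /=; first by rewrite rnorm0 mul0r.
rewrite rnormZ rnorm_half -mulrA ler_wpM2l// mulrDl mul1r.
apply: le_trans (rnormD _ _) _; apply: lerD; first exact: B1.
by apply: le_trans (IH _) _; rewrite expr2 -mulrA ler_wpM2l// root_bound_ge0.
Qed.

Lemma root_iter_sym n x y : ip (Q n x) y = ip x (Q n y).
Proof.
elim: n x y => [|n IH] x y /=; first by rewrite ip0l ip0r.
rewrite ipZl ipZr /B !(ipDl, ipDr, ipNl, ipNr) !IH sA; congr (_ * _).
by apply/eqP; rewrite eq_complex /= oppr0 !eqxx.
Qed.

Lemma root_iter_comm n C : linear C -> (forall x, C (A x) = A (C x)) ->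
  forall x, C (Q n x) = Q n (C x).
Proof.
move=> lC CA; elim: n => [|n IH] x /=; first exact: linear_map0.
by rewrite (linear_mapZ lC) (linear_mapD lC) !IH /B (linear_mapB lC) CA.
Qed.

Lemma root_iterC m n x : Q m (Q n x) = Q n (Q m x).
Proof.
apply: root_iter_comm; first exact: root_iter_linear.
move=> y; apply/esym; apply: root_iter_comm => //; by case: bA.
Qed.

(** The iterates commute, hence Q_{n+2} - Q_{n+1} = (Q_{n+1} + Q_n)(Q_{n+1} - Q_n) / 2. The scalars
    r_n obey the same recursion with equality, so domination passes from one step to the next. *)
Lemma root_iter_step n x :
  rnorm (Q n.+1 x - Q n x) <= (r n.+1 - r n) * rnorm x.
Proof.
elim: n x => [|n IH] x.
  rewrite /= subr0 subr0 addr0 expr0n addr0 rnormZ rnorm_half mulr1.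
  apply: ler_wpM2l; first by rewrite invr_ge0.
  exact: B1.
have -> : Q n.+2 x - Q n.+1 x =
    half *: (Q n.+1 (Q n.+1 x - Q n x) + Q n (Q n.+1 x - Q n x)).
  have -> : Q n.+2 x - Q n.+1 x =
    half *: (B x + Q n.+1 (Q n.+1 x)) - half *: (B x + Q n (Q n x)) by [].
  rewrite -scalerBr opprD addrACA subrr add0r (linear_mapB (root_iter_linear n.+1)).
  by rewrite (linear_mapB (root_iter_linear n)) (root_iterC n n.+1) addrA subrK.
rewrite rnormZ rnorm_half.
have h := rnormD (Q n.+1 (Q n.+1 x - Q n x)) (Q n (Q n.+1 x - Q n x)).
have h1 := root_iter_rnorm n.+1 (Q n.+1 x - Q n x).
have h2 := root_iter_rnorm n (Q n.+1 x - Q n x).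
have rn0 := root_bound_ge0 n; have rn1 := root_bound_ge0 n.+1.
have IHx := IH x.
rewrite (_ : r n.+2 - r n.+1 = 2^-1 * ((r n.+1 + r n) * (r n.+1 - r n))); last by rewrite /=; field.
rewrite -!mulrA ler_wpM2l//.
apply: (le_trans h); apply: le_trans (lerD h1 h2) _; rewrite -mulrDl.
by rewrite ler_wpM2l ?addr_ge0.
Qed.

Lemma root_iter_dist n m x : (m <= n)%N ->
  rnorm (Q n x - Q m x) <= r n * rnorm x - r m * rnorm x.
Proof.
move=> /subnK <-; elim: (n - m)%N => [|k IH]; first by rewrite add0n !subrr rnorm0.
rewrite addSn -(subrKA (Q (k + m) x)) -[leRHS](subrKA (r (k + m) * rnorm x)).
by apply: le_trans (rnormD _ _) _; rewrite lerD// -mulrBl; exact: root_iter_step.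
Qed.

Lemma root_iter_cvg : exists Qi : H -> H, forall x, scvg (Q ^~ x) (Qi x).
Proof.
suff h x : exists y, scvg (Q ^~ x) y by have [f hf] := choice h; exists f.
apply: HC.
have /cvg_ex[l rl] : cvg (r @ \oo).
  apply: nondecreasing_is_cvgn; last by exists 1 => _ [n _ <-]; exact: root_bound_le1.
  by apply/nondecreasing_seqP => n; exact: root_bound_mono.
apply: (@scauchy_le _ _ _ (fun n => r n * rnorm x)); last exact: cvgMl rl.
by move=> n m mn; exact: root_iter_dist.
Qed.

(** The limit Q satisfies Q = (B + Q^2) / 2, and S = 1 - Q is positive because Q is a symmetric
    contraction. Operators commuting with A commute with every iterate, hence with S; the uniqueness
    of roots rests on this clause. *)
Lemma contraction_root : exists S, [/\ positive_op S, S \o S = A &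
  forall C, bounded_op C -> (forall x, C (A x) = A (C x)) ->
    forall x, C (S x) = S (C x)].
Proof.
have [Qi hQ] := root_iter_cvg.
have lQ : linear Qi.
  move=> c x y; apply: scvg_unique (hQ _) _.
  have := scvgD (scvgZ c (hQ x)) (hQ y); congr scvg; apply/funext => n.
  by rewrite root_iter_linear.
have nQ x : rnorm (Qi x) <= rnorm x.
  have h := scvg_rnorm (hQ x); rewrite -(cvg_lim _ h)//.
  apply: limr_le; first exact: cvgP h.
  apply: nearW => n; apply: le_trans (root_iter_rnorm _ _) _.
  by rewrite ler_piMl ?rnorm_ge0 ?root_bound_le1.
(* Passing to the limit in the recursion: Q_n Q_n x and Q_n Q x differ by at most |Q_n x - Q x|, as
   each Q_n is a contraction. *)
have QQ x : Qi x = half *: (B x + Qi (Qi x)).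
  apply: (@scvg_unique _ _ (fun n => Q n.+1 x)).
    apply/scvgP => e e0; have [N hN] := (scvgP _ _).1 (hQ x) e e0.
    by exists N => n Nn; apply: hN; exact: leqW.
  apply: scvgZ; apply: scvgD; first exact: scvg_cst.
  apply: (@scvg_le _ _ _ _ (fun n => rnorm (Q n x - Qi x) + rnorm (Q n (Qi x) - Qi (Qi x)))).
    move=> n; rewrite -(subrKA (Q n (Qi x))) -(linear_mapB (root_iter_linear n)).
    apply: le_trans (rnormD _ _) _; rewrite lerD2r.
    apply: le_trans (root_iter_rnorm _ _) _.
    by rewrite ler_piMl ?rnorm_ge0 ?root_bound_le1.
  by rewrite -[0]addr0; apply: cvgD; exact: hQ.
have symQ x y : ip (Qi x) y = ip x (Qi y).
  apply: scvg_unique (scvg_ipl y (hQ x)) _.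
  under eq_fun do rewrite root_iter_sym.
  exact: (scvg_ip2 (scvg_cst x) (hQ y)).
have bQ : bounded_op Qi by split=> //; exists 1 => x; rewrite mul1r.
exists (fun x => x - Qi x); split.
- apply: positive_opP; first exact: (bounded_opB (bounded_op_id H) bQ).
  move=> x; exists (rnorm x ^+ 2 - Re (ip (Qi x) x)).
    rewrite subr_ge0; apply: le_trans (ler_norm _) _.
    apply: le_trans (Re_ip_le _ _) _; rewrite expr2 ler_wpM2r ?rnorm_ge0//.
  rewrite ipBl rmorphB /= ip_sqr; congr (_ - _).
  have : ip (Qi x) x = conj (ip (Qi x) x) by rewrite -ipC symQ.
  case: (ip (Qi x) x) => a b [] /= /eqP; rewrite -addr_eq0 -mulr2n mulrn_eq0 /=.
  by move=> /eqP ->.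
- apply/funext => x /=; rewrite (linear_mapB lQ).
  have := QQ x => /(congr1 (fun y => (2%:C)%C *: y)).
  rewrite scalerA -rmorphM /= divff// scale1r.
  rewrite (_ : 2%:C%C = 2%:R); last by rewrite rmorph_nat.
  rewrite scaler_nat mulr2n => E.
  have -> : A x = x + Qi (Qi x) - (Qi x + Qi x).
    by rewrite E [x - A x + _]addrAC opprB [RHS]addrC subrK.
  by rewrite opprB opprD addrACA.
- move=> C bC CA x; have [lC _] := bC; rewrite (linear_mapB lC); congr (_ - _).
  apply: scvg_unique (scvg_bounded_op bC (hQ x)) _.
  have := hQ (C x); congr scvg; apply/funext => n /=.
  by rewrite root_iter_comm.
Qed.

End construction.
End square_roots.

(** * Absolute values and the trace norm *)

Section trace_norm.
Context (R : realType) (H : preHilbertType R).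
Hypotheses (HC : scomplete H) (Hd : exists u : nat -> H, sdense u).
Implicit Types A S T : H -> H.

(** The factor c = 1/M^2 makes A = c T^H T satisfy |A x|^2 <= c |T x|^2, so |x - A x|^2 <= |x|^2 - c
    |T x|^2 and the iteration applies. Multiplying the root by M undoes the scaling. *)
Lemma gram_root T : bounded_op T -> exists S, [/\ positive_op S,
  S \o S = adj T \o T &
  forall C, bounded_op C -> (forall x, C (adj T (T x)) = adj T (T (C x))) ->
    forall x, C (S x) = S (C x)].
Proof.
move=> bT; have [M M0 hM] := bounded_op_ge0 bT.
have aT := adjP HC Hd bT; have bA := adj_bounded HC Hd bT.
have aM := adj_rnorm_le HC Hd (bT.1) (ltW M0) hM.
pose c : R[i] := (M ^- 2)%:C%C; pose A x := c *: adj T (T x).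
have cJ : conj c = c by apply/eqP; rewrite eq_complex /= oppr0 !eqxx.
have ipA x y : ip (A x) y = c * ip (T x) (T y).
  by rewrite ipZl; congr (_ * _); rewrite ipC -aT -ipC.
have [|x y|x|S [pS SS cS]] := @contraction_root R H A _ _ _ HC.
- exact: (bounded_opZ _ (bounded_op_comp bT bA)).
- by rewrite ipA /A ipZr cJ aT.
- rewrite -ler_sqr ?nnegrE ?rnorm_ge0// rnorm_sqrB.
  rewrite [ip x (A x)]ipC ReJ ipA ReZ Re_ip_sqr.
  have : rnorm (A x) ^+ 2 <= M ^- 2 * rnorm (T x) ^+ 2.
    rewrite rnormZ rnorm_real ger0_norm; last by rewrite invr_ge0 exprn_ge0// ltW.
    rewrite exprMn [(M ^- 2) ^+ 2]expr2 -mulrA ler_pM2l ?invr_gt0 ?exprn_gt0//.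
    rewrite mulrC ler_pdivrMr ?exprn_gt0// mulrC -exprMn.
    by rewrite lerXn2r ?nnegrE ?rnorm_ge0 ?mulr_ge0 ?rnorm_ge0// ltW.
  have : 0 <= M ^- 2 * rnorm (T x) ^+ 2.
    by rewrite mulr_ge0 ?sqr_ge0// invr_ge0 exprn_ge0// ltW.
  lra.
exists (fun x => M%:C%C *: S x); have [[lS _] _] := pS; split.
- apply: positive_opP; first by apply: bounded_opZ; case: pS.
  move=> x; exists (M * Re (ip (S x) x)).
    by rewrite mulr_ge0 ?positive_op_Re// ltW.
  by rewrite ipZl rmorphM /= -pos_real//; case: pS.
- apply/funext => x /=; rewrite (linear_mapZ lS) scalerA -rmorphM /= -expr2.
  have /= -> := congr1 (@^~ x) SS; rewrite /A scalerA -rmorphM /= divff ?scale1r//.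
  by rewrite expf_neq0// gt_eqF.
- move=> C bC CT x; rewrite (linear_mapZ bC.1) cS//.
  by move=> y; rewrite /A (linear_mapZ bC.1) CT.
Qed.

(** Let T be the constructed root of S^2. Any positive root P of S^2 commutes with S^2, hence with
    T, so (T + P)(T - P) = 0. With X = T - P, the forms of T and P at X x are nonnegative with sum
    0; thus T X x = P X x = 0, and |X x|^2 = <x, T X x> - <x, P X x> = 0. *)
Lemma positive_root_unique S S' : positive_op S -> positive_op S' ->
  S \o S = S' \o S' -> S = S'.
Proof.
move=> pS pS' SS'.
have [T [pT TT cT]] := gram_root pS.1.
rewrite positive_op_adj// in TT cT.
suff key P : positive_op P -> P \o P = S \o S -> T = P by rewrite -(key S)// -(key S').
move=> pP PP.
have lT := pT.1.1; have lP := pP.1.1.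
have PT x : P (T x) = T (P x).
  apply: (cT P pP.1) => y.
  by have /= <- := congr1 (@^~ y) PP; have /= <- := congr1 (@^~ (P y)) PP.
pose X x := T x - P x.
have XX x : T (X x) + P (X x) = 0.
  rewrite /X (linear_mapB lT) (linear_mapB lP) PT addrA subrK.
  have /= -> := congr1 (@^~ x) TT; have /= -> := congr1 (@^~ x) PP.
  exact: subrr.
apply/funext => x; apply/eqP; rewrite -subr_eq0; apply/eqP; rewrite -/(X x).
have ip0 : Re (ip (T (X x)) (X x)) + Re (ip (P (X x)) (X x)) = 0.
  by rewrite -ReD -ipDl XX ip0l.
move: ip0 => /eqP; rewrite paddr_eq0 ?positive_op_Re// => /andP[/eqP T0 /eqP P0].
have {}T0 := positive_op_ip0 pT T0; have {}P0 := positive_op_ip0 pP P0.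
apply: rnorm_eq0; apply/eqP; rewrite -sqrf_eq0 -Re_ip_sqr.
rewrite {1}/X ipBl (positive_op_sym pT) (positive_op_sym pP) T0 P0.
by rewrite subrr.
Qed.

Lemma abs_opP T : bounded_op T ->
  positive_op (abs_op T) /\ abs_op T \o abs_op T = adj T \o T.
Proof.
move=> bT; rewrite /abs_op; case: xgetP => [S -> //|h].
by have [S [pS SS _]] := gram_root bT; case: (h S).
Qed.

Lemma abs_op_positive A : positive_op A -> abs_op A = A.
Proof.
move=> pA; have [pS SS] := abs_opP pA.1.
by apply: positive_root_unique => //; rewrite SS positive_op_adj.
Qed.

Variable e : nat -> H.
Hypotheses (one : orthonormal_seq e) (te : total_seq e).
Hypothesis esumE : forall F : H -> \bar R, (forall x, 0 <= F x)%E -> F 0 = 0%E ->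
  (\esum_(x in @onb R H) F x = \sum_(0 <= n <oo) F (e n))%E.

Lemma trnorm_positive A : positive_op A ->
  (trnorm A = \sum_(0 <= n <oo) (Re (ip (A (e n)) (e n)))%:E)%E.
Proof.
move=> pA; rewrite /trnorm asboolT; last by case: pA.
rewrite abs_op_positive// esumE//.
  by move=> x; rewrite lee_fin positive_op_Re.
by rewrite ip0r.
Qed.

Lemma trnorm_ge0 A : (0 <= trnorm A)%E.
Proof.
rewrite /trnorm; case: asboolP => // bA; apply: esum_ge0 => x _.
by rewrite lee_fin positive_op_Re//; case: (abs_opP bA).
Qed.

(** Cauchy-Schwarz for the form of S against each [e n], summed by Parseval, gives |S x|^2 <= <S x,
    x> tr S <= |S x| |x| tr S. *)
Lemma positive_rnorm_le_trace S x : positive_op S ->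
  ((rnorm (S x))%:E <=
   (\sum_(0 <= n <oo) (Re (ip (S (e n)) (e n)))%:E) * (rnorm x)%:E)%E.
Proof.
move=> pS; set t := (\sum_(0 <= n <oo) _)%E.
have t0 : (0 <= t)%E by apply: nneseries_ge0 => n _ _; rewrite lee_fin positive_op_Re.
have [x0|nx] := eqVneq (rnorm x) 0.
  by rewrite (rnorm_eq0 x0) (linear_map0 pS.1.1) !rnorm0 mule0.
have xp : 0 < rnorm x by rewrite lt_neqAle eq_sym nx rnorm_ge0.
have h : ((rnorm (S x) ^+ 2)%:E <= (Re (ip (S x) x))%:E * t)%E.
  rewrite -(parseval one HC te) -nneseriesZl; last first.
    by move=> n _; rewrite lee_fin positive_op_Re.
  apply: lee_nneseries => n _; first by rewrite lee_fin sqr_ge0.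
  by rewrite -EFinM lee_fin positive_cauchy_schwarz.
have hx : Re (ip (S x) x) <= rnorm (S x) * rnorm x.
  exact: le_trans (ler_norm _) (Re_ip_le _ _).
case: t t0 h => [t| |//] /=; rewrite ?lee_fin; last first.
  by move=> _ _; rewrite gt0_mulye ?lte_fin// leey.
move=> t0; rewrite -?EFinM ?lee_fin => h.
have [->|nS] := eqVneq (rnorm (S x)) 0; first by rewrite mulr_ge0 ?rnorm_ge0.
have Sp : 0 < rnorm (S x) by rewrite lt_neqAle eq_sym nS rnorm_ge0.
rewrite -(ler_pM2l Sp) -expr2; apply: le_trans h _.
by rewrite [t * rnorm x]mulrC mulrA ler_wpM2r.
Qed.

(** A and its absolute value have the same norm at x, and the latter is bounded by its trace.
    Through this bound, convergence in trace norm is read off on quadratic forms. *)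
Lemma Re_ip_le_trnorm A x :
  ((`|Re (ip (A x) x)| / rnorm x ^+ 2)%:E <= trnorm A)%E.
Proof.
rewrite /trnorm; case: asboolP => [bA|_]; last by rewrite leey.
have [pS SS] := abs_opP bA; set S := abs_op A in pS SS *.
rewrite esumE; last 2 first.
- by move=> y; rewrite lee_fin positive_op_Re.
- by rewrite ip0r.
set t := (\sum_(0 <= n <oo) _)%E.
have t0 : (0 <= t)%E by apply: nneseries_ge0 => n _ _; rewrite lee_fin positive_op_Re.
(* For x = 0 the quotient is 0, since the inverse of 0 is 0. *)
have [->|nx] := eqVneq (rnorm x) 0; first by rewrite expr0n invr0 mulr0.
have xp : 0 < rnorm x by rewrite lt_neqAle eq_sym nx rnorm_ge0.
have AS : rnorm (A x) = rnorm (S x).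
  apply: (@pexpIrn _ 2) => //; rewrite ?nnegrE ?rnorm_ge0// -!Re_ip_sqr.
  rewrite (positive_op_sym pS) (adjP HC Hd bA).
  by have /= -> := congr1 (@^~ x) SS.
have := positive_rnorm_le_trace x pS; rewrite -/t.
case: t t0 => [t| |//] /=; rewrite ?lee_fin ?leey//.
move=> t0; rewrite -?EFinM ?lee_fin => h.
rewrite ler_pdivrMr ?exprn_gt0// expr2 mulrA.
by apply: le_trans (Re_ip_le _ _) _; rewrite ler_wpM2r ?rnorm_ge0// AS.
Qed.

End trace_norm.

(** * Comparison of integrals and integration against densities *)

Section integral_comparison.
Local Open Scope ereal_scope.
Context d (T : measurableType d) (R : realType).
Implicit Types mu : {measure set T -> \bar R}.

(** A simple function below f, cut off on the exceptional null set, has the same integral and lies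
    below g. The lemma is stated for arbitrary nonnegative functions because it is applied to trace
    norms whose measurability is not established. *)
Lemma ge0_le_integral_ae mu (f g : T -> \bar R) :
  (forall x, 0 <= f x) -> (forall x, 0 <= g x) ->
  {ae mu, forall x, f x <= g x} -> \int[mu]_x f x <= \int[mu]_x g x.
Proof.
move=> f0 g0 [N [mN N0 subN]].
rewrite [leLHS]ge0_integralTE//; apply: ge_ereal_sup => _ [h /= hf <-].
have mNc := measurableC mN.
rewrite -integralT_nnsfun (ge0_negligible_integral _ _ _ _ N0)//; last 2 first.
- exact/measurable_EFinP/measurable_funP.
- by move=> x _; rewrite lee_fin.
rewrite setTD integral_mkcond.
rewrite (eq_integral (EFin \o proj_nnsfun h mNc)); last first.
  move=> x _; rewrite /= patchE /proj_nnsfun/= mindicE; case: ifP => _.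
    by rewrite mulr1.
  by rewrite mulr0.
rewrite integralT_nnsfun ge0_integralTE//; apply: ereal_sup_ubound => /=.
exists (proj_nnsfun h mNc) => // x; rewrite /proj_nnsfun/= mindicE.
have [xN|xN] := boolP (x \in ~` N); last by rewrite mulr0.
rewrite mulr1; apply: le_trans (hf x) _.
by apply: contrapT => nfg; move: xN; rewrite inE; apply; exact: subN.
Qed.

Lemma ge0_le_integral_ae_dom mu (D : set T) (f g : T -> \bar R) :
  (forall x, 0 <= f x) -> (forall x, 0 <= g x) ->
  {ae mu, forall x, D x -> f x <= g x} ->
  \int[mu]_(x in D) f x <= \int[mu]_(x in D) g x.
Proof.
move=> f0 g0 fg; rewrite [leLHS]integral_mkcond [leRHS]integral_mkcond.
apply: ge0_le_integral_ae; [exact: erestrict_ge0|exact: erestrict_ge0|].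
apply: filterS fg => x fg; rewrite !patchE; case: ifPn => //.
by rewrite inE.
Qed.

Lemma integral_nnsfun_density mu (q : T -> \bar R) (f : {nnsfun T >-> R}) :
  measurable_fun setT q -> (forall x, 0 <= q x) ->
  \int[mu]_x ((f x)%:E * q x) = \sum_(k \in range f)
    (k%:E * \int[mu]_(x in f @^-1` [set k]) q x).
Proof.
move=> mq q0; transitivity (\int[mu]_x (\sum_(k \in range f)
    ((k * \1_(f @^-1` [set k]) x)%:E * q x))).
  apply: eq_integral => x _; rewrite {1}fimfunE -fsumEFin//.
  by rewrite ge0_mule_fsuml// => k; rewrite nnfun_muleindic_ge0.
rewrite ge0_integral_fsum//; last 2 first.
- move=> k; apply: emeasurable_funM => //; apply/measurable_EFinP.
  by apply: measurable_funM => //; exact: measurable_indic.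
- by move=> k x _; rewrite mule_ge0// nnfun_muleindic_ge0.
apply: eq_fsbigr => k /[!inE] -[y _ fyk].
have k0 : (0 <= k)%R by rewrite -fyk.
rewrite -ge0_integralZl//; last exact: measurable_funTS.
rewrite [RHS]integral_mkcond; apply: eq_integral => x _; rewrite patchE indicE.
by case: ifP => _; rewrite ?mulr1 ?mulr0 ?mul0e ?mule0.
Qed.

Lemma integral_density mu mu' (q q' f : T -> \bar R) :
  measurable_fun setT q -> measurable_fun setT q' -> measurable_fun setT f ->
  (forall x, 0 <= q x) -> (forall x, 0 <= q' x) -> (forall x, 0 <= f x) ->
  (forall A, measurable A -> \int[mu]_(x in A) q x = \int[mu']_(x in A) q' x) ->
  \int[mu]_x (f x * q x) = \int[mu']_x (f x * q' x).
Proof.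
move=> mq mq' mf q0 q'0 f0 qq'; pose F := nnsfun_approx measurableT mf.
have key (nu : {measure set T -> \bar R}) (p : T -> \bar R) :
    measurable_fun setT p -> (forall x, 0 <= p x) ->
    \int[nu]_x (f x * p x) = limn (fun n => \int[nu]_x ((F n x)%:E * p x)).
  move=> mp p0; rewrite -monotone_convergence//.
  - apply: eq_integral => x _; apply/esym/cvg_lim => //.
    (* The cases p x = 0 and f x = 0 are split off because either factor may be infinite, and a
       product of limits 0 and +oo is not a limit of products in general. *)
    have [r0|] := ltP 0 (p x); last first.
      move=> px; have -> : p x = 0 by apply/eqP; rewrite eq_le px p0.
      by rewrite mule0; under eq_fun do rewrite mule0; exact: cvg_cst.
    have hF : (F n x)%:E @[n --> \oo] --> f x by apply: cvg_nnsfun_approx.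
    have hm : nondecreasing_seq (fun n => (F n x)%:E * p x).
      move=> m n mn; rewrite lee_wpmul2r// lee_fin.
      by have /lefP := nd_nnsfun_approx measurableT mf mn; exact.
    have [fx|fx] := eqVneq (f x) 0.
      rewrite fx mul0e.
      have F0 n : F n x = 0%R.
        apply/eqP; rewrite eq_le; apply/andP; split; last exact: fun_ge0.
        suff : (F n x)%:E <= f x by rewrite fx lee_fin.
        rewrite -(cvg_lim _ hF)//; apply: lime_ge; first exact: cvgP hF.
        exists n => // m nm; rewrite lee_fin.
        by have /lefP := nd_nnsfun_approx measurableT mf nm; exact.
      by under eq_fun do rewrite F0 mul0e; exact: cvg_cst.
    have fp : 0 < f x by rewrite lt_neqAle eq_sym fx f0.
    apply: cvgeM => //; last exact: cvg_cst.
    by apply: neq0_mule_def; rewrite gt_eqF// mule_gt0.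
  - move=> n; apply: emeasurable_funM => //.
    exact/measurable_EFinP/measurable_funP.
  - by move=> n x _; rewrite mule_ge0// lee_fin.
  - move=> x _ m n mn; rewrite lee_wpmul2r// lee_fin.
    by have /lefP := nd_nnsfun_approx measurableT mf mn; exact.
rewrite !key//; congr (limn _); apply/funext => n.
rewrite !integral_nnsfun_density//; apply: eq_fsbigr => k _.
by rewrite qq'//; exact: measurable_sfunP.
Qed.

End integral_comparison.

(** * Bochner integrals seen through quadratic forms *)

Section bochner_quadratic_forms.
Context d (T : measurableType d) (R : realType) (mu : {measure set T -> \bar R}).
Context (H : preHilbertType R).
Hypotheses (HC : scomplete H) (Hd : exists u : nat -> H, sdense u).
Implicit Types (s : seq (set T * (H -> H))) (g : T -> H -> H) (x : H).

Lemma Re_ip_trnorm_le (A : H -> H) x :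
  ((`|Re (ip (A x) x)| / rnorm x ^+ 2)%:E <= trnorm A)%E.
Proof.
have [u /onb_enum[e [one te esumE]]] := Hd.
exact: (Re_ip_le_trnorm HC Hd one te esumE).
Qed.

Lemma trnormP (A : H -> H) : (0 <= trnorm A)%E.
Proof. exact: trnorm_ge0. Qed.

(** Real-linear in the operator and controlled by the trace norm, these forms turn Bochner integrals
    of operators into scalar integrals. *)
Definition qform x (A : H -> H) : R := Re (ip (A x) x).

Lemma qformD x A B : qform x (A + B) = qform x A + qform x B.
Proof. by rewrite /qform ipDl ReD. Qed.

Lemma qformB x A B : qform x (A - B) = qform x A - qform x B.
Proof. by rewrite /qform ipBl ReD ReN. Qed.

Lemma qform0 x : qform x 0 = 0.
Proof. by rewrite /qform ip0l. Qed.

Lemma qformZ x (r : R) A : qform x (r%:C%C *: A) = r * qform x A.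
Proof. by rewrite /qform ipZl ReZ. Qed.

Lemma qform_sfun_cons x p s t : qform x (sfun_eval (p :: s) t) =
  \1_(p.1) t * qform x p.2 + qform x (sfun_eval s t).
Proof.
rewrite /sfun_eval big_cons qformD; congr (_ + _); rewrite indicE.
case: asboolP => h; first by rewrite mem_set// mul1r.
by rewrite memNset// mul0r qform0.
Qed.

Lemma measurable_qform_sfun x s : (forall p, p \in s -> measurable p.1) ->
  measurable_fun setT (fun t => qform x (sfun_eval s t)).
Proof.
elim: s => [|p s IH] ms.
  rewrite (_ : (fun t => _) = cst 0); first exact: measurable_cst.
  by apply/funext => t; rewrite /sfun_eval big_nil qform0.
under eq_fun do rewrite qform_sfun_cons.
apply: measurable_funD.
  apply: measurable_funM => //; apply: measurable_indic.
  by apply: ms; rewrite mem_head.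
by apply: IH => q qs; apply: ms; rewrite inE qs orbT.
Qed.

Lemma integral_qform_sfun (A : set T) x s : measurable A ->
  (forall p, p \in s -> measurable p.1) ->
  (forall p, p \in s -> (mu (A `&` p.1) < +oo)%E) ->
  mu.-integrable A (fun t => (qform x (sfun_eval s t))%:E) /\
  (\int[mu]_(t in A) (qform x (sfun_eval s t))%:E)%E =
    (qform x (sfun_integral mu A s))%:E.
Proof.
move=> mA; elim: s => [|p s IH] ms fs.
  rewrite (_ : (fun t => _) = cst 0%E); last first.
    by apply/funext => t; rewrite /sfun_eval big_nil qform0.
  by rewrite /sfun_integral big_nil qform0 integral0; split=> //; exact: integrable0.
have [||iH eH] := IH.
- by move=> q qs; apply: ms; rewrite inE qs orbT.
- by move=> q qs; apply: fs; rewrite inE qs orbT.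
have mp : measurable p.1 by apply: ms; rewrite mem_head.
have fp : (mu (A `&` p.1) < +oo)%E by apply: fs; rewrite mem_head.
have ip1 : mu.-integrable A (fun t => (\1_(p.1) t)%:E).
  apply/integrableP; split; first exact/measurable_EFinP/measurable_indic.
  under eq_integral do rewrite /= ger0_norm//.
  by rewrite integral_indic// setIC.
have ip2 : mu.-integrable A (fun t => (\1_(p.1) t * qform x p.2)%:E).
  under eq_fun do rewrite EFinM; exact: integrableZr.
have E : (fun t => (qform x (sfun_eval (p :: s) t))%:E) =
    (fun t => (\1_(p.1) t * qform x p.2)%:E + (qform x (sfun_eval s t))%:E)%E.
  by apply/funext => t; rewrite qform_sfun_cons EFinD.
rewrite E; split; first exact: integrableD.
rewrite integralD// eH /sfun_integral big_cons qformD EFinD; congr (_ + _)%E.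
under eq_integral do rewrite EFinM muleC.
rewrite integralZl// integral_indic// setIC.
rewrite qformZ EFinM fineK 1?muleC//.
by rewrite ge0_fin_numE.
Qed.

Lemma cvg_qform_of_trnorm (a : nat -> \bar R) (c : nat -> R) x : x != 0 ->
  (forall n, ((`|c n| / rnorm x ^+ 2)%:E <= a n)%E) ->
  a n @[n --> \oo] --> 0%E -> c n @[n --> \oo] --> (0 : R).
Proof.
move=> x0 ca a0.
have nx : rnorm x ^+ 2 != 0 by rewrite sqrf_eq0; apply: contra_neq x0; exact: rnorm_eq0.
have : (`|c n| / rnorm x ^+ 2)%:E @[n --> \oo] --> (0%:E : \bar R).
  apply: (squeeze_cvge _ (@cvg_cst _ 0%E _ _ _) a0).
  by apply: nearW => n; rewrite ca andbT lee_fin mulr_ge0// invr_ge0 sqr_ge0.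
move=> /fine_cvg /= h; apply/norm_cvg0P.
rewrite (_ : (fun n => _) = (fun n => (`|c n| / rnorm x ^+ 2) * rnorm x ^+ 2)).
  by rewrite -(mul0r (rnorm x ^+ 2)); apply: cvgMl; exact: h.
by apply/funext => n; rewrite divfK.
Qed.

Lemma qform_eq0 A : qform 0 A = 0.
Proof. by rewrite /qform ip0r. Qed.

Lemma measurable_qform g x : strongly_measurable (@trnorm R H) g ->
  measurable_fun setT (fun t => qform x (g t)).
Proof.
move=> [s ss hs]; have [->|x0] := eqVneq x 0.
  by under eq_fun do rewrite qform_eq0; exact: measurable_cst.
apply: (measurable_fun_cvg (h := fun n t => qform x (sfun_eval (s n) t))).
  by move=> n; apply: measurable_qform_sfun => p ps; case: (ss n p ps).
move=> t _; apply/subr_cvg0.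
apply: (cvg_qform_of_trnorm x0 _ (hs t)) => n.
by rewrite -qformB; exact: Re_ip_trnorm_le.
Qed.

Lemma integrable_qform g x : bochner_Lp mu (@trnorm R H) 1 g ->
  mu.-integrable setT (fun t => (qform x (g t))%:E).
Proof.
move=> [sg ig]; have mq := measurable_qform x sg.
have [->|x0] := eqVneq x 0.
  by under eq_fun do rewrite qform_eq0; exact: integrable0.
have nx : rnorm x ^+ 2 != 0 by rewrite sqrf_eq0; apply: contra_neq x0; exact: rnorm_eq0.
apply/integrableP; split; first exact/measurable_EFinP.
rewrite (eq_integral (fun t => (rnorm x ^+ 2)%:E * (`|qform x (g t)| / rnorm x ^+ 2)%:E)%E); last first.
  by move=> t _; rewrite -EFinM mulrC divfK.
rewrite ge0_integralZl//.
- apply: lte_mul_pinfty => //; first by rewrite lee_fin sqr_ge0.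
  apply: le_lt_trans ig; apply: ge0_le_integral_ae.
  + by move=> t; rewrite lee_fin mulr_ge0// invr_ge0 sqr_ge0.
  + by move=> t; exact: trnormP.
  + by apply: aeW => t; exact: Re_ip_trnorm_le.
- apply/measurable_EFinP; apply: measurable_funM => //.
  exact: measurableT_comp.
- by move=> t _; rewrite lee_fin mulr_ge0// invr_ge0 sqr_ge0.
- by rewrite lee_fin sqr_ge0.
Qed.

Lemma integral_qform g x A I : measurable A -> bochner_Lp mu (@trnorm R H) 1 g ->
  is_bochner_integral mu (@trnorm R H) A g I ->
  (\int[mu]_(t in A) (qform x (g t))%:E)%E = (qform x I)%:E.
Proof.
move=> mA Lg [_ [s [ss fs is_ sI]]].
have [->|x0] := eqVneq x 0.
  by under eq_integral do rewrite qform_eq0; rewrite qform_eq0 integral0.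
have nx : 0 < rnorm x ^+ 2.
  by rewrite exprn_gt0// lt_neqAle rnorm_ge0 andbT eq_sym; apply: contra_neq x0; exact: rnorm_eq0.
have iq : mu.-integrable A (fun t => (qform x (g t))%:E).
  exact: integrableS (integrable_qform x Lg).
have mq := measurable_int _ iq.
have sn n := @integral_qform_sfun A x (s n) mA
  (fun p ps => (ss n p ps).1) (fun p ps => fs n p ps).
pose a : R := fine (\int[mu]_(t in A) (qform x (g t))%:E)%E.
have aE : (\int[mu]_(t in A) (qform x (g t))%:E)%E = a%:E.
  by rewrite /a fineK//; exact: integrable_fin_num.
rewrite aE; congr EFin.
pose c n := qform x (sfun_integral mu A (s n)).
have cI : c n @[n --> \oo] --> qform x I.
  apply/subr_cvg0; apply: (cvg_qform_of_trnorm x0 _ sI) => n.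
  by rewrite -qformB; exact: Re_ip_trnorm_le.
(* The integrals of the forms of [s n] and of g differ by at most |x|^2 times the integral of the
   trace norm of their difference, which tends to 0 by definition of the Bochner integral. *)
have ca : c n @[n --> \oo] --> a.
  apply/subr_cvg0; apply: (cvg_qform_of_trnorm x0 _ is_) => n.
  have [in_ en] := sn n.
  have id : mu.-integrable A (fun t => (qform x (sfun_eval (s n) t - g t))%:E).
    by under eq_fun do rewrite qformB EFinB; exact: integrableB.
  have E : (c n - a)%:E = (\int[mu]_(t in A) (qform x (sfun_eval (s n) t - g t))%:E)%E.
    under eq_integral do rewrite qformB EFinB.
    by rewrite integralB// aE en -EFinB.
  rewrite EFinM -abse_EFin E muleC.
  apply: (@le_trans _ _ ((rnorm x ^- 2)%:E *
     \int[mu]_(t in A) `|(qform x (sfun_eval (s n) t - g t))%:E|)%E).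
    rewrite lee_pmul2l ?lte_fin ?invr_gt0//; first exact: le_abse_integral (measurable_int _ id).
  rewrite -ge0_integralZl//.
  - apply: ge0_le_integral_ae_dom.
    + by move=> t; rewrite mule_ge0// lee_fin invr_ge0 ltW.
    + by move=> t; exact: trnormP.
    + by apply: aeW => t _; rewrite /= -EFinM mulrC; exact: Re_ip_trnorm_le.
  - exact: measurableT_comp (measurable_int _ id).
  - by rewrite lee_fin invr_ge0 ltW.
by apply: (cvg_unique _ ca cI).
Qed.

End bochner_quadratic_forms.

(** * Two densities of one operator measure *)

Section change_of_dominating_measure.
Context d (T : measurableType d) (R : realType).
Context (H : preHilbertType R).
Hypotheses (HC : scomplete H) (Hd : exists u : nat -> H, sdense u).
Implicit Types (mu : {measure set T -> \bar R}) (g : T -> H -> H) (x : H).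

(** This is the scalar density of A |-> tr nu(A), a measure common to all the densities of the same
    operator measure nu. *)
Definition trace_density g t : R := fine (trnorm (g t)).

Lemma trace_density_ge0 g t : 0 <= trace_density g t.
Proof. by rewrite /trace_density fine_ge0//; exact: trnormP. Qed.

Lemma trace_densityE g t : S1plus (g t) -> (trace_density g t)%:E = trnorm (g t).
Proof. by move=> [_ gt]; rewrite fineK// ge0_fin_numE//; exact: trnormP. Qed.

(** The norm of a positive operator is at most its trace. *)
Lemma S1plus_trace0 g t : S1plus (g t) -> trace_density g t = 0 -> g t = 0.
Proof.
move=> gS t0; have [u /onb_enum[e [one te esumE]]] := Hd.
have [pg _] := gS; apply/funext => x; apply: rnorm_eq0; apply/eqP.
rewrite eq_le rnorm_ge0 andbT -lee_fin.
apply: le_trans (positive_rnorm_le_trace HC one te x pg) _.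
by rewrite -(trnorm_positive HC Hd esumE pg) -trace_densityE// t0 mul0e.
Qed.

Lemma qform_ge0 g t x : S1plus (g t) -> 0 <= qform x (g t).
Proof. by move=> [pg _]; exact: positive_op_Re. Qed.

Section two_densities.
Variables (mu mu' : {measure set T -> \bar R}) (g g' : T -> H -> H).
Variable nu : set T -> H -> H.
Hypotheses (gS : forall t, S1plus (g t)) (gS' : forall t, S1plus (g' t)).
Hypotheses (Lg : bochner_Lp mu (@trnorm R H) 1 g).
Hypotheses (Lg' : bochner_Lp mu' (@trnorm R H) 1 g').
Hypotheses (gnu : forall A, measurable A ->
  is_bochner_integral mu (@trnorm R H) A g (nu A)).
Hypotheses (gnu' : forall A, measurable A ->
  is_bochner_integral mu' (@trnorm R H) A g' (nu A)).

Local Notation th := (trace_density g).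
Local Notation th' := (trace_density g').

Let mq x : measurable_fun setT (fun t => (qform x (g t))%:E).
Proof. by apply/measurable_EFinP; exact: measurable_qform (proj1 Lg). Qed.

Let mq' x : measurable_fun setT (fun t => (qform x (g' t))%:E).
Proof. by apply/measurable_EFinP; exact: measurable_qform (proj1 Lg'). Qed.

Let q0 x t : (0 <= (qform x (g t))%:E)%E.
Proof. by rewrite lee_fin qform_ge0. Qed.

Let q0' x t : (0 <= (qform x (g' t))%:E)%E.
Proof. by rewrite lee_fin qform_ge0. Qed.

(** Both sides integrate f against the scalar measure A |-> <nu(A) x, x>. *)
Lemma qform_density (f : T -> \bar R) x : measurable_fun setT f ->
  (forall t, (0 <= f t)%E) ->
  (\int[mu]_t (f t * (qform x (g t))%:E) =
   \int[mu']_t (f t * (qform x (g' t))%:E))%E.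
Proof.
move=> mf f0; apply: integral_density => // A mA.
by rewrite (integral_qform HC Hd x mA Lg (gnu mA)) (integral_qform HC Hd x mA Lg' (gnu' mA)).
Qed.

Lemma trace_density_series (k : T -> H -> H) e t :
  (forall F : H -> \bar R, (forall x, 0 <= F x)%E -> F 0 = 0%E ->
    (\esum_(x in @onb R H) F x = \sum_(0 <= n <oo) F (e n))%E) ->
  S1plus (k t) ->
  ((trace_density k t)%:E = \sum_(0 <= n <oo) (qform (e n) (k t))%:E)%E.
Proof.
move=> esumE kS; have [pk _] := kS.
by rewrite trace_densityE// (trnorm_positive HC Hd esumE pk).
Qed.

Lemma measurable_trace_density (k : T -> H -> H) (m : {measure set T -> \bar R}) :
  (forall t, S1plus (k t)) -> bochner_Lp m (@trnorm R H) 1 k ->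
  measurable_fun setT (trace_density k).
Proof.
move=> kS Lk; have [u /onb_enum[e [one te esumE]]] := Hd.
apply/measurable_EFinP.
rewrite (_ : _ \o _ = fun t => (\sum_(0 <= n <oo) (qform (e n) (k t))%:E)%E); last first.
  by apply/funext => t /=; exact: trace_density_series.
apply: ge0_emeasurable_sum.
  by move=> n t _ _; rewrite lee_fin qform_ge0.
by move=> n _; apply/measurable_EFinP; exact: measurable_qform (proj1 Lk).
Qed.

Let mth : measurable_fun setT th. Proof. exact: measurable_trace_density Lg. Qed.
Let mth' : measurable_fun setT th'. Proof. exact: measurable_trace_density Lg'. Qed.

(** Summing the quadratic forms over a basis, both sides integrate f against A |-> tr nu(A). *)
Lemma trace_density_density (f : T -> R) : measurable_fun setT f ->
  (forall t, 0 <= f t) ->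
  (\int[mu]_t (f t * th t)%:E = \int[mu']_t (f t * th' t)%:E)%E.
Proof.
move=> mf f0; have [u /onb_enum[e [one te esumE]]] := Hd.
have mf' : measurable_fun setT (EFin \o f) by exact/measurable_EFinP.
have E (m : {measure set T -> \bar R}) (k : T -> H -> H) :
    (forall t, S1plus (k t)) -> bochner_Lp m (@trnorm R H) 1 k ->
    (\int[m]_t (f t * trace_density k t)%:E =
     \sum_(0 <= n <oo) \int[m]_t ((f t)%:E * (qform (e n) (k t))%:E))%E.
  move=> kS Lk; rewrite -integral_nneseries//.
  - apply: eq_integral => t _; rewrite EFinM (trace_density_series esumE)//.
    by rewrite nneseriesZl// => n _; rewrite lee_fin qform_ge0.
  - move=> n; apply: emeasurable_funM => //.
    by apply/measurable_EFinP; exact: measurable_qform (proj1 Lk).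
  - by move=> n t _; rewrite mule_ge0// lee_fin// qform_ge0.
rewrite (E _ _ gS Lg) (E _ _ gS' Lg'); apply: eq_eseriesr => n _.
by apply: qform_density => // t; rewrite lee_fin.
Qed.

Lemma measurable_inv_ge0 (k : T -> R) : (forall t, 0 <= k t) ->
  measurable_fun setT k -> measurable_fun setT (fun t => (k t)^-1).
Proof.
move=> k0 mk; under eq_fun do rewrite -powR_inv1//.
exact: (measurableT_comp (@measurable_powR R (-1)) mk).
Qed.

(** Two exchanges of measure. Over any A, the integral of th' <g x, x> for mu is that of th' <g' x,
    x> for mu', by the form at x; reading th' as a trace density, it is that of th <g' x, x> for
    mu. *)
Lemma qform_proportional x :
  {ae mu, forall t, th' t * qform x (g t) = th t * qform x (g' t)}.
Proof.
(* The weight keeps w th' <= 1, which makes the left-hand function integrable; equal integrals over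
   all sets then give equality almost everywhere. *)
pose w t : R := (1 + th' t)^-1.
have w0 t : 0 < 1 + th' t by rewrite ltr_pwDl// trace_density_ge0.
have wp t : 0 < w t by rewrite invr_gt0.
have wg0 t : 0 <= w t by exact: ltW.
have mw : measurable_fun setT w.
  apply: measurable_inv_ge0; first by move=> t; exact: ltW.
  by apply: measurable_funD.
have mqx : measurable_fun setT (fun t => qform x (g t)) := measurable_qform HC Hd x (proj1 Lg).
have mqx' : measurable_fun setT (fun t => qform x (g' t)) := measurable_qform HC Hd x (proj1 Lg').
have iq : mu.-integrable setT (fun t => (w t * th' t * qform x (g t))%:E).
  apply: le_integrable (integrable_qform HC Hd x Lg) => //.
    by apply/measurable_EFinP; apply: measurable_funM => //; exact: measurable_funM.
  move=> t _ /=; rewrite lee_fin normrM ler_piMl//.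
  rewrite ger0_norm; last by rewrite mulr_ge0 ?trace_density_ge0// ltW.
  by rewrite mulrC ler_pdivrMr// mul1r lerDr.
have h := integral_ae_eq measurableT iq.
have /h : measurable_fun setT (fun t => (w t * th t * qform x (g' t))%:E).
  by apply/measurable_EFinP; apply: measurable_funM => //; exact: measurable_funM.
case.
  move=> A _ mA; rewrite integral_mkcond [RHS]integral_mkcond.
  have m1 : measurable_fun setT (\1_A : T -> R) by exact: measurable_indic.
  transitivity (\int[mu]_t ((\1_A t * w t * th' t)%:E * (qform x (g t))%:E))%E.
    apply: eq_integral => t _; rewrite patchE indicE -!EFinM; case: ifP => _.
      by rewrite mul1r.
    by rewrite !mul0r.
  rewrite qform_density; last 2 first.
  - by apply/measurable_EFinP; apply: measurable_funM => //; exact: measurable_funM.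
  - by move=> t; rewrite lee_fin !mulr_ge0 ?trace_density_ge0 ?wg0.
  transitivity (\int[mu']_t (\1_A t * w t * qform x (g' t) * th' t)%:E)%E.
    by apply: eq_integral => t _; rewrite -EFinM mulrAC.
  rewrite -trace_density_density; last 2 first.
  - by apply: measurable_funM => //; exact: measurable_funM.
  - by move=> t; rewrite !mulr_ge0 ?qform_ge0 ?wg0.
  apply: eq_integral => t _; rewrite patchE indicE; case: ifP => _.
    by rewrite mul1r mulrAC.
  by rewrite !mul0r.
move=> N [mN N0 sN]; exists N; split => // t /= nt; apply: sN => /= ht; apply: nt.
have [{}ht] := ht I.
have wn : w t != 0 by rewrite gt_eqF.
by apply: (mulfI wn); rewrite !mulrA.
Qed.

(** A dense sequence of vectors costs one null set; off it, continuity extends the identity of forms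
    to all x, and polarization to the operators. *)
Lemma density_proportional : {ae mu, forall t,
  (th' t)%:C%C *: g t = (th t)%:C%C *: g' t}.
Proof.
have [u du] := Hd.
have := ae_foralln (fun n => qform_proportional (u n)).
apply: filterS => t ht.
have lg : linear (g t) by case: (gS t) => -[[]].
have lg' : linear (g' t) by case: (gS' t) => -[[]].
have bg : bounded_op (g t) by case: (gS t) => -[].
have bg' : bounded_op (g' t) by case: (gS' t) => -[].
have E x : th' t * qform x (g t) = th t * qform x (g' t).
  have /choice[k hk] : forall n, exists m, rnorm (x - u m) < n.+1%:R^-1.
    by move=> n; apply: du; rewrite invr_gt0.
  have ux : scvg (u \o k) x.
    apply: (@scvg_le _ _ _ _ (fun n => n.+1%:R^-1)); last exact: cvg_harmonic.
    by move=> n /=; rewrite rnormBC ltW.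
  have c (f : H -> H) : bounded_op f -> qform (u (k n)) f @[n --> \oo] --> qform x f.
    by move=> bf; apply: scvg_Re; apply: scvg_ip2 => //; exact: (scvg_bounded_op bf ux).
  have h1 : th' t * qform (u (k n)) (g t) @[n --> \oo] --> th' t * qform x (g t).
    by apply: cvgMr; exact: c.
  have h2 : th' t * qform (u (k n)) (g t) @[n --> \oo] --> th t * qform x (g' t).
    by under eq_fun do rewrite ht; apply: cvgMr; exact: c.
  exact: (cvg_unique _ h1 h2).
have lZ (r : R) (f : H -> H) : linear f -> linear (r%:C%C *: f).
  move=> lf c x y; have rf z : (r%:C%C *: f) z = r%:C%C *: f z by [].
  by rewrite !rf lf scalerDr !scalerA [c * _]mulrC.
apply: polarization; [exact: lZ|exact: lZ|] => x.
have qE (f : H -> H) : positive_op f -> ip (f x) x = (qform x f)%:C%C.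
  by move=> pf; rewrite /qform -pos_real//; case: pf.
transitivity ((th' t)%:C%C * ip (g t x) x); first by rewrite ipZl.
transitivity ((th t)%:C%C * ip (g' t x) x); last by rewrite ipZl.
rewrite !qE -?rmorphM ?E//; first by case: (gS' t).
by case: (gS t).
Qed.

(** With f = W / th on a suitable set, the chain is: integral of W for mu <= integral of f th for mu
    = integral of f th' for mu' <= integral of F' for mu'. Only the measurable f crosses from one
    measure to the other; F' is reached by a pointwise bound. *)
Lemma change_dominating_measure (W : T -> R) (F' : T -> \bar R) :
  measurable_fun setT W ->
  (forall t, 0 <= W t) -> (forall t, (0 <= F' t)%E) ->
  {ae mu, forall t, g t = 0 -> W t = 0} ->
  {ae mu, forall t, 0 < th t -> 0 < th' t ->
    g' t = (th' t / th t)%:C%C *: g t -> ((th' t / th t * W t)%:E <= F' t)%E} ->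
  (\int[mu]_t (W t)%:E <= \int[mu']_t F' t)%E.
Proof.
move=> mW W0 F0 gW0 hW.
pose good t := [/\ g t = 0 -> W t = 0,
    0 < th t -> 0 < th' t -> g' t = (th' t / th t)%:C%C *: g t ->
      ((th' t / th t * W t)%:E <= F' t)%E &
    (th' t)%:C%C *: g t = (th t)%:C%C *: g' t].
have : {ae mu, forall t, good t} by apply: filterS3 gW0 hW density_proportional.
move=> [Z [mZ Z0 sZ]].
have Zh t : ~ Z t -> good t by move=> nZ; apply: contrapT => h; apply: nZ; apply: sZ.
(* The exceptional set Z is null for mu but perhaps not for mu'. Cutting f off outside Z makes the
   last comparison hold at every point. *)
pose P := ~` Z `&` ([set t | 0 < th t] `&` [set t | 0 < th' t]).
have mpos (k : T -> R) : measurable_fun setT k -> measurable [set t | 0 < k t].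
  move=> mk; rewrite -[X in measurable X]setTI.
  have mk' : measurable_fun setT (EFin \o k) by exact/measurable_EFinP.
  exact: (emeasurable_fun_o_infty measurableT mk' 0%E).
have mP : measurable P.
  apply: measurableI; first exact: measurableC.
  by apply: measurableI; [exact: (mpos _ mth)|exact: (mpos _ mth')].
pose f t := \1_P t * (th t)^-1 * W t.
have mf : measurable_fun setT f.
  apply: measurable_funM => //; apply: measurable_funM; first exact: measurable_indic.
  by apply: measurable_inv_ge0 => // t; exact: trace_density_ge0.
have f0 t : 0 <= f t by rewrite !mulr_ge0// invr_ge0 trace_density_ge0.
(* On the set B where th' vanishes, the integral of th for mu equals that of th' for mu', which is
   0. *)
have th0 : {ae mu, forall t, th' t = 0 -> th t = 0}.
  pose B := ~` [set t | 0 < th' t].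
  have mB : measurable B by exact: measurableC (mpos _ mth').
  have mB1 : measurable_fun setT (\1_B : T -> R) by exact: measurable_indic.
  have h := trace_density_density mB1 (fun t => ltac:(by [])).
  have h0 : (\int[mu]_t `|(\1_B t * th t)%:E| = 0)%E.
    rewrite (eq_integral (fun t => (\1_B t * th t)%:E)); last first.
      by move=> t _; rewrite gee0_abs// lee_fin mulr_ge0// trace_density_ge0.
    rewrite h integral0_eq// => t _; rewrite indicE.
    have [|_] := boolP (t \in B); last by rewrite mul0r.
    rewrite inE /B /= => /negP; rewrite -leNgt => tle; congr EFin.
    by apply/eqP; rewrite mul1r eq_le tle trace_density_ge0.
  have mBt : measurable_fun setT (fun t => (\1_B t * th t)%:E).
    by apply/measurable_EFinP; exact: measurable_funM.
  have := (ae_eq_integral_abs mu measurableT mBt).1 h0.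
  apply: filterS => t /(_ I) /= [] + t0; rewrite indicE mem_set ?mul1r//.
  by rewrite /B /= t0 ltxx.
apply: (@le_trans _ _ (\int[mu]_t (f t * th t)%:E)%E).
  apply: ge0_le_integral_ae.
  - by move=> t; rewrite lee_fin.
  - by move=> t; rewrite lee_fin mulr_ge0// trace_density_ge0.
  have nZ : {ae mu, forall t, ~ Z t} by exists Z; split => // t /contrapT.
  apply: filterS2 nZ th0 => t nZt th0t; rewrite lee_fin.
  have [h1 h2 h3] := Zh t nZt.
  rewrite /f indicE; have := trace_density_ge0 g t.
  rewrite le_eqVlt => /orP[/eqP/esym th00|thp].
    by rewrite h1 ?mulr0 ?mul0r//; exact: S1plus_trace0.
  have thp' : 0 < th' t.
    rewrite lt_neqAle trace_density_ge0 andbT eq_sym; apply/eqP => /th0t h.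
    by rewrite h ltxx in thp.
  by rewrite mem_set//= mul1r mulrAC mulVf ?mul1r// gt_eqF.
rewrite trace_density_density//; apply: ge0_le_integral_ae => //.
  by move=> t; rewrite lee_fin mulr_ge0// trace_density_ge0.
apply: aeW => t; rewrite /f indicE; case: (boolP (t \in P)) => [|_]; last by rewrite !mul0r.
rewrite inE => -[nZt [/= thp thp']]; have [_ h2 h3] := Zh t nZt.
rewrite mul1r mulrAC [_^-1 * _]mulrC; apply: h2 => //.
rewrite mulrC rmorphM /= -scalerA h3 scalerA -rmorphM /= mulVf ?scale1r//.
by rewrite gt_eqF.
Qed.

End two_densities.
End change_of_dominating_measure.

(** * Testing functions of one variable against sections of product sets *)

Section section_integrals.
Context d (V : measurableType d) (R : realType).
Variable xi : {sigma_finite_measure set V -> \bar R}.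
Implicit Types (w : V -> V -> R) (B : set (V * V)).

(** The null set attached to C depends on C, whereas the sections of B vary with v. The sets B
    satisfying the conclusion form a Dynkin system that contains the rectangles. *)
Lemma section_integral_eq0 (E : set V) w : measurable E ->
  {ae xi, forall v, xi.-integrable E (EFin \o w v)} ->
  (forall C, measurable C ->
    {ae xi, forall v, (\int[xi]_(x in E `&` C) (w v x)%:E = 0)%E}) ->
  forall B, measurable B ->
    {ae xi, forall v, (\int[xi]_(x in E `&` xsection B v) (w v x)%:E = 0)%E}.
Proof.
move=> mE iw hw B mB.
pose P B := {ae xi, forall v, (\int[xi]_(x in E `&` xsection B v) (w v x)%:E = 0)%E}.
have mX (S : set (V * V)) (v : V) : measurable S -> measurable (E `&` xsection S v).
  by move=> mS; apply: measurableI => //; exact: measurable_xsection.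
apply: (dynkin_induction (P := P) (@measurable_prod_measurableType _ _ V V)).
- move=> X Y [X1 mX1 [X2 mX2 <-{X}]] [Y1 mY1 [Y2 mY2 <-{Y}]].
  exists (X1 `&` Y1); first exact: measurableI.
  by exists (X2 `&` Y2); [exact: measurableI|rewrite setXI].
- apply: filterS (hw setT measurableT) => v; rewrite (_ : xsection _ _ = setT)//.
  by apply/seteqP; split => // x _; apply/xsectionP.
- move=> _ [X1 mX1 [X2 mX2 <-]]; apply: filterS (hw _ mX2) => v hv.
  have [vX1|vX1] := boolP (v \in X1); first by rewrite in_xsectionX.
  by rewrite notin_xsectionX// setI0 integral_set0.
- move=> S mS PS; apply: filterS3 iw PS (hw setT measurableT) => v iv h1 h2.
  have EE : E `&` setT = (E `&` xsection S v) `|` (E `&` xsection (~` S) v).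
    rewrite -setIUr; congr (_ `&` _); apply/seteqP; split => // x _.
    by have [h|h] := pselect (S (v, x)); [left|right]; apply/xsectionP.
  have mi : measurable_fun ((E `&` xsection S v) `|` (E `&` xsection (~` S) v)) (EFin \o w v).
    by rewrite -EE setIT; exact: measurable_int iv.
  have dj : [disjoint E `&` xsection S v & E `&` xsection (~` S) v].
    by apply/disj_setPS => x /= [[_ /xsectionP h] [_ /xsectionP]].
  move: h2; rewrite EE (integral_setU _ (mX _ v mS) (mX _ v (measurableC mS)) mi dj).
  by rewrite [X in (X + _)%E]h1 add0e.
- move=> F mF tF PF; apply: filterS2 iw (ae_foralln PF) => v iv hv.
  have FE : E `&` xsection (\bigcup_k F k) v = \bigcup_k (E `&` xsection (F k) v).
    by rewrite xsection_bigcup setI_bigcupr.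
  rewrite FE integral_bigcup//.
  + by rewrite eseries0.
  + have := trivIset_xsection (x := v) tF; exact: trivIset_setIl.
  + by move=> k; exact: mX.
  + by rewrite -FE; apply: integrableS iv => //; apply: mX; exact: bigcup_measurable.
- by rewrite -measurable_prod_measurableType.
Qed.

Lemma section_integral_nnsfun (E : set V) w (a : {nnsfun (V * V)%type >-> R}) :
  measurable E ->
  {ae xi, forall v, xi.-integrable E (EFin \o w v)} ->
  (forall C, measurable C ->
    {ae xi, forall v, (\int[xi]_(x in E `&` C) (w v x)%:E = 0)%E}) ->
  {ae xi, forall v, xi.-integrable E (fun x => (a (v, x) * w v x)%:E) /\
    (\int[xi]_(x in E) (a (v, x) * w v x)%:E = 0)%E}.
Proof.
move=> mE iw hw.
have key (s : seq R) : {ae xi, forall v,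
    xi.-integrable E (fun x => (\sum_(r <- s) r * \1_(a @^-1` [set r]) (v, x) * w v x)%:E) /\
    (\int[xi]_(x in E) (\sum_(r <- s) r * \1_(a @^-1` [set r]) (v, x) * w v x)%:E = 0)%E}.
  elim: s => [|r s IH].
    apply: aeW => v; rewrite (_ : (fun x => _) = cst 0%E).
      by rewrite integral0; split => //; exact: integrable0.
    by apply/funext => x; rewrite big_nil.
  pose B := a @^-1` [set r].
  have mB : measurable B by exact: measurable_sfunP.
  apply: filterS3 iw IH (section_integral_eq0 mE iw hw mB) => v iv [IH1 IH2] hB.
  have mBv := measurable_xsection v mB.
  have i1 : xi.-integrable E (fun x => (\1_B (v, x) * w v x)%:E).
    have mv := measurable_int _ iv.
    apply: le_integrable iv => //.
      apply/measurable_EFinP; apply: measurable_funM.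
        have : measurable_fun E (\1_(xsection B v) : V -> R).
          exact: measurable_funTS (measurable_indic _).
        apply: eq_measurable_fun => x _; rewrite !indicE; congr (_%:R).
        by rewrite mem_xsection.
      by apply/measurable_EFinP.
    move=> x _ /=; rewrite lee_fin normrM indicE.
    by case: (_ \in _); rewrite ?normr1 ?normr0 ?mul1r ?mul0r.
  have e1 : (\int[xi]_(x in E) (\1_B (v, x) * w v x)%:E = 0)%E.
    rewrite -hB integral_mkcondr; apply: eq_integral => x _.
    rewrite patchE indicE mem_xsection; case: ifP => _; first by rewrite mul1r.
    by rewrite mul0r.
  have i2 : xi.-integrable E (fun x => (r * \1_B (v, x) * w v x)%:E).
    by under eq_fun do rewrite -mulrA EFinM; exact: integrableZl.
  have e2 : (\int[xi]_(x in E) (r * \1_B (v, x) * w v x)%:E = 0)%E.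
    by under eq_integral do rewrite -mulrA EFinM; rewrite integralZl// e1 mule0.
  have EE : (fun x => (\sum_(r' <- r :: s) r' * \1_(a @^-1` [set r']) (v, x) * w v x)%:E) =
     (fun x => (r * \1_B (v, x) * w v x)%:E +
      (\sum_(r' <- s) r' * \1_(a @^-1` [set r']) (v, x) * w v x)%:E)%E.
    by apply/funext => x; rewrite big_cons EFinD.
  rewrite EE; split; first exact: integrableD.
  by rewrite integralD// e2 IH2 adde0.
apply: filterS (key (finmap.enum_fset (fset_set (range a)))) => v.
set f := fun x => _; set g := fun x => (a (v, x) * w v x)%:E.
suff -> : f = g by [].
apply/funext => x; rewrite /f /g; congr EFin; rewrite [in RHS]fimfunE.
by rewrite fsbig_finite// -mulr_suml.
Qed.

Lemma integrable_sqr (q : V -> R) : measurable_fun setT q ->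
  (\int[xi]_x (q x ^+ 2)%:E < +oo)%E -> xi.-integrable setT (fun x => (q x ^+ 2)%:E).
Proof.
move=> mq q2; apply/integrableP; split; first exact/measurable_EFinP/measurable_funX.
by under eq_integral do rewrite /= ger0_norm ?sqr_ge0//.
Qed.

Lemma integrable_of_sqr (q : V -> R) (E : set V) : measurable_fun setT q ->
  (\int[xi]_x (q x ^+ 2)%:E < +oo)%E -> measurable E -> (xi E < +oo)%E ->
  xi.-integrable E (EFin \o q).
Proof.
move=> mq q2 mE fE.
have i1 : xi.-integrable E (fun x => 1%:E + (q x ^+ 2)%:E)%E.
  apply: integrableD => //; last by apply: integrableS (integrable_sqr mq q2).
  apply/integrableP; split => //.
  by under eq_integral do rewrite /= normr1; rewrite integral_cst// mul1e.
apply: le_integrable i1 => //; first exact/measurable_EFinP/measurable_funTS.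
move=> x _ /=; rewrite lee_fin (ger0_norm (addr_ge0 ler01 (sqr_ge0 _))).
have h1 := sqr_ge0 (q x - 1); have h2 := sqr_ge0 (q x + 1).
by rewrite ler_norml; apply/andP; split; nra.
Qed.

(** The integrals of p(v, .) and q v over C agree off a null set depending on C, and q is a mere
    choice in v. The difference is therefore tested only against the countably many simple functions
    on V^2 that approximate the positive part of p, over an exhaustion of V by sets of finite
    measure. *)
Lemma section_sqr_le (p : V * V -> R) (q : V -> V -> R) :
  measurable_fun setT p ->
  (forall v, measurable_fun setT (q v)) ->
  (forall v, (\int[xi]_x (q v x ^+ 2)%:E < +oo)%E) ->
  (forall C, measurable C -> (xi C < +oo)%E -> {ae xi, forall v,
    xi.-integrable C (fun x => (p (v, x))%:E) /\
    (\int[xi]_(x in C) (p (v, x))%:E = \int[xi]_(x in C) (q v x)%:E)%E}) ->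
  {ae xi, forall v, (\int[xi]_x (Num.max (p (v, x)) 0 ^+ 2)%:E <=
    \int[xi]_x (q v x ^+ 2)%:E)%E}.
Proof.
move=> mp mq q2 pq.
have [F [TF ndF mF]] := (sigma_finiteP _ _).1 (sigma_finiteT xi).
have mp0 : measurable_fun setT (fun z => (Num.max (p z) 0)%:E).
  by apply/measurable_EFinP; apply: measurable_maxr => //; exact: measurable_cst.
pose a := nnsfun_approx measurableT mp0.
have ap n z : a n z <= Num.max (p z) 0.
  rewrite -lee_fin; have hF : (a k z)%:E @[k --> \oo] --> (Num.max (p z) 0)%:E.
    by apply: cvg_nnsfun_approx => // y _; rewrite lee_fin le_max lexx orbT.
  rewrite -(cvg_lim _ hF)//; apply: lime_ge; first exact: cvgP hF.
  exists n => // m nm; rewrite lee_fin.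
  by have /lefP := nd_nnsfun_approx measurableT mp0 nm; exact.
have i2 v : xi.-integrable setT (fun x => (q v x ^+ 2)%:E).
  exact: (integrable_sqr (mq v) (q2 v)).
have iq E v : measurable E -> (xi E < +oo)%E -> xi.-integrable E (EFin \o q v).
  by move=> mE fE; exact: (integrable_of_sqr (mq v) (q2 v)).
have fin n m : {ae xi, forall v, (\int[xi]_(x in F n) (a m (v, x) ^+ 2)%:E <=
    \int[xi]_x (q v x ^+ 2)%:E)%E}.
  have [mFn fFn] := mF n; pose w v x := p (v, x) - q v x.
  have iw : {ae xi, forall v, xi.-integrable (F n) (EFin \o w v)}.
    apply: filterS (pq _ mFn fFn) => v [ip_ _].
    rewrite (_ : _ \o _ = (fun x => (p (v, x))%:E - (q v x)%:E)%E)//.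
    by apply: integrableB => //; exact: iq.
  have hw C : measurable C ->
      {ae xi, forall v, (\int[xi]_(x in F n `&` C) (w v x)%:E = 0)%E}.
    move=> mC; have mFC : measurable (F n `&` C) by exact: measurableI.
    have fFC : (xi (F n `&` C) < +oo)%E.
      by apply: le_lt_trans fFn; apply: le_measure; rewrite ?inE.
    apply: filterS (pq _ mFC fFC) => v [ip_ ep].
    rewrite (eq_integral (fun x => (p (v, x))%:E - (q v x)%:E)%E)//.
    rewrite integralB//; last exact: iq.
    by rewrite ep subee//; apply: integrable_fin_num => //; exact: iq.
  apply: filterS (section_integral_nnsfun (a m) mFn iw hw) => v [iaw eaw].
  have q2F : (\int[xi]_(x in F n) (q v x ^+ 2)%:E <= \int[xi]_x (q v x ^+ 2)%:E)%E.
    by apply: ge0_subset_integral => //; [exact: measurable_int (i2 v)|move=> x _; rewrite lee_fin sqr_ge0].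
  apply: le_trans q2F.
  (* a^2 <= 2 a p - a^2 = 2 a (p - q) + (2 a q - a^2) <= 2 a (p - q) + q^2 *)
  have apq x : a m (v, x) ^+ 2 <= 2 * (a m (v, x) * w v x) + q v x ^+ 2.
    have := ap m (v, x); have : 0 <= a m (v, x) by []. rewrite /w.
    set t := a m (v, x) => t0; case: (ltP (p (v, x)) 0) => [pn|pp] tp.
      have -> : t = 0 by apply/eqP; rewrite eq_le tp t0.
      by rewrite expr0n mul0r mulr0 add0r sqr_ge0.
    have := sqr_ge0 (t - q v x); nra.
  apply: (@le_trans _ _ (\int[xi]_(x in F n)
      (2%:E * (a m (v, x) * w v x)%:E + (q v x ^+ 2)%:E))%E).
    apply: ge0_le_integral_ae_dom.
    - by move=> x; rewrite lee_fin sqr_ge0.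
    - by move=> x; rewrite -EFinM -EFinD lee_fin; exact: le_trans (sqr_ge0 _) (apq x).
    - by apply: aeW => x _; rewrite -EFinM -EFinD lee_fin.
  rewrite integralD//; last 2 first.
  - exact: integrableZl.
  - exact: integrableS (i2 v).
  by rewrite integralZl// eaw mule0 add0e.
have := ae_foralln (fun n => ae_foralln (fin n)).
apply: filterS => v hv.
(* One index drives both the approximation and the exhaustion, so a single monotone convergence
   concludes. *)
pose G n x := ((a n (v, x) ^+ 2) * \1_(F n) x)%:E.
have G0 n x : (0 <= G n x)%E by rewrite lee_fin mulr_ge0// sqr_ge0.
have mG n : measurable_fun setT (G n).
  apply/measurable_EFinP; apply: measurable_funM; last exact/measurable_indic/(mF n).1.
  by apply: measurable_funX; apply: measurable_fun_pair2; exact: measurable_funPT.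
have ndG x : nondecreasing_seq (G ^~ x).
  move=> m n mn; rewrite lee_fin; apply: ler_pM => //; first exact: sqr_ge0.
    rewrite lerXn2r ?nnegrE//.
    by have /lefP := nd_nnsfun_approx measurableT mp0 mn; exact.
  rewrite !indicE; have [xm|//] := boolP (x \in F m).
  rewrite mem_set//; have /subsetPset := ndF _ _ mn; apply; by rewrite inE in xm.
have Gcvg x : G n x @[n --> \oo] --> (Num.max (p (v, x)) 0 ^+ 2)%:E.
  have hF : (a k (v, x))%:E @[k --> \oo] --> (Num.max (p (v, x)) 0)%:E.
    by apply: cvg_nnsfun_approx => // y _; rewrite lee_fin le_max lexx orbT.
  have h1 : a n (v, x) @[n --> \oo] --> Num.max (p (v, x)) 0 by exact: (fine_cvg hF).
  have h2 : a n (v, x) ^+ 2 * \1_(F n) x @[n --> \oo] --> Num.max (p (v, x)) 0 ^+ 2 * 1.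
    apply: cvgM.
      by rewrite expr2; under eq_fun do rewrite expr2; exact: (cvgM h1 h1).
    have : [set: V] x by []; rewrite TF => -[N _ FNx].
    apply: cvg_near_cst; exists N => // n Nn /=; rewrite indicE mem_set//.
    by have /subsetPset := ndF _ _ Nn; apply.
  rewrite mulr1 in h2; apply: cvg_EFin; [exact: nearW|exact: h2].
rewrite (eq_integral (fun x => limn (G ^~ x))); last first.
  by move=> x _; apply/esym/cvg_lim.
rewrite monotone_convergence//.
apply: lime_le.
  apply: ereal_nondecreasing_is_cvgn => m n mn; apply: ge0_le_integral => // x _.
  exact: ndG.
apply: nearW => n; apply: le_trans (hv n n).
rewrite [leRHS]integral_mkcond; apply: ge0_le_integral_ae => //.
  by apply: erestrict_ge0 => x _; rewrite lee_fin sqr_ge0.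
apply: aeW => x; rewrite /G patchE indicE; case: ifP => _; first by rewrite mulr1.
by rewrite mulr0.
Qed.

End section_integrals.

(** * Square-integrable classes, Hilbert-Schmidt operators and kernel rows *)

Section square_integrable_functions.
Context d (V : measurableType d) (R : realType).
Variable xi : {measure set V -> \bar R}.
Implicit Types x y : L2 xi.

Lemma L2_rnorm_sqr x :
  (\int[xi]_v (rnorm (x v) ^+ 2)%:E = (rnorm x ^+ 2)%:E)%E.
Proof.
have fx : (\int[xi]_v (rnorm (x v) ^+ 2)%:E)%E \is a fin_num.
  by rewrite ge0_fin_numE; [exact: L2_sqint|apply: integral_ge0 => v _; rewrite lee_fin sqr_ge0].
rewrite -(fineK fx); congr EFin; apply: complexI.
have -> : ((rnorm x ^+ 2)%:C)%C = cintegral xi setT (fun v => (rnorm (x v) ^+ 2)%:C%C).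
  rewrite -ip_sqr /ip /= /L2_ip; congr cintegral; apply/funext => v; exact: mulJ.
apply/eqP; rewrite eq_complex /=; apply/andP; split=> //; rewrite eq_sym; apply/eqP.
by rewrite Rintegral_cst// mul0r.
Qed.

Lemma L2_exists (f : V -> R[i]) : cmeasurable_fun setT f ->
  (\int[xi]_v (rnorm (f v) ^+ 2)%:E < +oo)%E ->
  exists x : L2 xi, {ae xi, forall v, x v = f v}.
Proof.
move=> mf f2; have pf : f \in @sqint_pred _ V R xi by apply/asboolP.
by exists (L2_class (Sqint pf)); exact: L2_classE.
Qed.

Lemma L2B x y : {ae xi, forall v, (x - y : L2 xi) v = x v - y v}.
Proof.
apply: filterS2 (L2D x (- y)) (L2Z (-1) y) => v ->.
by rewrite scaleN1r => ->; rewrite mulN1r.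
Qed.

Lemma L2_sum n (c : nat -> R[i]) (u : nat -> L2 xi) : {ae xi, forall v,
  (\sum_(k < n) c k *: u k : L2 xi) v = \sum_(k < n) c k * u k v}.
Proof.
elim: n => [|n IH].
  by apply: filterS (L2_zero xi) => v; rewrite !big_ord0.
rewrite big_ord_recr /=.
apply: filterS3 IH (L2D (\sum_(k < n) c k *: u k) (c n *: u n)) (L2Z (c n) (u n)).
by move=> v h1 h2 h3; rewrite big_ord_recr /= h2 h1 h3.
Qed.

Lemma L2_measurable_sqr x : measurable_fun setT (fun v => (rnorm (x v) ^+ 2)%:E).
Proof. by apply/measurable_EFinP; exact/measurable_rnorm2/L2_cmeasurable. Qed.

End square_integrable_functions.

Section hilbert_schmidt_kernels.
Context d (V : measurableType d) (R : realType).
Variable xi : {sigma_finite_measure set V -> \bar R}.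
Local Notation G := (L2 xi).
Hypothesis HC : scomplete G.
Variable e : nat -> G.
Hypotheses (one : orthonormal_seq e) (te : total_seq e).
Variable K : G -> G.
Hypothesis bK : bounded_op K.
Hypothesis K2 : (\sum_(0 <= n <oo) (rnorm (K (e n)) ^+ 2)%:E < +oo)%E.

Let c v := (\sum_(0 <= n <oo) (rnorm (K (e n) v) ^+ 2)%:E)%E.

Let c_ge0 v : (0 <= c v)%E.
Proof. by apply: nneseries_ge0 => n _ _; rewrite lee_fin sqr_ge0. Qed.

Lemma integral_hs_series : (\int[xi]_v c v = \sum_(0 <= n <oo) (rnorm (K (e n)) ^+ 2)%:E)%E.
Proof.
rewrite /c integral_nneseries//.
- by apply: eq_eseriesr => n _; exact: L2_rnorm_sqr.
- by move=> n; exact: L2_measurable_sqr.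
- by move=> n x _; rewrite lee_fin sqr_ge0.
Qed.

Lemma hs_series_fin : {ae xi, forall v, (c v < +oo)%E}.
Proof.
have mc : measurable_fun setT c.
  apply: ge0_emeasurable_sum => [n x _ _|n _]; first by rewrite lee_fin sqr_ge0.
  exact: L2_measurable_sqr.
have ic : xi.-integrable setT c.
  apply/integrableP; split => //.
  rewrite (eq_integral c); first by rewrite integral_hs_series.
  by move=> v _; rewrite gee0_abs.
apply: filterS (integrable_ae measurableT ic) => v /(_ I).
by rewrite ge0_fin_numE.
Qed.

(** The row should satisfy K f v = <f, u v>, which forces the coefficients conj (K (e n) v); they
    are square-summable wherever c is finite. *)
Lemma hs_row : exists u : V -> G, forall v, (c v < +oo)%E ->
  scvg (fourier e (fun n => conj (K (e n) v))) (u v).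
Proof.
suff h v : exists y, (c v < +oo)%E -> scvg (fourier e (fun n => conj (K (e n) v))) y.
  by have [f hf] := choice h; exists f.
have [cv|] := pselect (c v < +oo)%E; last by move=> h; exists 0 => /h.
have cn n : \sum_(k < n) rnorm (conj (K (e k) v)) ^+ 2 <= fine (c v).
  rewrite -lee_fin fineK ?ge0_fin_numE// -sumEFin.
  under eq_bigr do rewrite rnormJ.
  rewrite -(big_mkord xpredT (fun k => (rnorm (K (e k) v) ^+ 2)%:E)).
  by apply: nneseries_lim_ge => k _; rewrite lee_fin sqr_ge0.
have [y hy _] := riesz_fischer one HC (c := fun n => conj (K (e n) v)) cn.
by exists y.
Qed.

Variable u : V -> G.
Hypothesis hu : forall v, (c v < +oo)%E ->
  scvg (fourier e (fun n => conj (K (e n) v))) (u v).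

(** For the partial sums f_N of f the identity holds by linearity, and <f_N, u v> converges to <f, u
    v> at each good v. As K f_N tends to K f in L^2 only, Fatou shows that the lower limit of |K f v
    - K f_N v|^2 vanishes almost everywhere, which identifies the pointwise limit. *)
Lemma hs_row_apply (f : G) : {ae xi, forall v, K f v = ip f (u v)}.
Proof.
pose fN N := fourier e (fun n => ip f (e n)) N.
have lK : linear K by case: bK.
have KfN N : {ae xi, forall v, K (fN N) v = \sum_(k < N) ip f (e k) * K (e k) v}.
  rewrite /fN /fourier (linear_map_sum lK _ (fun k => ip f (e k) *: e k)).
  under eq_bigr do rewrite (linear_mapZ lK).
  exact: (L2_sum N (fun k => ip f (e k)) (fun k => K (e k))).
have cvgK : rnorm (K f - K (fN N)) @[N --> \oo] --> (0 : R).
  have := scvg_bounded_op bK (fourier_cvg one HC te f).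
  by rewrite /scvg; under eq_fun do rewrite rnormBC.
pose D N v := (rnorm ((K f - K (fN N) : G) v) ^+ 2)%:E.
have D0 N v : (0 <= D N v)%E by rewrite lee_fin sqr_ge0.
have mD N : measurable_fun setT (D N) by exact: L2_measurable_sqr.
have L_ge0 v : (0 <= limn_einf (D ^~ v))%E.
  rewrite limn_einf_lim; apply: lime_ge; first exact: is_cvg_einfs.
  by apply: nearW => n; apply: le_ereal_inf_tmp => _ [k _ <-].
have iD : (\int[xi]_v limn_einf (D ^~ v) = 0)%E.
  apply/eqP; rewrite eq_le; apply/andP; split; last exact: integral_ge0.
  apply: le_trans (fatou _ _ _ _) _ => //.
  rewrite (_ : (fun n => _) = (fun n => (rnorm (K f - K (fN n)) ^+ 2)%:E)); last first.
    by apply/funext => n; exact: L2_rnorm_sqr.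
  have h : (rnorm (K f - K (fN n)) ^+ 2)%:E @[n --> \oo] --> 0%E.
    apply: cvg_EFin; first exact: nearW.
    rewrite -(mul0r 0); under eq_fun do rewrite /= expr2.
    exact: (cvgM cvgK cvgK).
  by rewrite (cvg_limn_einf_sup h).1.
have mL : measurable_fun setT (fun v => limn_einf (D ^~ v)).
  apply: (emeasurable_fun_cvg (fun n v => einfs (D ^~ v) n)).
    by move=> n; exact: measurable_fun_einfs.
  by move=> v _; rewrite limn_einf_lim; exact: is_cvg_einfs.
have L0 : {ae xi, forall v, limn_einf (D ^~ v) = 0%E}.
  have i0 : (\int[xi]_v `|limn_einf (D ^~ v)| = 0)%E.
    by rewrite -[RHS]iD; apply: eq_integral => v _; rewrite gee0_abs.
  by apply: filterS ((ae_eq_integral_abs xi measurableT mL).1 i0) => v; apply.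
apply: filterS3 L0 hs_series_fin (ae_foralln (fun N =>
  filterI (KfN N) (L2B (K f) (K (fN N))))) => v h0 cv hN.
have uv := hu cv.
have E N : ip (fN N) (u v) = K (fN N) v.
  rewrite (hN N).1 /fN /fourier (ip_suml _ _ (fun k => ip f (e k) *: e k)).
  apply: eq_bigr => k _; rewrite ipZl [ip (e k) _]ipC (scvg_fourier_ip one _ uv).
  case: (one.2 k) => [ek|ek1]; first by rewrite ek !ip0r !mul0r.
  by rewrite ipZl ip_sqr ek1 expr1n mulr1 conjcK.
have cN : scvg (fun N => K (fN N) v) (ip f (u v)).
  rewrite (_ : (fun N => _) = (fun N => ip (fN N) (u v))); last exact/funext.
  exact: scvg_ipl (fourier_cvg one HC te f).
have dN : rnorm (K f v - K (fN N) v) @[N --> \oo] --> rnorm (K f v - ip f (u v)).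
  apply: (scvg_rnorm (u := fun N => K f v - K (fN N) v)).
  apply: scvgD; first exact: scvg_cst.
  rewrite /scvg; under eq_fun do rewrite -opprD rnormN; exact: cN.
have : D N v @[N --> \oo] --> (rnorm (K f v - ip f (u v)) ^+ 2)%:E.
  apply: cvg_EFin; first exact: nearW.
  rewrite (_ : fine \o _ = (fun N => rnorm (K f v - K (fN N) v) * rnorm (K f v - K (fN N) v))).
    by rewrite expr2; exact: (cvgM dN dN).
  by apply/funext => N /=; rewrite (hN N).2 expr2.
move=> /cvg_limn_einf_sup[]; rewrite h0 => -[] /esym/eqP.
by rewrite sqrf_eq0 => /eqP/rnorm_eq0/eqP; rewrite subr_eq0 => /eqP.
Qed.

End hilbert_schmidt_kernels.

Section kernel_rows.
Context d (V : measurableType d) (R : realType).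
Variable xi : {sigma_finite_measure set V -> \bar R}.
Local Notation G := (L2 xi).
Hypothesis HC : scomplete G.
Variable e : nat -> G.
Hypotheses (one : orthonormal_seq e) (te : total_seq e).
Variable K : G -> G.
Hypothesis bK : bounded_op K.
Hypothesis K2 : (\sum_(0 <= n <oo) (rnorm (K (e n)) ^+ 2)%:E < +oo)%E.
Variable k : V * V -> R[i].
Hypothesis mk : cmeasurable_fun setT k.
Hypothesis kK : forall f : G, {ae xi, forall v,
    cintegrable xi setT (fun v' => k (v, v') * f v') /\
    K f v = cintegral xi setT (fun v' => k (v, v') * f v')}.

Lemma cmeasurable_row v : cmeasurable_fun setT (fun v' => k (v, v')).
Proof. by case: mk => m1 m2; split; [exact: (measurable_fun_pair2 v m1)|exact: (measurable_fun_pair2 v m2)]. Qed.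

(** The one-sided bound is applied to p and to - p, whose positive parts make up p^2. *)
Lemma integral_sqr_le2 (p : V * V -> R) (q : V -> V -> R) :
  measurable_fun setT p -> (forall v, measurable_fun setT (q v)) ->
  (forall v, (\int[xi]_x (q v x ^+ 2)%:E < +oo)%E) ->
  (forall C, measurable C -> (xi C < +oo)%E -> {ae xi, forall v,
    xi.-integrable C (fun x => (p (v, x))%:E) /\
    (\int[xi]_(x in C) (p (v, x))%:E = \int[xi]_(x in C) (q v x)%:E)%E}) ->
  {ae xi, forall v, (\int[xi]_x (p (v, x) ^+ 2)%:E < +oo)%E}.
Proof.
move=> mp mq q2 pq.
have h1 := section_sqr_le mp mq q2 pq.
have h2 : {ae xi, forall v, (\int[xi]_x (Num.max (- p (v, x)) 0 ^+ 2)%:E <=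
    \int[xi]_x ((- q v x) ^+ 2)%:E)%E}.
  apply: (section_sqr_le (p := fun z => - p z) (q := fun v x => - q v x)).
  - exact: measurableT_comp.
  - by move=> v; exact: measurableT_comp.
  - by move=> v; under eq_integral do rewrite sqrrN.
  - move=> C mC fC; apply: filterS (pq C mC fC) => v [ip_ ep].
    have iq := integrable_of_sqr (mq v) (q2 v) mC fC.
    have N (f : V -> R) : xi.-integrable C (fun x => (f x)%:E) ->
        xi.-integrable C (fun x => (- f x)%:E) /\
        (\int[xi]_(x in C) (- f x)%:E = - \int[xi]_(x in C) (f x)%:E)%E.
      move=> if_; have E : (fun x => (- f x)%:E) = (fun x => (-1)%:E * (f x)%:E)%E.
        by apply/funext => x; rewrite -EFinM mulN1r.
      rewrite E; split; first exact: integrableZl.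
      by rewrite integralZl// mulN1e.
    by split; [exact: (N _ ip_).1|rewrite (N _ ip_).2 (N _ iq).2 ep].
apply: filterS2 h1 h2 => v le1 le2.
have mv : measurable_fun setT (fun x => p (v, x)) by exact: measurable_fun_pair2.
have mm (f : V -> R) : measurable_fun setT f ->
    measurable_fun setT (fun x => (Num.max (f x) 0 ^+ 2)%:E).
  move=> mf; apply/measurable_EFinP; apply: measurable_funX.
  by apply: measurable_maxr => //; exact: measurable_cst.
rewrite (eq_integral (fun x => (Num.max (p (v, x)) 0 ^+ 2)%:E +
    (Num.max (- p (v, x)) 0 ^+ 2)%:E)%E); last first.
  move=> x _; rewrite -EFinD; congr EFin.
  have [p0|p0] := ltP (p (v, x)) 0.
    by rewrite max_l ?sqrrN ?expr0n ?add0r// oppr_ge0 ltW.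
  by rewrite max_r ?expr0n ?addr0// oppr_le0.
rewrite ge0_integralD//; last 4 first.
- by move=> x _; rewrite lee_fin sqr_ge0.
- exact: mm.
- by move=> x _; rewrite lee_fin sqr_ge0.
- by apply: mm; exact: measurableT_comp.
apply: lte_add_pinfty; first exact: le_lt_trans le1 (q2 v).
by apply: le_lt_trans le2 _; under eq_integral do rewrite sqrrN.
Qed.

(** The abstract row u v and the kernel row represent the same operator, so k(v, .) and the
    conjugate of u v have equal integrals over each C of finite measure. The conjugation explains
    the sign of the imaginary part. *)
Lemma kernel_row_sqint : {ae xi, forall v,
  (\int[xi]_v' (rnorm (k (v, v')) ^+ 2)%:E < +oo)%E}.
Proof.
have [u hu] := hs_row HC one K.
have [mR mI] := mk.
have rows (C : set V) : measurable C -> (xi C < +oo)%E -> {ae xi, forall v,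
    [/\ xi.-integrable C (fun x => (Re (k (v, x)))%:E),
     (\int[xi]_(x in C) (Re (k (v, x)))%:E = \int[xi]_(x in C) (Re (u v x))%:E)%E,
     xi.-integrable C (fun x => (Im (k (v, x)))%:E) &
     (\int[xi]_(x in C) (Im (k (v, x)))%:E = \int[xi]_(x in C) (- Im (u v x))%:E)%E]}.
  move=> mC fC.
  (* The test function is the class of the indicator of C, square-integrable because C has finite
     measure. *)
  have [f fE] : exists f : G, {ae xi, forall v, f v = (\1_C v)%:C%C}.
    apply: L2_exists.
      by split; [exact: measurable_indic|exact: measurable_cst].
    rewrite (eq_integral (fun x => (\1_C x)%:E)).
      by rewrite integral_indic// setIT.
    move=> x _; rewrite rnorm_real indicE; congr EFin.
    by case: (_ \in _); rewrite ?normr1 ?normr0 ?expr1n ?expr0n.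
  apply: filterS2 (hs_row_apply HC one te bK K2 hu f) (kK f) => v hv [[i1 i2] eK].
  have [uR uI] := L2_cmeasurable (u v).
  have [fR fI] := L2_cmeasurable f.
  have [rR rI] := cmeasurable_row v.
  have [j1 j2] := L2_ip_integrable f (u v).
  have ipE : ip f (u v) = cintegral xi setT (fun x => f x * conj (u v x)) by [].
  rewrite eK ipE in hv.
  have kR : {ae xi, forall x, Re (k (v, x) * f x) = \1_C x * Re (k (v, x)) /\
      Im (k (v, x) * f x) = \1_C x * Im (k (v, x))}.
    apply: filterS fE => x ->; case: (k (v, x)) => a b /=.
    by rewrite !mulr0 subr0 add0r; split; rewrite mulrC.
  have uR' : {ae xi, forall x, Re (f x * conj (u v x)) = \1_C x * Re (u v x) /\
      Im (f x * conj (u v x)) = \1_C x * - Im (u v x)}.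
    apply: filterS fE => x ->; case: (u v x) => a b /=.
    by rewrite !mul0r subr0 addr0.
  have m1 (g : V -> R) : measurable_fun setT g -> measurable_fun setT (fun x => \1_C x * g x).
    by move=> mg; apply: measurable_funM => //; exact: measurable_indic.
  have restr (g : V -> R) : measurable_fun setT g ->
      forall g' : V -> R, xi.-integrable setT (EFin \o g') ->
      {ae xi, forall x, g' x = \1_C x * g x} ->
      xi.-integrable C (fun x => (g x)%:E) /\
      (\int[xi]_(x in C) (g x)%:E)%E = (\int[xi]_x g' x)%:E.
    move=> mg g' ig' gg'.
    have E : (fun x => (\1_C x * g x)%:E) = (fun x => (g x)%:E) \_ C.
      apply/funext => x; rewrite patchE indicE; case: ifP => _; first by rewrite mul1r.
      by rewrite mul0r.
    have ae' : ae_eq xi setT (EFin \o g') (fun x => (\1_C x * g x)%:E).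
      by apply: filterS gg' => x /= -> _.
    have mg1 : measurable_fun setT (fun x => (\1_C x * g x)%:E).
      by apply/measurable_EFinP; exact: m1.
    have i3 : xi.-integrable setT (fun x => (\1_C x * g x)%:E).
      apply/integrableP; split => //.
      apply: le_lt_trans (proj2 (integrableP _ _ _ ig')).
      apply: ge0_le_integral_ae => //.
      by apply: filterS gg' => x /= ->.
    split; first by apply/(integrable_mkcond _ mC); rewrite -E.
    rewrite integral_mkcond -E.
    have <- : (\int[xi]_x (EFin \o g') x = \int[xi]_x (\1_C x * g x)%:E)%E.
      by apply: ae_eq_integral => //; exact: measurable_int ig'.
    by rewrite /Rintegral fineK//; exact: integrable_fin_num.
  have mIu : measurable_fun setT (fun x => - Im (u v x)) by exact: measurableT_comp.
  have a0 : _ := restr _ rR _ i1.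
  have [|a1 a2] := a0; first by apply: filterS kR => x [].
  have b0 : _ := restr _ rI _ i2.
  have [|b1 b2] := b0; first by apply: filterS kR => x [].
  have c0 : _ := restr _ uR _ j1.
  have [|c1 c2] := c0; first by apply: filterS uR' => x [].
  have d0 : _ := restr _ mIu _ j2.
  have [|d1 d2] := d0; first by apply: filterS uR' => x [].
  split => //.
  - by rewrite [LHS]a2 [RHS]c2; congr EFin; case: hv.
  - by rewrite [LHS]b2 [RHS]d2; congr EFin; case: hv.
have uRI v : measurable_fun setT (fun x => Re (u v x)) /\
    measurable_fun setT (fun x => - Im (u v x)).
  by have [? ?] := L2_cmeasurable (u v); split => //; exact: measurableT_comp.
have u2 v (g : V -> R) : measurable_fun setT g -> (forall x, g x ^+ 2 <= rnorm (u v x) ^+ 2) ->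
    (\int[xi]_x (g x ^+ 2)%:E < +oo)%E.
  move=> mg gu; apply: le_lt_trans (L2_sqint (u v)); apply: ge0_le_integral_ae.
  - by move=> x; rewrite lee_fin sqr_ge0.
  - by move=> x; rewrite lee_fin sqr_ge0.
  - by apply: aeW => x; rewrite lee_fin.
have hR : {ae xi, forall v, (\int[xi]_x (Re (k (v, x)) ^+ 2)%:E < +oo)%E}.
  apply: (integral_sqr_le2 (p := fun z => Re (k z)) (q := fun v x => Re (u v x))) => //.
  - by move=> v; exact: (uRI v).1.
  - move=> v; apply: (u2 v); first exact: (uRI v).1.
    by move=> x /=; rewrite rnormE lerDl sqr_ge0.
  - by move=> C mC fC; apply: filterS (rows C mC fC) => v [].
have hI : {ae xi, forall v, (\int[xi]_x (Im (k (v, x)) ^+ 2)%:E < +oo)%E}.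
  apply: (integral_sqr_le2 (p := fun z => Im (k z)) (q := fun v x => - Im (u v x))) => //.
  - by move=> v; exact: (uRI v).2.
  - move=> v; apply: (u2 v); first exact: (uRI v).2.
    by move=> x /=; rewrite rnormE sqrrN lerDr sqr_ge0.
  - by move=> C mC fC; apply: filterS (rows C mC fC) => v [].
apply: filterS2 hR hI => v h1 h2.
have [mRv mIv] := cmeasurable_row v.
rewrite (eq_integral (fun x => (Re (k (v, x)) ^+ 2)%:E + (Im (k (v, x)) ^+ 2)%:E)%E); last first.
  by move=> x _; rewrite rnormE EFinD.
rewrite ge0_integralD//; last 4 first.
- by move=> x _; rewrite lee_fin sqr_ge0.
- by apply/measurable_EFinP; exact: measurable_funX.
- by move=> x _; rewrite lee_fin sqr_ge0.
- by apply/measurable_EFinP; exact: measurable_funX.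
exact: lte_add_pinfty.
Qed.

(** Once the row is square-integrable, its conjugate is a vector y with K (e n) v = <e n, y>, and
    Parseval sums these coefficients. *)
Lemma hs_series_kernel : {ae xi, forall v,
  (\sum_(0 <= n <oo) (rnorm (K (e n) v) ^+ 2)%:E =
   \int[xi]_v' (rnorm (k (v, v')) ^+ 2)%:E)%E}.
Proof.
apply: filterS2 kernel_row_sqint (ae_foralln (fun n => kK (e n))) => v rv hv.
have [mR mI] := cmeasurable_row v.
have [y yE] : exists y : G, {ae xi, forall x, y x = conj (k (v, x))}.
  apply: L2_exists; first exact: cmeasurable_conj (cmeasurable_row v).
  by under eq_integral do rewrite rnormJ.
have Ke n : K (e n) v = ip (e n) y.
  rewrite (hv n).2; apply: eq_cintegral_ae.
  - exact: cmeasurable_funM (cmeasurable_row v) (L2_cmeasurable _).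
  - exact: cmeasurable_funM (L2_cmeasurable _) (cmeasurable_conj (L2_cmeasurable _)).
  - by apply: filterS yE => x ->; rewrite mulrC; congr (_ * _); exact/esym/conjcK.
under eq_eseriesr do rewrite Ke ipC rnormJ.
rewrite (parseval one HC te) -L2_rnorm_sqr.
apply: ae_eq_integral => //.
- exact: L2_measurable_sqr.
- by apply/measurable_EFinP; exact: measurable_rnorm2 (cmeasurable_row v).
- by apply: filterS yE => x -> _; rewrite rnormJ.
Qed.

End kernel_rows.

(** * Partial sums of the exponential series *)

Section exponential_sums.
Context (R : realType).

Definition exp_sum (F : numFieldType) n (a : F) : F :=
  \sum_(i < n) (i`!%:R)^-1 * a ^+ i.

Lemma triangular_sum (F : nmodType) (f : nat -> nat -> F) n :
  \sum_(k < n) \sum_(i < k.+1) f i (k - i)%N = \sum_(i < n) \sum_(j < n - i) f i j.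
Proof.
elim: n => [|n IH]; first by rewrite !big_ord0.
rewrite big_ord_recr /= IH [RHS]big_ord_recr /= subSnn big_ord1.
under [in RHS]eq_bigr => i _.
  rewrite subSn; last exact: ltnW.
  rewrite big_ord_recr /=; over.
by rewrite big_split /= -addrA; congr (_ + _); rewrite big_ord_recr /= subnn.
Qed.

Lemma exp_sumD (F : numFieldType) n (a b : F) :
  exp_sum n (a + b) = \sum_(i < n) \sum_(j < n - i)
    ((i`!%:R)^-1 * b ^+ i) * ((j`!%:R)^-1 * a ^+ j).
Proof.
rewrite -(triangular_sum (fun i j => ((i`!%:R)^-1 * b ^+ i) * ((j`!%:R)^-1 * a ^+ j))).
apply: eq_bigr => k _; rewrite exprDn mulr_sumr; apply: eq_bigr => i _.
have ik : (i <= k)%N by rewrite -ltnS.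
have fk m : m`!%:R != 0 :> F by rewrite pnatr_eq0 -lt0n fact_gt0.
rewrite -(bin_fact ik) -mulr_natr !natrM.
have := fk i; have := fk (k - i)%N.
have : 'C(k, i)%:R != 0 :> F by rewrite pnatr_eq0 -lt0n bin_gt0.
by move=> h1 h2 h3; field; rewrite h1 h2 h3.
Qed.

(** A product of partial sums runs over a square of indices and the partial sum at a + b over a
    triangle; this is the part of the square beyond the triangle. *)
Definition exp_defect (F : numFieldType) n (a b : F) :=
  exp_sum n a * exp_sum n b - exp_sum n (a + b).

Lemma exp_defectE (F : numFieldType) n (a b : F) : exp_defect n a b =
  \sum_(i < n) \sum_(n - i <= j < n)
    ((i`!%:R)^-1 * b ^+ i) * ((j`!%:R)^-1 * a ^+ j).
Proof.
rewrite /exp_defect exp_sumD mulrC /exp_sum mulr_suml -sumrB.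
apply: eq_bigr => i _; rewrite mulr_sumr.
set f := fun j : nat => ((i`!%:R)^-1 * b ^+ i) * ((j`!%:R)^-1 * a ^+ j).
rewrite -(big_mkord xpredT f) -(big_mkord xpredT f).
by rewrite (big_cat_nat (leq0n (n - i)) (leq_subr _ _)) /= addrAC subrr add0r.
Qed.

Lemma rnorm_sum_seq (I : Type) (s : seq I) (f : I -> R[i]) :
  rnorm (\sum_(i <- s) f i) <= \sum_(i <- s) rnorm (f i).
Proof.
elim: s => [|i s IH]; first by rewrite !big_nil rnorm0.
by rewrite !big_cons; apply: le_trans (rnormD _ _) _; rewrite lerD2l.
Qed.

Lemma rnorm_fact n : rnorm ((n`!%:R)^-1 : R[i]) = (n`!%:R)^-1.
Proof.
have -> : (n`!%:R)^-1 = ((n`!%:R)^-1)%:C%C :> R[i] by rewrite fmorphV rmorph_nat.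
by rewrite rnorm_real ger0_norm.
Qed.

Lemma rnorm_exp_term n (a : R[i]) :
  rnorm ((n`!%:R)^-1 * a ^+ n) = (n`!%:R)^-1 * rnorm a ^+ n.
Proof. by rewrite rnormM rnormX rnorm_fact. Qed.

(** All coefficients of the defect are nonnegative, so the triangle inequality compares it termwise
    with the defect of the moduli, which tends to 0 by the functional equation of the real
    exponential. *)
Lemma rnorm_exp_defect n (a b : R[i]) :
  rnorm (exp_defect n a b) <= exp_defect n (rnorm a) (rnorm b).
Proof.
rewrite !exp_defectE; apply: le_trans (rnorm_sum_seq _ _) _.
apply: ler_sum => i _; apply: le_trans (rnorm_sum_seq _ _) _.
by apply: ler_sum => j _; rewrite rnormM !rnorm_exp_term.
Qed.

Lemma rnorm_exp_sum n (a : R[i]) : rnorm (exp_sum n a) <= exp_sum n (rnorm a).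
Proof.
apply: le_trans (rnorm_sum_seq _ _) _.
by apply: ler_sum => j _; rewrite rnorm_exp_term.
Qed.

Lemma exp_sum_cvg (r : R) : exp_sum n r @[n --> \oo] --> expR r.
Proof.
have := @is_cvg_series_exp_coeff R r; rewrite /expR => h.
suff -> : (fun n => exp_sum n r) = series (exp_coeff r) by exact: h.
apply/funext => n; rewrite /exp_sum /series /= big_mkord; apply: eq_bigr => i _.
by rewrite /exp_coeff /= mulrC.
Qed.

Lemma exp_sum_le_expR n (r : R) : 0 <= r -> exp_sum n r <= expR r.
Proof.
move=> r0; rewrite -(cvg_lim _ (@exp_sum_cvg r))//.
apply: nondecreasing_cvgn_le; last exact: cvgP (@exp_sum_cvg r).
apply/nondecreasing_seqP => m; rewrite /exp_sum big_ord_recr lerDl /=.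
by rewrite mulr_ge0 ?exprn_ge0.
Qed.

Lemma exp_sum_conj n (a : R[i]) : exp_sum n (conj a) = conj (exp_sum n a).
Proof.
rewrite /exp_sum rmorph_sum; apply: eq_bigr => i _.
by rewrite rmorphM fmorphV rmorphXn rmorph_nat.
Qed.

Lemma exp_sum_real n (r : R) : exp_sum n (r%:C%C) = (exp_sum n r)%:C%C.
Proof.
rewrite /exp_sum rmorph_sum; apply: eq_bigr => i _.
by rewrite rmorphM fmorphV rmorphXn rmorph_nat.
Qed.

(* |exp z|^2 = exp z * exp (conj z) = exp (2 Re z), via the Cauchy product. *)
Lemma exp_sum_sqr_cvg (z : R[i]) :
  rnorm (exp_sum n z) ^+ 2 @[n --> \oo] --> expR (2 * Re z).
Proof.
have zz : z + conj z = (2 * Re z)%:C%C.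
  by case: z => a b; apply/eqP; rewrite eq_complex /= subrr mulr_natl mulr2n !eqxx.
have h1 : exp_defect n (rnorm z) (rnorm z) @[n --> \oo] --> (0 : R).
  rewrite -(subrr (expR (rnorm z + rnorm z))) {1}expRD.
  by apply: cvgB; [apply: cvgM|]; exact: exp_sum_cvg.
have h2 : rnorm (exp_sum n z) ^+ 2 - exp_sum n (2 * Re z) @[n --> \oo] --> (0 : R).
  apply/norm_cvg0P; apply: squeeze_cvgr (@cvg_cst _ 0 _ _ _) h1.
  apply: nearW => n; rewrite normr_ge0 /=.
  have -> : `|rnorm (exp_sum n z) ^+ 2 - exp_sum n (2 * Re z)| =
      rnorm (exp_defect n z (conj z)).
    rewrite /exp_defect zz exp_sum_conj mulJ exp_sum_real -rmorphB /=.
    by rewrite rnorm_real.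
  by rewrite -{2}(rnormJ z); exact: rnorm_exp_defect.
rewrite -[X in _ --> X]add0r.
rewrite (_ : (fun n => _) = (fun n => (rnorm (exp_sum n z) ^+ 2 - exp_sum n (2 * Re z)) +
    exp_sum n (2 * Re z))); last by apply/funext => n; rewrite subrK.
exact: cvgD h2 (@exp_sum_cvg _).
Qed.

End exponential_sums.

(** * Exponentials of bounded operators and of multiplication operators *)

Section operator_exponential.
Context (R : realType) (H : hilbertType R).
Let HC := @hilbert_scomplete R H.
Variable A : H -> H.
Hypothesis bA : bounded_op A.

Definition op_exp_sum n x : H := \sum_(k < n) (k`!%:R : R[i])^-1 *: iter k A x.

Lemma iter_rnorm_le (M : R) : 0 <= M -> (forall x, rnorm (A x) <= M * rnorm x) ->
  forall k x, rnorm (iter k A x) <= M ^+ k * rnorm x.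
Proof.
move=> M0 hM; elim=> [|k IH] x; first by rewrite expr0 mul1r.
by rewrite iterS exprS -mulrA; apply: le_trans (hM _) _; rewrite ler_wpM2l.
Qed.

(** Each term is dominated by the corresponding term of the scalar series at M; the Cauchy property
    and the norm bound both follow. *)
Lemma op_exp_sum_dist (M : R) : 0 <= M -> (forall x, rnorm (A x) <= M * rnorm x) ->
  forall x n m, (m <= n)%N -> rnorm (op_exp_sum n x - op_exp_sum m x) <=
    exp_sum n M * rnorm x - exp_sum m M * rnorm x.
Proof.
move=> M0 hM x n m /subnK <-; elim: (n - m)%N => [|k IH].
  by rewrite add0n !subrr rnorm0.
rewrite addSn /op_exp_sum big_ord_recr /= -/(op_exp_sum (k + m) x).
rewrite /exp_sum big_ord_recr /= -/(exp_sum (k + m) M) addrAC mulrDl [leRHS]addrAC.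
apply: le_trans (rnormD _ _) _; apply: lerD; first exact: IH.
by rewrite rnormZ rnorm_fact -mulrA ler_wpM2l// iter_rnorm_le.
Qed.

Lemma op_exp_cvg x : scvg (op_exp_sum ^~ x) (op_exp A x).
Proof.
have [M M0 hM] := bounded_op_ge0 bA.
have h : exp_sum n M * rnorm x @[n --> \oo] --> expR M * rnorm x.
  by apply: cvgMl; exact: exp_sum_cvg.
have [y hy] := HC (scauchy_le (op_exp_sum_dist (ltW M0) hM x) h).
suff -> : op_exp A x = y by [].
apply: scvg_limn; rewrite (_ : series _ = op_exp_sum ^~ x)//.
by apply/funext => n; rewrite /series /= big_mkord.
Qed.

Lemma iter_linear k : linear (iter k A).
Proof.
by elim: k => [//|k IH] c x y; rewrite !iterS IH; case: bA => -> _.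
Qed.

Lemma op_exp_bounded : bounded_op (op_exp A).
Proof.
split=> [c x y|].
  apply: scvg_unique (op_exp_cvg _) _.
  have := scvgD (scvgZ c (op_exp_cvg x)) (op_exp_cvg y).
  congr scvg; apply/funext => n; rewrite /op_exp_sum scaler_sumr -big_split /=.
  apply: eq_bigr => k _; rewrite iter_linear scalerDr !scalerA.
  by rewrite [c * _]mulrC.
have [M M0 hM] := bounded_op_ge0 bA; exists (expR M) => x.
have h := scvg_rnorm (op_exp_cvg x); rewrite -(cvg_lim _ h)//.
apply: limr_le; first exact: cvgP h.
apply: nearW => n; have := @op_exp_sum_dist M (ltW M0) hM x n 0 (leq0n n).
rewrite /op_exp_sum /exp_sum !big_ord0 subr0 mul0r subr0 => h1.
apply: le_trans h1 _; rewrite ler_wpM2r ?rnorm_ge0//.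
exact: exp_sum_le_expR (ltW M0).
Qed.

End operator_exponential.

Section multiplication_operators.
Context d (V : measurableType d) (R : realType).
Variable xi : {measure set V -> \bar R}.
Context (H : hilbertType R).
Variables (A : H -> H) (U : H -> L2 xi) (z : V -> R[i]).
Hypothesis bA : bounded_op A.
Hypothesis uU : unitary_op U.
Hypothesis mz : cmeasurable_fun setT z.
Hypothesis Uz : forall x, {ae xi, forall v, U (A x) v = z v * U x v}.
Variable B : R.
Hypothesis zB : {ae xi, forall v, rnorm (z v) <= B}.

Lemma iter_mulE k x : {ae xi, forall v, U (iter k A x) v = z v ^+ k * U x v}.
Proof.
elim: k => [|k IH]; first by apply: aeW => v; rewrite expr0 mul1r.
by apply: filterS2 IH (Uz (iter k A x)) => v h1; rewrite iterS => ->; rewrite h1 exprS mulrA.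
Qed.

Lemma op_exp_sum_mulE n x :
  {ae xi, forall v, U (op_exp_sum A n x) v = exp_sum n (z v) * U x v}.
Proof.
have lU := unitary_linear uU.
rewrite /op_exp_sum (linear_map_sum lU _ (fun k => (k`!%:R : R[i])^-1 *: iter k A x)).
under eq_bigr do rewrite (linear_mapZ lU).
have := L2_sum n (fun k => (k`!%:R : R[i])^-1) (fun k => U (iter k A x)).
apply: filterS2 (ae_foralln (fun k => iter_mulE k x)) => v h1 ->.
by rewrite /exp_sum mulr_suml; apply: eq_bigr => k _; rewrite h1 mulrA.
Qed.

(** The partial sums act as multiplication by [exp_sum n (z v)], whose squared modulus tends to
    exp(2 Re z(v)) and is at most exp(B)^2. Dominated convergence passes to the limit in the
    norms. *)
Lemma op_exp_rnorm x :
  (\int[xi]_v (expR (2 * Re (z v)) * rnorm (U x v) ^+ 2)%:E =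
   (rnorm (op_exp A x) ^+ 2)%:E)%E.
Proof.
pose f n v := (rnorm (U (op_exp_sum A n x) v) ^+ 2)%:E.
pose g v := (expR (2 * Re (z v)) * rnorm (U x v) ^+ 2)%:E.
pose h v := (expR B ^+ 2 * rnorm (U x v) ^+ 2)%:E.
have mf n : measurable_fun setT (f n) by exact: L2_measurable_sqr.
have mg : measurable_fun setT g.
  apply/measurable_EFinP; apply: measurable_funM; last first.
    by apply/measurable_EFinP; exact: L2_measurable_sqr.
  apply: measurableT_comp => //; apply: measurable_funM => //; exact: mz.1.
have ih : xi.-integrable setT h.
  rewrite /h; under eq_fun do rewrite EFinM; apply: integrableZl => //.
  apply/integrableP; split; first exact: L2_measurable_sqr.
  by under eq_integral do rewrite /= ger0_norm ?sqr_ge0//; exact: L2_sqint.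
have aeE := ae_foralln (fun n => op_exp_sum_mulE n x).
have fg : {ae xi, forall v, setT v -> f n v @[n --> \oo] --> g v}.
  apply: filterS aeE => v hv _; rewrite /f /g.
  under eq_fun do rewrite hv rnormM exprMn.
  apply: cvg_EFin; first exact: nearW.
  by apply: cvgMl; exact: exp_sum_sqr_cvg.
have fh : {ae xi, forall v, forall n, setT v -> (`|f n v| <= h v)%E}.
  apply: filterS2 aeE zB => v hv zv n _.
  rewrite gee0_abs ?lee_fin ?sqr_ge0// /f hv rnormM exprMn ler_wpM2r ?sqr_ge0//.
  rewrite lerXn2r ?nnegrE ?rnorm_ge0 ?expR_ge0//.
  apply: le_trans (rnorm_exp_sum _ _) _.
  by apply: le_trans (exp_sum_le_expR _ (rnorm_ge0 _)) _; rewrite ler_expR.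
have [_ _ lim1] := dominated_convergence measurableT mf mg fg ih fh.
have lim2 : ((\int[xi]_v f n v) @[n --> \oo] --> (rnorm (op_exp A x) ^+ 2)%:E)%E.
  rewrite (_ : (fun n => _) = (fun n => (rnorm (op_exp_sum A n x) ^+ 2)%:E)); last first.
    by apply/funext => n; rewrite L2_rnorm_sqr unitary_rnorm.
  have hn := scvg_rnorm (op_exp_cvg bA x).
  apply: cvg_EFin; first exact: nearW.
  rewrite (_ : fine \o _ = fun n => rnorm (op_exp_sum A n x) * rnorm (op_exp_sum A n x)).
    by rewrite expr2; exact: (cvgM hn hn).
  by apply/funext => n /=; rewrite expr2.
exact: (cvg_unique _ lim1 lim2).
Qed.

End multiplication_operators.

(** * The trace norm as a weighted integral of the kernel *)

Section weighted_trace.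
Context d (V : measurableType d) (R : realType).
Variable xi : {sigma_finite_measure set V -> \bar R}.
Local Notation G := (L2 xi).
Hypotheses (GC : scomplete G) (Gd : exists u : nat -> G, sdense u).

Lemma S2_bounded (H : preHilbertType R) (K : H -> H) : S2 K -> bounded_op K.
Proof. by rewrite /S2 /hsnorm /=; case: asboolP. Qed.

Section hilbert_schmidt.
Variables (K : G -> G) (k : V * V -> R[i]).
Hypothesis SK : S2 K.
Hypothesis mk : cmeasurable_fun setT k.
Hypothesis kK : forall f : G, {ae xi, forall v,
    cintegrable xi setT (fun v' => k (v, v') * f v') /\
    K f v = cintegral xi setT (fun v' => k (v, v') * f v')}.

Lemma hsnorm_series (e : nat -> G) :
  (forall F : G -> \bar R, (forall x, 0 <= F x)%E -> F 0 = 0%E ->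
    (\esum_(x in @onb R G) F x = \sum_(0 <= n <oo) F (e n))%E) ->
  (hsnorm K ^+ 2 = \sum_(0 <= n <oo) (rnorm (K (e n)) ^+ 2)%:E)%E.
Proof.
move=> esumE; have bK := S2_bounded SK; rewrite /hsnorm asboolT// esumE.
- rewrite sqr_sqrte//; apply: nneseries_ge0 => n _ _; by rewrite lee_fin sqr_ge0.
- by move=> x; rewrite lee_fin sqr_ge0.
- by rewrite (linear_map0 bK.1) rnorm0 expr0n.
Qed.

Lemma hsnorm_lty (e : nat -> G) :
  (forall F : G -> \bar R, (forall x, 0 <= F x)%E -> F 0 = 0%E ->
    (\esum_(x in @onb R G) F x = \sum_(0 <= n <oo) F (e n))%E) ->
  (\sum_(0 <= n <oo) (rnorm (K (e n)) ^+ 2)%:E < +oo)%E.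
Proof.
move=> esumE; rewrite -(hsnorm_series esumE).
have : (hsnorm K < +oo)%E by [].
have : (0 <= hsnorm K)%E.
  by rewrite /hsnorm; case: asboolP => // _; exact: sqrte_ge0.
by case: (hsnorm K) => [r||]//= _ _; rewrite ltry.
Qed.

Lemma hsnorm_kernel : (hsnorm K ^+ 2 =
  \int[xi]_v \int[xi]_v' (rnorm (k (v, v')) ^+ 2)%:E)%E.
Proof.
have [w /onb_enum[f [onf tf esumf]]] := Gd.
have K2 := hsnorm_lty esumf; have bK := S2_bounded SK.
rewrite (hsnorm_series esumf) -integral_hs_series.
apply: ae_eq_integral => //.
- apply: ge0_emeasurable_sum => [n x _ _|n _]; first by rewrite lee_fin sqr_ge0.
  exact: L2_measurable_sqr.
- have mk2 : measurable_fun setT (fun z => (rnorm (k z) ^+ 2)%:E).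
    by apply/measurable_EFinP; exact: measurable_rnorm2.
  by apply: (measurable_fun_fubini_tonelli_F (fun z => (rnorm (k z) ^+ 2)%:E)) => // z; rewrite lee_fin sqr_ge0.
- by apply: filterS (hs_series_kernel GC onf tf bK K2 mk kK) => v -> _.
Qed.

Variables (H : hilbertType R) (Hd : exists u : nat -> H, sdense u).
Variables (U : H -> G) (Phi g : H -> H) (om : V -> R).
Hypotheses (uU : unitary_op U) (bPhi : bounded_op Phi) (pg : positive_op g).
Hypothesis Kg : K \o adj K = U \o g \o adj U.
Hypotheses (mom : measurable_fun setT om) (om0 : forall v, 0 <= om v).
Hypothesis Phi_om : forall x,
  (\int[xi]_v (om v * rnorm (U x v) ^+ 2)%:E = (rnorm (Phi x) ^+ 2)%:E)%E.

Let HC := @hilbert_scomplete R H.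

(** With W = Phi U^H K one has Phi g Phi^H = W W^H. Its trace is the double series of |<W^H e_n,
    f_m>|^2; summing over n first gives the sum of |W f_m|^2, and [Phi_om] writes each term as an
    integral of |K f_m|^2 with weight om. *)
Lemma weighted_trace : (trnorm (Phi \o g \o adj Phi) =
  \int[xi]_v ((om v)%:E * \int[xi]_v' (rnorm (k (v, v')) ^+ 2)%:E))%E.
Proof.
have [u /onb_enum[e [one te esume]]] := Hd.
have [w /onb_enum[f [onf tf esumf]]] := Gd.
have K2 := hsnorm_lty esumf; have bK := S2_bounded SK.
have baP := adj_bounded HC Hd bPhi.
have aP := adjP HC Hd bPhi; have aK := adjP GC Gd bK.
have [_ Uip _] := uU.
pose Ws x := adj K (U (adj Phi x)).
pose W y := Phi (adj U (K y)).
have WW y x : ip (W y) x = ip y (Ws x).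
  by rewrite /W aP -Uip unitaryVK// aK.
have gE x : ip (g x) x = (rnorm (adj K (U x)) ^+ 2)%:C%C.
  rewrite -Uip -[X in U (g X)](unitaryK uU).
  by have /= <- := congr1 (@^~ (U x)) Kg; rewrite aK ip_sqr.
have PE x : ip ((Phi \o g \o adj Phi) x) x = (rnorm (Ws x) ^+ 2)%:C%C.
  by rewrite /= aP gE.
have pP : positive_op (Phi \o g \o adj Phi).
  apply: positive_opP.
    by apply: bounded_op_comp => //; apply: bounded_op_comp => //; exact: pg.1.
  by move=> x; exists (rnorm (Ws x) ^+ 2); [exact: sqr_ge0|exact: PE].
rewrite (trnorm_positive HC Hd esume pP).
under eq_eseriesr do rewrite PE /= -(parseval onf GC tf).
rewrite nneseries_interchange; last by move=> i j; rewrite lee_fin sqr_ge0.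
have Wf m : (\sum_(0 <= n <oo) (rnorm (ip (Ws (e n)) (f m)) ^+ 2)%:E =
    \int[xi]_v (om v * rnorm (K (f m) v) ^+ 2)%:E)%E.
  under eq_eseriesr do rewrite ipC rnormJ -WW.
  by rewrite (parseval one HC te) -Phi_om unitaryVK.
under eq_eseriesr do rewrite Wf.
rewrite -integral_nneseries//; last 2 first.
- move=> n; apply/measurable_EFinP; apply: measurable_funM => //.
  by apply/measurable_EFinP; exact: L2_measurable_sqr.
- by move=> n v _; rewrite lee_fin mulr_ge0// sqr_ge0.
have E v : (\sum_(0 <= n <oo) (om v * rnorm (K (f n) v) ^+ 2)%:E =
  (om v)%:E * \sum_(0 <= n <oo) (rnorm (K (f n) v) ^+ 2)%:E)%E.
  by rewrite -nneseriesZl// => n _; rewrite lee_fin sqr_ge0.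
apply: ae_eq_integral => //.
- apply: ge0_emeasurable_sum => [n x _ _|n _].
    by rewrite lee_fin mulr_ge0// sqr_ge0.
  apply/measurable_EFinP; apply: measurable_funM => //.
  by apply/measurable_EFinP; exact: L2_measurable_sqr.
- apply: emeasurable_funM; first exact/measurable_EFinP.
  have mk2 : measurable_fun setT (fun z => (rnorm (k z) ^+ 2)%:E).
    by apply/measurable_EFinP; exact: measurable_rnorm2.
  by apply: (measurable_fun_fubini_tonelli_F (fun z => (rnorm (k z) ^+ 2)%:E)) => // z; rewrite lee_fin sqr_ge0.
- by apply: filterS (hs_series_kernel GC onf tf bK K2 mk kK) => v hv _; rewrite /= E hv.
Qed.

End hilbert_schmidt.
End weighted_trace.

(** * Bounds on the modulus and argument of 1 - e^{-it} *)

Section angle_bounds.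
Context (R : realType).

Lemma carg_le (z : R[i]) : `|carg z| <= pi.
Proof.
have h : -1 <= Re z / rnorm z <= 1.
  have [->|nz] := eqVneq (rnorm z) 0; first by rewrite invr0 mulr0 lerN10 ler01.
  have zp : 0 < rnorm z by rewrite lt_neqAle eq_sym nz rnorm_ge0.
  rewrite ler_pdivlMr// ler_pdivrMr// mulN1r mul1r -ler_norml.
  exact: Re_le_rnorm.
rewrite /carg; case: ifP => _; rewrite ?normrN ger0_norm ?acos_ge0 ?acos_lepi//.
Qed.

Lemma sin_mean_value (s : R) : 0 <= s -> exists2 x, 0 <= x <= s & sin s = s * cos x.
Proof.
rewrite le_eqVlt => /orP[/eqP <-|s0].
  by exists 0; rewrite ?lexx// sin0 mul0r.
have [x /[!in_itv] /= /andP[x0 xs]] := @MVT R sin cos 0 s s0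
  (fun x _ => is_derive_sin x) (continuous_subspaceT (@continuous_sin R)).
rewrite sin0 !subr0 mulrC => e; exists x => //.
by rewrite !ltW.
Qed.

Lemma sin_le_id (s : R) : 0 <= s -> sin s <= s.
Proof.
move=> s0; have [x _ ->] := sin_mean_value s0.
by rewrite ler_piMr// cos_le1.
Qed.

Lemma cos_sqr_ge (u : R) : 0 <= u <= pi / 4 -> 0 <= cos u /\ 2^-1 <= cos u ^+ 2.
Proof.
move=> /andP[u0 u1]; have p := pi_gt0 R; split.
  by apply: cos_ge0_pihalf; apply/andP; split; lra.
have : 0 <= cos (u *+ 2).
  by apply: cos_ge0_pihalf; rewrite [u *+ 2]mulr2n; apply/andP; split; lra.
rewrite cos_mulr2n [_ *+ 2]mulr2n; lra.
Qed.

(** With u = s/2, sin s = 2 sin u cos u = s cos x cos u for some x in [0, u]. Both angles are at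
    most pi/4, where cos^2 >= 1/2. *)
Lemma half_le_sin (s : R) : 0 <= s <= pi / 2 -> s / 2 <= sin s.
Proof.
move=> /andP[s0 s1]; pose u := s / 2.
have u0 : 0 <= u by rewrite divr_ge0.
have u1 : u <= pi / 4 by rewrite /u; lra.
have [x /andP[x0 xu] xE] := sin_mean_value u0.
have [|c0 c1] := @cos_sqr_ge x; first by rewrite x0 (le_trans xu).
have [|d0 d1] := @cos_sqr_ge u; first by rewrite u0.
have -> : s = u *+ 2 by rewrite [RHS]mulr2n /u; lra.
rewrite sin_mulr2n xE.
have h : 2^-1 <= cos x * cos u.
  rewrite -ler_sqr ?nnegrE ?mulr_ge0// exprMn.
  by apply: le_trans (_ : 2^-1 * 2^-1 <= _); [rewrite expr2|apply: ler_pM].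
have : u * 2^-1 <= u * (cos x * cos u) by rewrite ler_wpM2l.
rewrite [u *+ 2]mulr2n [_ *+ 2]mulr2n; set w := u * (cos x * cos u).
have -> : cos u * (u * cos x) = w by rewrite /w; ring.
lra.
Qed.

(** |1 - e^{-it}|^2 = 2 - 2 cos t = 4 sin^2(t/2). *)
Lemma rnorm_1Bexpi (t : R) : rnorm (1 - expi (- t)) = 2 * `|sin (t / 2)|.
Proof.
apply: (@pexpIrn _ 2) => //; rewrite ?nnegrE ?rnorm_ge0 ?mulr_ge0//.
rewrite rnormE /= cosN sinN exprMn real_normK ?num_real//.
have tE : t = (t / 2) *+ 2 by rewrite [RHS]mulr2n; lra.
have ct : cos t = 2 * cos (t / 2) ^+ 2 - 1.
  by rewrite {1}tE cos_mulr2n [_ *+ 2]mulr2n; lra.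
have h1 := cos2Dsin2 t; have h2 := cos2Dsin2 (t / 2).
have -> : sin (t / 2) ^+ 2 = 1 - cos (t / 2) ^+ 2 by lra.
have -> : (0 - - sin t) ^+ 2 = 1 - cos t ^+ 2 by rewrite sub0r opprK; lra.
rewrite ct; ring.
Qed.

Lemma rnorm_1Bexpi_bounds (t : R) : `|t| <= pi ->
  `|t| / 2 <= rnorm (1 - expi (- t)) <= `|t|.
Proof.
move=> tpi; rewrite rnorm_1Bexpi.
have -> : `|sin (t / 2)| = sin (`|t| / 2).
  have h : 0 <= sin (`|t| / 2).
    by apply: le_trans (half_le_sin _); rewrite ?divr_ge0//= ler_pM2r.
  move: h; case: (ger0P t) => t0 h; first by rewrite ger0_norm.
  by rewrite -[LHS]normrN -sinN -mulNr ger0_norm.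
have h1 : `|t| / 2 / 2 <= sin (`|t| / 2).
  by apply: half_le_sin; rewrite ?divr_ge0//= ler_pM2r.
have h2 : sin (`|t| / 2) <= `|t| / 2 by apply: sin_le_id; rewrite divr_ge0.
by apply/andP; split; lra.
Qed.

End angle_bounds.

(** * Weights of the fractional integration operator *)

Section fractional_integration_weights.
Context d (V : measurableType d) (R : realType).
Variable xi : {measure set V -> \bar R}.
Context (H : hilbertType R).
Variables (D : H -> H) (U : H -> L2 xi) (dv : V -> R[i]).
Hypotheses (bD : bounded_op D) (uU : unitary_op U) (dvb : ess_bounded xi dv).
Hypothesis D_svd : forall f : L2 xi,
  {ae xi, forall v, U (D (adj U f)) v = dv v * f v}.
Implicit Types l : torus R.

Definition fi_exponent l : R[i] := cln (1 - expi (- torus_val l)).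

(** This is |(1 - e^{-il})^{-d(v)}|^2, expressed by a real exponential. *)
Definition fi_weight l v : R := expR (2 * Re (- (fi_exponent l * dv v))).

(** The power |l|^{-2b} as an exponential, positive for every l and b; it is matched with the power
    only for l <> 0. *)
Definition log_weight l (b : R) : R := expR (- 2 * b * ln `|torus_val l|).

Lemma torus_val_le l : `|torus_val l| <= pi.
Proof.
case: l => t /= h; move: (h); rewrite in_itv /= => /andP[t1 t2].
by rewrite ler_norml t1 ltW.
Qed.

Lemma log_weightE l b : torus_val l != 0 ->
  `|torus_val l| `^ (- 2 * b) = log_weight l b.
Proof. by move=> l0; rewrite /powR normr_eq0 (negbTE l0). Qed.

Lemma FI_E l : torus_val l != 0 ->
  FI D l = op_exp (fun x => fi_exponent l *: - D x).
Proof. by move=> l0; rewrite /FI (negbTE l0). Qed.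

Let A l x : H := fi_exponent l *: - D x.

Let bA l : bounded_op (A l).
Proof.
apply: bounded_opZ; have := bounded_opZ (-1) bD.
by congr bounded_op; apply/funext => x; rewrite scaleN1r.
Qed.

Lemma FI_bounded l : torus_val l != 0 -> bounded_op (FI D l).
Proof. by move=> l0; rewrite FI_E//; exact: (op_exp_bounded (bA l)). Qed.

Lemma measurable_fi_weight l : measurable_fun setT (fi_weight l).
Proof.
have [mdv _] := dvb.
apply: measurableT_comp => //; apply: measurable_funM => //.
have [h _] := cmeasurable_funM (cmeasurable_cst V (- fi_exponent l)) mdv.
rewrite (_ : (fun v => _) = Re \o (fun v => - fi_exponent l * dv v))//.
by apply/funext => v /=; rewrite mulNr.
Qed.

Lemma FI_rnorm l x : torus_val l != 0 ->
  (\int[xi]_v (fi_weight l v * rnorm (U x v) ^+ 2)%:E =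
   (rnorm (FI D l x) ^+ 2)%:E)%E.
Proof.
move=> l0; have [mdv [M hM]] := dvb; have lU := unitary_linear uU.
rewrite FI_E//.
apply: (op_exp_rnorm (A := A l) (z := fun v => - (fi_exponent l * dv v))
  (bA l) uU _ _ (B := rnorm (fi_exponent l) * M)).
- have := cmeasurable_funM (cmeasurable_cst V (- fi_exponent l)) mdv.
  by congr cmeasurable_fun; apply/funext => v; rewrite mulNr.
- move=> y; rewrite /A (linear_mapZ lU) (linear_mapN lU).
  have h := D_svd (U y); rewrite unitaryK// in h.
  rewrite scalerN -scaleNr.
  by apply: filterS2 h (L2Z (- fi_exponent l) (U (D y))) => v -> ->; rewrite !mulNr mulrA.
- by apply: filterS hM => v h; rewrite rnormN rnormM ler_wpM2l ?rnorm_ge0.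
Qed.

(** The term 2 M ln 2 comes from |l|/2 <= |1 - e^{-il}| <= |l| with |Re d| <= M, and 2 M pi from the
    argument, at most pi, times |Im d| <= M. *)
Definition weight_gap (M : R) : R := 2 * M * ln 2 + 2 * M * pi.

(** The real part of - ln(1 - e^{-il}) d is - ln(rho) Re d + arg Im d, with rho = |1 - e^{-il}|.
    Replacing rho by |l| and dropping the argument changes twice this quantity by at most the
    gap. *)
Lemma fi_weight_bounds l v M : torus_val l != 0 -> rnorm (dv v) <= M ->
  expR (- weight_gap M) * log_weight l (Re (dv v)) <= fi_weight l v <=
  expR (weight_gap M) * log_weight l (Re (dv v)).
Proof.
move=> l0 dM; set t := torus_val l.
have tp : 0 < `|t| by rewrite normr_gt0.
have /andP[r1 r2] := rnorm_1Bexpi_bounds (torus_val_le l).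
rewrite -/t in r1 r2; set rho := rnorm (1 - expi (- t)) in r1 r2.
have rp : 0 < rho by apply: lt_le_trans r1; rewrite divr_gt0.
have a1 : ln rho <= ln `|t| by rewrite ler_ln ?posrE.
have a2 : ln `|t| - ln 2 <= ln rho.
  by rewrite -ln_div ?posrE// ler_ln ?posrE// divr_gt0.
have b1 : `|Re (dv v)| <= M by exact: le_trans (Re_le_rnorm _) dM.
have b2 : `|Im (dv v)| <= M by exact: le_trans (Im_le_rnorm _) dM.
have b3 := carg_le (1 - expi (- t)).
have zE : Re (- (fi_exponent l * dv v)) =
    - (ln rho * Re (dv v)) + carg (1 - expi (- t)) * Im (dv v).
  by rewrite ReN ReM /= opprB addrC.
rewrite /fi_weight /log_weight zE -!expRD !ler_expR -/t /weight_gap.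
have M0 : 0 <= M by exact: le_trans (normr_ge0 _) b1.
set a := carg (1 - expi (- t)) in b3 zE *; set x := Re (dv v) in b1 zE *.
set y := Im (dv v) in b2 zE *.
have k1 : `|x * (ln `|t| - ln rho)| <= M * ln 2.
  by rewrite normrM ler_pM// ger0_norm; lra.
have k2 : `|a * y| <= M * pi by rewrite normrM mulrC ler_pM.
move: k1 k2; rewrite !ler_norml => /andP[k1 k1'] /andP[k2 k2'].
by apply/andP; split; lra.
Qed.

Lemma log_weight_le l b M : torus_val l != 0 -> `|b| <= M ->
  log_weight l b <= expR (2 * M * `|ln `|torus_val l| |).
Proof.
move=> l0 bM; rewrite /log_weight ler_expR; apply: le_trans (ler_norm _) _.
rewrite normrM mulNr normrN normrM (ger0_norm (ler0n R 2)).
by rewrite ler_wpM2r// ler_wpM2l.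
Qed.

End fractional_integration_weights.

(** * Measurability on the torus and Tonelli on the triple product *)

Section torus_measurability.
Context (R : realType).

Lemma measurable_torus_val : measurable_fun setT (@torus_val R : torus R -> R).
Proof.
move=> _ Y mY; rewrite setTI; exists Y => //.
by rewrite setTI.
Qed.

Lemma measurable_punctured (eta : R) : measurable (punctured eta).
Proof.
have mv : measurable_fun setT (fun l : torus R => `|torus_val l|).
  exact: measurableT_comp measurable_torus_val.
rewrite (_ : punctured eta = (fun l : torus R => `|torus_val l|) @^-1` `]0, eta[%classic).
  by rewrite -[X in measurable X]setTI; exact: mv.
by apply/seteqP; split => l /=; rewrite in_itv.
Qed.

End torus_measurability.

Section square_measure.
Context d (V : measurableType d) (R : realType).
Variable xi : {sigma_finite_measure set V -> \bar R}.

(* An alias of [xi \x xi]: on [\x] itself, the canonical sigma-finite structure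
   found by unification is the one of products of subprobabilities. *)
Definition square_measure := product_measure1 xi xi.
HB.instance Definition _ := Measure.on square_measure.

Lemma square_measure_sigma_finite : sigma_finite setT square_measure.
Proof.
have /sigma_finiteP[F [TF ndF Foo]] := sigma_finiteT xi.
exists (fun n => F n `*` F n) => [|k].
  rewrite -setXTT TF predeqE => -[x y]; split.
    move=> [/= [n _ Fnx] [k _ Gky]]; exists (maxn n k) => //; split.
    - by move: x Fnx; exact/subsetPset/ndF/leq_maxl.
    - by move: y Gky; exact/subsetPset/ndF/leq_maxr.
  by move=> [n _ []/= ? ?]; split; exists n.
have [? ?] := Foo k; split; first exact: measurableX.
by rewrite /square_measure product_measure1E// lte_mul_pinfty// ge0_fin_numE.
Qed.

HB.instance Definition _ := Measure_isSigmaFinite.Build _ _ _ square_measure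
  square_measure_sigma_finite.

End square_measure.

Section kernel_energy.
Context d (V : measurableType d) (R : realType).
Variable xi : {sigma_finite_measure set V -> \bar R}.
Variable kappa : V * V * torus R -> R[i].
Hypothesis mkappa : cmeasurable_fun setT kappa.
Implicit Types (b : V -> R) (l : torus R).
Local Open Scope ereal_scope.

Definition row_energy l v := \int[xi]_v' (rnorm (kappa (v, v', l)) ^+ 2)%:E.

(** The inner integrals of conditions (ii) and (iii) at a fixed angle; exponent 0 gives the squared
    Hilbert-Schmidt norm of the operator with this kernel. *)
Definition energy b l := \int[xi]_v ((log_weight l (b v))%:E * row_energy l v).

Lemma cmeasurable_slice l : cmeasurable_fun setT (fun z : V * V => kappa (z, l)).
Proof. by case: mkappa => m1 m2; split; [exact: (measurable_fun_pair1 l m1)|exact: (measurable_fun_pair1 l m2)]. Qed.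

Lemma row_energy_ge0 l v : 0 <= row_energy l v.
Proof. by apply: integral_ge0 => v' _; rewrite lee_fin sqr_ge0. Qed.

Lemma measurable_row_energy l : measurable_fun setT (row_energy l).
Proof.
have mk2 : measurable_fun setT (fun z : V * V => (rnorm (kappa (z, l)) ^+ 2)%:E).
  by apply/measurable_EFinP; exact: measurable_rnorm2 (cmeasurable_slice l).
by apply: (measurable_fun_fubini_tonelli_F (fun z : V * V => (rnorm (kappa (z, l)) ^+ 2)%:E)) => // z; rewrite lee_fin sqr_ge0.
Qed.

Lemma log_weight_gt0 l (r : R) : (0 < log_weight l r)%R.
Proof. exact: expR_gt0. Qed.

Lemma measurable_log_weight l b : measurable_fun setT b ->
  measurable_fun setT (fun v => log_weight l (b v)).
Proof.
move=> mb; apply: (measurableT_comp (@measurable_expR R)).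
apply: measurable_funM; last exact: measurable_cst.
by apply: measurable_funM.
Qed.

Lemma energy_ge0 b l : 0 <= energy b l.
Proof.
by apply: integral_ge0 => v _; rewrite mule_ge0 ?row_energy_ge0// lee_fin ltW// log_weight_gt0.
Qed.

Lemma energy0 l : energy (fun=> 0%R) l = \int[xi]_v row_energy l v.
Proof.
apply: eq_integral => v _.
by rewrite /log_weight mulr0 mul0r expR0 mul1e.
Qed.

(** One statement for three comparisons: C2 = 0 relates two weights up to a factor, C1 = 0 bounds a
    weight by a constant, and C1 = C2 = 1 handles the exponent Re_+ d. *)
Lemma integral_weight_le l (f g : V -> R) (C1 C2 : R) :
  (forall v, 0 <= f v)%R -> (forall v, 0 <= g v)%R -> measurable_fun setT g ->
  (0 <= C1)%R -> (0 <= C2)%R -> {ae xi, forall v, (f v <= C1 * g v + C2)%R} ->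
  \int[xi]_v ((f v)%:E * row_energy l v) <=
  C1%:E * \int[xi]_v ((g v)%:E * row_energy l v) + C2%:E * energy (fun=> 0%R) l.
Proof.
move=> f0 g0 mg C10 C20 fg; rewrite energy0 -!ge0_integralZl//; last 4 first.
- exact: measurable_row_energy.
- by move=> v _; exact: row_energy_ge0.
- by apply: emeasurable_funM; [exact/measurable_EFinP|exact: measurable_row_energy].
- by move=> v _; rewrite mule_ge0 ?row_energy_ge0// lee_fin.
rewrite -ge0_integralD//; last 4 first.
- by move=> v _; rewrite !mule_ge0 ?row_energy_ge0// lee_fin.
- apply: measurable_funeM; apply: emeasurable_funM; [exact/measurable_EFinP|].
  exact: measurable_row_energy.
- by move=> v _; rewrite !mule_ge0 ?row_energy_ge0// lee_fin.
- by apply: measurable_funeM; exact: measurable_row_energy.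
apply: ge0_le_integral_ae.
- by move=> v; rewrite !mule_ge0 ?row_energy_ge0// lee_fin.
- by move=> v; rewrite adde_ge0// !mule_ge0 ?row_energy_ge0// lee_fin.
apply: filterS fg => v h; rewrite muleA -EFinM -ge0_muleDl ?lee_fin ?mulr_ge0//.
by rewrite -EFinD lee_wpmul2r ?row_energy_ge0// lee_fin.
Qed.

Section integrated.
Variable mu : {sigma_finite_measure set (torus R) -> \bar R}.

Let F b (z : V * V * torus R) : \bar R :=
  (log_weight z.2 (b z.1.1) * rnorm (kappa z) ^+ 2)%:E.

Let F0 b z : 0 <= F b z.
Proof. by rewrite lee_fin mulr_ge0 ?sqr_ge0// ltW// log_weight_gt0. Qed.

Let mF b : measurable_fun setT b -> measurable_fun setT (F b).
Proof.
move=> mb; apply/measurable_EFinP; apply: measurable_funM.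
  apply: (measurableT_comp (@measurable_expR R)); apply: measurable_funM.
    apply: measurable_funM => //; apply: (measurableT_comp mb).
    exact: (measurableT_comp measurable_fst measurable_fst).
  apply: (measurableT_comp (@measurable_ln R)).
  apply: (measurableT_comp (@normr_measurable R setT)).
  exact: (measurableT_comp (@measurable_torus_val R) measurable_snd).
exact: measurable_rnorm2.
Qed.

Lemma energyE b l : measurable_fun setT b ->
  energy b l = \int[xi \x xi]_z F b (z, l).
Proof.
move=> mb.
have mFl : measurable_fun setT (fun z => F b (z, l)) by exact: (measurable_fun_pair1 l (mF mb)).
rewrite (fubini_tonelli1 (fun z => F b (z, l)))//.
apply: eq_integral => v _; rewrite /fubini_F /row_energy -ge0_integralZl//.
- have [m1 m2] := cmeasurable_slice l.
  apply/measurable_EFinP; apply: measurable_rnorm2.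
  by split; [exact: (measurable_fun_pair2 v m1)|exact: (measurable_fun_pair2 v m2)].
- by move=> v' _; rewrite lee_fin sqr_ge0.
- by rewrite lee_fin ltW// log_weight_gt0.
Qed.

Lemma measurable_energy b : measurable_fun setT b -> measurable_fun setT (energy b).
Proof.
move=> mb; have := @measurable_fun_fubini_tonelli_G _ _ _ _ R (square_measure xi)
  (F b) (mF mb) (F0 b).
apply: eq_measurable_fun => l _; exact/esym/energyE.
Qed.

(** The power and the exponential weight coincide on the punctured set. Tonelli, with the angle as
    outer variable, is applied to the function restricted to that set. *)
Lemma integral_energy b (eta : R) : measurable_fun setT b ->
  \int[(xi \x xi) \x mu]_(z in setT `*` punctured eta)
    (`|torus_val z.2| `^ (- 2 * b z.1.1) * rnorm (kappa z) ^+ 2)%:E =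
  \int[mu]_(l in punctured eta) energy b l.
Proof.
move=> mb; have mp := measurable_punctured eta.
have mD : measurable ([set: V * V] `*` punctured eta) by exact: measurableX.
transitivity (\int[(xi \x xi) \x mu]_(z in setT `*` punctured eta) F b z).
  apply: eq_integral => z; rewrite inE => -[_ /= /andP[z0 _]].
  by rewrite log_weightE// -normr_gt0.
rewrite integral_mkcond [RHS]integral_mkcond.
have mFD : measurable_fun setT (F b \_ (setT `*` punctured eta)).
  by apply/(measurable_restrictT _ mD); exact: measurable_funTS (mF mb).
have FD0 z : 0 <= (F b \_ (setT `*` punctured eta)) z by apply: erestrict_ge0 => y _.
have -> := @fubini_tonelli2 _ _ _ _ R (square_measure xi) mu _ mFD FD0.
apply: eq_integral => l _; rewrite /fubini_G patchE; case: ifPn => lp.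
  rewrite energyE//; apply: eq_integral => z _.
  by rewrite patchE mem_set//; split => //=; rewrite inE in lp.
apply: integral0_eq => z _; rewrite patchE memNset// => -[_ /=] h.
by move: lp; rewrite notin_setE.
Qed.

End integrated.
End kernel_energy.

(** * Conjugation and scaling of positive operators, and assembly of the equivalences *)

Lemma positive_op_conj (R : realType) (H : preHilbertType R) (A B : H -> H) :
  scomplete H -> (exists u : nat -> H, sdense u) -> bounded_op B ->
  positive_op A -> positive_op (B \o A \o adj B).
Proof.
move=> HC Hd bB pA; have aB := adjP HC Hd bB; apply: positive_opP.
  exact: (bounded_op_comp (adj_bounded HC Hd bB) (bounded_op_comp pA.1 bB)).
move=> x; exists (Re (ip (A (adj B x)) (adj B x))); first exact: positive_op_Re.
by rewrite /= aB -pos_real//; case: pA.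
Qed.

(** For a positive operator the trace norm is a series of quadratic forms, each homogeneous in the
    operator. *)
Lemma trnorm_scale (R : realType) (H : preHilbertType R) (A : H -> H) (r : R) :
  scomplete H -> (exists u : nat -> H, sdense u) -> 0 <= r -> positive_op A ->
  (trnorm (r%:C%C *: A) = r%:E * trnorm A)%E.
Proof.
move=> HC Hd r0 pA; have [u /onb_enum[e [one te esume]]] := Hd.
have ipr x : ip ((r%:C%C *: A) x) x = (r * Re (ip (A x) x))%:C%C.
  by rewrite [LHS]ipZl rmorphM /= -pos_real//; case: pA.
have prA : positive_op (r%:C%C *: A).
  apply: positive_opP; first exact: (bounded_opZ _ pA.1).
  by move=> x; exists (r * Re (ip (A x) x)); rewrite ?mulr_ge0 ?positive_op_Re.
rewrite (trnorm_positive HC Hd esume prA) (trnorm_positive HC Hd esume pA).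
rewrite -nneseriesZl; last by move=> n _; rewrite lee_fin positive_op_Re.
by apply: eq_eseriesr => n _; rewrite ipr /= EFinM.
Qed.

Theorem theorem3p3 (R : realType) (d d' : measure_display)
    (Omega : measurableType d) (P : probability Omega R)
    (V : measurableType d') (xi : {sigma_finite_measure set V -> \bar R})
    (mu : {sigma_finite_measure set (torus R) -> \bar R})
    (H0 : hilbertType R) (X : int -> Omega -> H0) (gX : torus R -> H0 -> H0)
    (D : H0 -> H0) (dv : V -> R[i]) (U : H0 -> L2 xi)
    (h : torus R -> L2 xi -> L2 xi) (kappa : V * V * torus R -> R[i])
    (H0_separable : separable H0)
    (X_stationary : weakly_stationary P X) (X_centered : centered P X)
    (X_density : is_spectral_density P X mu gX)
    (D_bounded : bounded_op D) (D_normal : normal_op D)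
    (D_svd : singular_value_decomposition D dv U)
    (h_S2 : forall l, S2 (h l)) (h_L2 : bochner_Lp mu (@hsnorm R (L2 xi)) 2 h)
    (h_density : {ae mu, forall l, h l \o adj (h l) = U \o gX l \o adj U})
    (kappa_h : is_joint_kernel h kappa) :
  let i := S_filter P (FI D) X in
  let ii := exists eta : R, 0 < eta < pi /\
    (\int[(xi \x xi) \x mu]_(z in setT `*` punctured eta)
       (`|torus_val z.2| `^ (- 2 * complex.Re (dv z.1.1)) * rnorm (kappa z) ^+ 2)%:E
     < +oo)%E in
  let iii :=
    (\int[(xi \x xi) \x mu]_(z in setT `*` punctured pi)
       (`|torus_val z.2| `^ (- 2 * Re_plus (dv z.1.1)) *
        rnorm (kappa z) ^+ 2)%:E
     < +oo)%E in
  (i <-> ii) /\ (ii <-> iii).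
Proof.
have HC := @hilbert_scomplete R H0.
have Hd := separable_sdense H0_separable.
have [dvb uU svd] := D_svd.
have GC : scomplete (L2 xi) := unitary_scomplete uU HC.
have Gd : exists u : nat -> L2 xi, sdense u.
  by have [u du] := Hd; exists (U \o u); exact: unitary_sdense.
have [mkap kap] := kappa_h.
have [mdv [M hM]] := dvb.
pose b v := Re (dv v); pose bp v := Re_plus (dv v).
have mb : measurable_fun setT b := mdv.1.
have mbp : measurable_fun setT bp.
  by apply: measurable_maxr => //; exact: measurable_cst.
pose E c l := energy xi kappa c l; pose S := E (fun=> 0).
have E0 c l : (0 <= E c l)%E by exact: energy_ge0.
have mE c : measurable_fun setT c -> measurable_fun setT (E c) by exact: measurable_energy.
have mS : measurable_fun setT S by exact/mE/measurable_cst.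
have SE l : (hsnorm (h l) ^+ 2 = S l)%E.
  by rewrite /S /E energy0 (hsnorm_kernel GC Gd (h_S2 l) (cmeasurable_slice mkap l) (kap l)).
have Sfin l : (S l < +oo)%E.
  rewrite -SE; have : (hsnorm (h l) < +oo)%E by exact: h_S2.
  have : (0 <= hsnorm (h l))%E by rewrite /hsnorm; case: asboolP => // _; exact: sqrte_ge0.
  by case: (hsnorm (h l)) => [r||]//= _ _; rewrite ltry.
have intS : (\int[mu]_l S l < +oo)%E.
  by have [_] := h_L2; under eq_integral do rewrite SE.
have b_le v : rnorm (dv v) <= M -> `|b v| <= M by apply: le_trans; exact: Re_le_rnorm.
have lw0 (l : torus R) (r : R) : 0 <= log_weight l r by rewrite ltW// log_weight_gt0.
have eg0 : expR (weight_gap M) > 0 by exact: expR_gt0.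
pose good l := h l \o adj (h l) = U \o gX l \o adj U.
have [gS Lg gspec gnu] := X_density.
pose T l := trnorm (FI D l \o gX l \o adj (FI D l)).
have TE l : torus_val l != 0 -> good l ->
    (T l = \int[xi]_v ((fi_weight dv l v)%:E * row_energy xi kappa l v))%E.
  move=> l0 gl; apply: (weighted_trace GC Gd (h_S2 l) (cmeasurable_slice mkap l) (kap l)
     (H := H0) Hd uU (FI_bounded D_bounded l0) (gS l).1 gl).
  - exact: measurable_fi_weight dvb l.
  - by move=> v; exact: expR_ge0.
  - by move=> x; exact: (FI_rnorm D_bounded uU dvb svd).
(* Multiplication by exp of the gap is the same in both directions, as the comparison of the weights
   is symmetric. *)
have T_le l : torus_val l != 0 -> good l -> (T l <= (expR (weight_gap M))%:E * E b l)%E.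
  move=> l0 gl; rewrite TE//.
  have := @integral_weight_le _ _ _ xi _ mkap l (fi_weight dv l) (fun v => log_weight l (b v))
    (expR (weight_gap M)) 0 (fun v => expR_ge0 _) (fun v => lw0 _ _)
    (measurable_log_weight l mb) (ltW eg0) (lexx 0).
  rewrite mul0e adde0; apply; apply: filterS hM => v dM.
  by rewrite addr0; have /andP[] := fi_weight_bounds l0 dM.
have T_ge l : torus_val l != 0 -> good l -> (E b l <= (expR (weight_gap M))%:E * T l)%E.
  move=> l0 gl; rewrite TE//.
  have := @integral_weight_le _ _ _ xi _ mkap l (fun v => log_weight l (b v)) (fi_weight dv l)
    (expR (weight_gap M)) 0 (fun v => lw0 _ _) (fun v => expR_ge0 _)
    (measurable_fi_weight dvb l) (ltW eg0) (lexx 0).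
  rewrite mul0e adde0; apply; apply: filterS hM => v dM.
  have /andP[h1 _] := fi_weight_bounds l0 dM.
  by rewrite addr0 mulrC -ler_pdivrMr// -expRN mulrC.
have E_le l : torus_val l != 0 ->
    (E b l <= (expR (2 * M * `|ln `|torus_val l| |))%:E * S l)%E.
  move=> l0.
  have := @integral_weight_le _ _ _ xi _ mkap l (fun v => log_weight l (b v)) (fun=> 0%R)
    0 (expR (2 * M * `|ln `|torus_val l| |)) (fun v => lw0 _ _) (fun v => lexx 0)
    (measurable_cst _) (lexx 0) (expR_ge0 _).
  rewrite mul0e add0e; apply; apply: filterS hM => v dM.
  by rewrite mul0r add0r; apply: log_weight_le => //; exact: b_le.
(* Finiteness at each l <> 0 allows a real-valued minorant later on. *)
have E_fin l : torus_val l != 0 -> (E b l < +oo)%E.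
  move=> l0; apply: le_lt_trans (E_le l l0) _.
  by rewrite lte_mul_pinfty// ?lee_fin ?expR_ge0.
have b_energy (eta : R) : (\int[(xi \x xi) \x mu]_(z in setT `*` punctured eta)
    (`|torus_val z.2| `^ (- 2 * complex.Re (dv z.1.1)) * rnorm (kappa z) ^+ 2)%:E =
    \int[mu]_(l in punctured eta) E b l)%E.
  exact: (@integral_energy _ _ _ xi kappa mkap mu b eta mb).
have bp_energy : (\int[(xi \x xi) \x mu]_(z in setT `*` punctured pi)
    (`|torus_val z.2| `^ (- 2 * Re_plus (dv z.1.1)) * rnorm (kappa z) ^+ 2)%:E =
    \int[mu]_(l in punctured pi) E bp l)%E.
  exact: (@integral_energy _ _ _ xi kappa mkap mu bp pi mbp).
move=> i ii iii.
(* Angles lie in [-pi, pi), so [punctured pi] misses the angle -pi, which mu may charge. Any radius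
   above pi gives all nonzero angles. *)
pose N : set (torus R) := punctured (pi + 1).
have NP l : N l <-> torus_val l != 0.
  rewrite /N /punctured /= normr_gt0; split => [/andP[]//|->] /=.
  by apply: le_lt_trans (torus_val_le l) _; rewrite ltrDl.
have mN : measurable N by exact: measurable_punctured.
(* The pivot: each of the three conditions is compared with this one. *)
pose full := (\int[mu]_(l in N) E b l < +oo)%E.
have pi0 : 0 < (pi : R) by exact: pi_gt0.
have sub_int (A B : set (torus R)) (f : torus R -> \bar R) : (forall l, (0 <= f l)%E) ->
    A `<=` B -> (\int[mu]_(l in A) f l <= \int[mu]_(l in B) f l)%E.
  move=> f0 AB; rewrite [leLHS]integral_mkcond [leRHS]integral_mkcond.
  apply: ge0_le_integral_ae; [exact: erestrict_ge0|exact: erestrict_ge0|].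
  apply: aeW => l; rewrite !patchE; case: ifPn => [lA|_]; last by case: ifP.
  by rewrite mem_set//; apply: AB; rewrite inE in lA.
have full_ii : full -> ii.
  move=> hf; exists (pi / 2); split; first by apply/andP; split; lra.
  rewrite b_energy; apply: le_lt_trans hf; apply: sub_int => // l.
  by move=> /andP[l0 _]; apply/NP; rewrite -normr_gt0.
have iii_ii : iii -> ii.
  (* The bound 1 makes ln |l| <= 0, so that the weight increases with the exponent and Re d <= Re_+
     d can be used; the bound pi/2 keeps eta below pi. *)
  move=> hf; pose eta : R := Num.min 1 (pi / 2).
  have eta1 : eta <= 1 by rewrite /eta ge_min lexx.
  have eta2 : eta <= pi / 2 by rewrite /eta ge_min lexx orbT.
  have eta0 : 0 < eta by rewrite /eta lt_min ltr01 divr_gt0.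
  exists eta; split; first by apply/andP; split => //; lra.
  rewrite b_energy; move: hf; rewrite /iii bp_energy; apply: le_lt_trans.
  apply: (@le_trans _ _ (\int[mu]_(l in punctured eta) E bp l)%E); last first.
    by apply: sub_int => // l /andP[l0 l1]; apply/andP; split => //; lra.
  apply: ge0_le_integral_ae_dom => //; apply: aeW => l /andP[l0 l1].
  have := @integral_weight_le _ _ _ xi _ mkap l (fun v => log_weight l (b v))
    (fun v => log_weight l (bp v)) 1 0 (fun v => lw0 _ _) (fun v => lw0 _ _)
    (measurable_log_weight l mbp) ler01 (lexx 0).
  rewrite mul1e mul0e adde0; apply; apply: aeW => v; rewrite mul1r addr0.
  rewrite /log_weight ler_expR.
  have t1 : ln `|torus_val l| <= 0 by apply: ln_le0; lra.
  have bb : b v <= bp v by rewrite /bp /Re_plus le_max lexx orbT.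
  nra.
have S0 l : (0 <= S l)%E by exact: E0.
have ii_full : ii -> full.
  move=> [eta [/andP[eta0 etapi]]]; rewrite b_energy => hf.
  (* For eta <= |l| <= pi, |ln |l|| is at most |ln eta| + |ln pi|. *)
  pose C := expR (2 * M * (`|ln eta| + `|ln (pi : R)|)).
  have C0 : 0 <= C by exact: expR_ge0.
  have mp := measurable_punctured eta.
  apply: (@le_lt_trans _ _ (\int[mu]_l ((E b \_ (punctured eta)) l + C%:E * S l))%E).
    rewrite [leLHS]integral_mkcond; apply: ge0_le_integral_ae.
    - exact: erestrict_ge0.
    - by move=> l; rewrite adde_ge0 ?mule_ge0 ?lee_fin//; exact: erestrict_ge0.
    apply: aeW => l; rewrite !patchE; case: ifPn => lN; last first.
      by rewrite adde_ge0 ?mule_ge0 ?lee_fin//; case: ifP.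
    have [lp|lp] := boolP (l \in punctured eta).
      by rewrite leeDl// mule_ge0// lee_fin.
    have l0 : torus_val l != 0 by apply/NP; rewrite inE in lN.
    have tp : 0 < `|torus_val l| by rewrite normr_gt0.
    have te : eta <= `|torus_val l|.
      rewrite leNgt; apply/negP => lt; move: lp; rewrite notin_setE; apply.
      by apply/andP.
    (* The essential bound M may be negative only if almost no v exists, that is, if xi is null;
       then the energy is 0. *)
    have M0 : 0 <= M \/ S l = 0%E.
      have [M0|M0] := leP 0 M; first by left.
      right; rewrite /S /E /energy.
      rewrite (ae_eq_integral (cst 0%E))//; first by rewrite integral0.
      + apply: emeasurable_funM; last exact: measurable_row_energy.
        exact: measurable_cst.
      + apply: filterS hM => v dM; exfalso.
        by move: (le_lt_trans dM M0); rewrite ltNge rnorm_ge0.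
    rewrite add0e; apply: le_trans (E_le l l0) _.
    case: M0 => [M0|->]; last by rewrite !mule0.
    rewrite lee_wpmul2r// lee_fin ler_expR ler_wpM2l ?mulr_ge0//.
    have h1 : ln eta <= ln `|torus_val l| by rewrite ler_ln ?posrE.
    have h2 : ln `|torus_val l| <= ln pi by rewrite ler_ln ?posrE// torus_val_le.
    have h3 := ler_norm (- ln eta); have h4 := ler_norm (ln (pi : R)).
    have h5 := normr_ge0 (ln eta); have h6 := normr_ge0 (ln (pi : R)).
    rewrite normrN in h3; rewrite ler_norml; apply/andP; split; lra.
  rewrite ge0_integralD//; last 4 first.
  - by move=> l _; exact: erestrict_ge0.
  - by apply/(measurable_restrictT _ mp); exact: measurable_funTS (mE _ mb).
  - by move=> l _; rewrite mule_ge0 ?lee_fin.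
  - exact: measurable_funeM.
  rewrite -integral_mkcond ge0_integralZl ?lee_fin//.
  apply: lte_add_pinfty; first exact: hf.
  by apply: lte_mul_pinfty; [rewrite lee_fin; exact: C0|exact: isT|exact: intS].
have full_iii : full -> iii.
  move=> hf; rewrite /iii bp_energy.
  (* The weight with exponent Re_+ d is at most the weight with exponent Re d plus 1, and the term 1
     contributes the integrable S. *)
  apply: (@le_lt_trans _ _ (\int[mu]_l ((E b \_ N) l + S l))%E).
    rewrite [leLHS]integral_mkcond; apply: ge0_le_integral_ae.
    - exact: erestrict_ge0.
    - by move=> l; rewrite adde_ge0//; exact: erestrict_ge0.
    apply: aeW => l; have [lp|lp] := boolP (l \in punctured pi); last first.
      by rewrite [leLHS]patchN//; apply: adde_ge0 (S0 l); exact: erestrict_ge0.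
    have lN : l \in N.
      by rewrite inE; apply/NP; move: lp; rewrite inE => /andP[]; rewrite normr_gt0.
    rewrite (patchT _ _ lp) (patchT _ _ lN) -[E b l]mul1e -[S l]mul1e.
    apply: (@integral_weight_le _ _ _ xi _ mkap l (fun v => log_weight l (bp v))
      (fun v => log_weight l (b v)) 1 1 (fun v => lw0 _ _) (fun v => lw0 _ _)
      (measurable_log_weight l mb) ler01 ler01).
    apply: aeW => v; rewrite mul1r.
    rewrite /bp /Re_plus -/(b v); have [bv|bv] := leP 0 (b v).
      by rewrite lerDl.
    by rewrite {1}/log_weight mulr0 mul0r expR0 lerDr.
  rewrite ge0_integralD//; last 2 first.
  - by move=> l _; exact: erestrict_ge0.
  - by apply/(measurable_restrictT _ mN); exact: measurable_funTS (mE _ mb).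
  by rewrite -integral_mkcond; apply: lte_add_pinfty; [exact: hf|exact: intS].
have zeroE (A : H0 -> H0) : 0 = (0 : R)%:C%C *: A :> (H0 -> H0) by rewrite scale0r.
have tr0 (l : torus R) : trnorm (0 : H0 -> H0) = 0%E.
  by rewrite (zeroE (gX l)) trnorm_scale ?mul0e//; exact: (gS l).1.
have full_i : full -> i.
  move=> hf; split; [exact: X_centered|exact: X_stationary|exists mu, gX].
  split; first exact: X_density.
  apply: (@le_lt_trans _ _ (\int[mu]_l ((expR (weight_gap M))%:E * (E b \_ N) l))%E).
    apply: ge0_le_integral_ae.
    - by move=> l; exact: trnormP.
    - by move=> l; rewrite mule_ge0 ?lee_fin ?expR_ge0//; exact: erestrict_ge0.
    apply: filterS h_density => l gl; rewrite patchE; case: ifPn => lN.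
      by apply: T_le => //; apply/NP; rewrite inE in lN.
    (* At l = 0 the transfer operator is 0 by definition, so a possible atom of mu there adds
       nothing. *)
    rewrite mule0 (_ : _ \o adj _ = 0) ?tr0//.
    have /eqP l0 : torus_val l == 0.
      apply/negPn/negP => l0; move: lN; rewrite notin_setE; apply; exact/NP.
    by rewrite /FI l0 eqxx; apply/funext.
  rewrite ge0_integralZl ?lee_fin ?expR_ge0//.
  - rewrite -integral_mkcond.
    by apply: lte_mul_pinfty; [rewrite lee_fin; exact: expR_ge0|exact: isT|exact: hf].
  - by apply/(measurable_restrictT _ mN); exact: measurable_funTS (mE _ mb).
  - by move=> l _; exact: erestrict_ge0.
have i_full : i -> full.
  move=> [_ _ [mu' [g' [dens' fin']]]].
  have [gS' Lg' _ gnu'] := dens'.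
  pose c := expR (weight_gap M).
  have c0 : 0 < c by exact: expR_gt0.
  (* W is a measurable real-valued minorant of the trace norm T, proportional to the energy off l =
     0; it is W that is carried to the measure mu'. *)
  pose W l := c^-1 * fine ((E b \_ N) l).
  have EN l : (0 <= (E b \_ N) l)%E by exact: erestrict_ge0.
  have WE l : (W l)%:E = ((c^-1)%:E * (E b \_ N) l)%E.
    rewrite /W EFinM fineK// (ge0_fin_numE (EN l)).
    have [lN|lN] := boolP (l \in N); last by rewrite patchN// ltry.
    by rewrite (patchT _ _ lN); apply/E_fin/NP; rewrite inE in lN.
  have mEN : measurable_fun setT (E b \_ N).
    by apply/(measurable_restrictT _ mN); exact: measurable_funTS (mE _ mb).
  have W0 t : 0 <= W t by rewrite mulr_ge0 ?fine_ge0// invr_ge0 ltW.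
  have mW : measurable_fun setT W.
    by apply: measurable_funM => //; exact: measurableT_comp mEN.
  have W_le l : good l -> N l -> ((W l)%:E <= T l)%E.
    move=> gl Nl; rewrite WE patchE mem_set// muleC lee_pdivrMr//.
    by rewrite muleC; apply: T_ge => //; exact/NP.
  have WN l : ~ N l -> W l = 0 by move=> Nl; rewrite /W patchE memNset// mulr0.
  have le1 : (\int[mu]_l (W l)%:E <=
      \int[mu']_l trnorm (FI D l \o g' l \o adj (FI D l)))%E.
    apply: (change_dominating_measure HC Hd gS gS' Lg Lg' gnu gnu' mW W0).
    - by move=> l; exact: trnormP.
    (* Where gX vanishes so does T, and W lies below T. *)
    - apply: filterS h_density => l gl gl0.
      have [Nl|/WN//] := pselect (N l).
      apply/eqP; rewrite eq_le W0 andbT -lee_fin.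
      apply: le_trans (W_le l gl Nl) _; rewrite /T gl0.
      have l0 : torus_val l != 0 by exact/NP.
      rewrite (_ : _ \o adj _ = 0) ?tr0//; apply/funext => x /=.
      exact: linear_map0 (FI_bounded D_bounded l0).1.
    - apply: filterS h_density => l gl th th' gg'.
      have [Nl|/WN ->] := pselect (N l); last by rewrite mulr0; exact: trnormP.
      have l0 : torus_val l != 0 by exact/NP.
      have bF := FI_bounded D_bounded l0.
      set r := trace_density g' l / _ in gg' *.
      have r0 : 0 <= r by rewrite divr_ge0// ltW.
      (* When g' = r gX the trace norm for g' is r T, hence at least r W. *)
      have -> : FI D l \o g' l \o adj (FI D l) =
          r%:C%C *: (FI D l \o gX l \o adj (FI D l)).
        by apply/funext => x /=; rewrite gg' [LHS](linear_mapZ bF.1).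
      rewrite trnorm_scale//; last exact: positive_op_conj (gS l).1.
      by rewrite EFinM lee_wpmul2l ?lee_fin//; exact: W_le.
  rewrite /full integral_mkcond.
  rewrite (eq_integral (fun l => c%:E * (W l)%:E)%E); last first.
    by move=> l _; rewrite WE muleA -EFinM mulfV ?mul1e// gt_eqF.
  rewrite ge0_integralZl ?lee_fin ?ltW//.
  - apply: lte_mul_pinfty; [by rewrite lee_fin ltW|exact: isT|].
    exact: le_lt_trans le1 fin'.
  - exact/measurable_EFinP.
  - by move=> l _; rewrite lee_fin.
split; split.
- by move=> /i_full/full_ii.
- by move=> /ii_full/full_i.
- by move=> /ii_full/full_iii.
- exact: iii_ii.
Qed.
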